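(* The monoid variety $\mathbf N=\mathbf A\vee\mathbf R_2$ is a non-finitely based, finitely generated almost Cross variety.
   Context: All varieties are varieties of monoids; $\vee$ is the join in the lattice of monoid varieties, and $\mathbf V\Sigma$ denotes the subvariety of $\mathbf V$ defined within $\mathbf V$ by the identities $\Sigma$. A variety is finitely based if it can be defined by finitely many identities, finitely generated if it is generated by a single finite monoid, and small if its lattice of subvarieties is finite. A variety is Cross if it is finitely based, finitely generated and small; it is almost Cross if it is not Cross but every proper subvariety of it is Cross. In presentations below, $0$ is a zero element and ''$\cup\{1\}$'' means adjoining an identity element to the semigroup so presented. $\mathbf A$ is the variety generated by the monoid $A=\langle a,b,c\mid a^2=a,\ b^2=b,\ ab=ca=0,\ ac=cb=c\rangle\cup\{1\}=\{a,b,c,ba,bc,0,1\}$. $\mathbf E$ is the variety generated by the monoid $E=\langle a,b,c\mid a^2=ab=0,\ ba=ca=a,\ b^2=bc=b,\ c^2=cb=c\rangle\cup\{1\}=\{a,b,c,ac,0,1\}$; one has $\mathbf E=\operatorname{var}\{xyx\approx x^2yx\approx xyx^2,\ xy^2x\approx x^2y^2\}$. Then $\mathbf R_2=\mathbf E\{yt_2xt_1xy\approx yt_2xt_1yx\}$. *)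

(* Defs.v *)
From HB Require Import structures.
From mathcomp Require Import all_boot.
From mathcomp Require Import boolp classical_sets cardinality.

Set Implicit Arguments.
Unset Strict Implicit.
Unset Printing Implicit Defensive.

Local Open Scope group_scope.
Local Open Scope classical_set_scope.

Section DirectProduct.
Variables (I : Type) (F : I -> monoidType).

Definition dprod_monoid := forall i, F i.

HB.instance Definition _ := Choice.copy dprod_monoid (forall i, F i).

Definition dprod_mul (x y : dprod_monoid) : dprod_monoid := fun i => x i * y i.
Definition dprod_one : dprod_monoid := fun=> 1.

Fact dprod_mulA : associative dprod_mul.
Proof. by move=> x y z; apply: functional_extensionality_dep => i; exact: mulgA. Qed.
Fact dprod_mul1 : left_id dprod_one dprod_mul.
Proof. by move=> x; apply: functional_extensionality_dep => i; exact: mul1g. Qed.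
Fact dprod_mulr1 : right_id dprod_one dprod_mul.
Proof. by move=> x; apply: functional_extensionality_dep => i; exact: mulg1. Qed.

HB.instance Definition _ := isSemigroup.Build dprod_monoid dprod_mulA.
HB.instance Definition _ :=
  Magma_isUMagma.Build dprod_monoid dprod_mul1 dprod_mulr1.

End DirectProduct.

(* Classes of monoids.  classical_sets.set cannot be used here: its universe   *)
(* is strictly below that of monoidType.                                      *)
Definition mclass : Type := monoidType -> Prop.

Definition subclass (V W : mclass) : Prop := forall M, V M -> W M.
Definition same_class (V W : mclass) : Prop := forall M, V M <-> W M.
Definition proper_subclass (V W : mclass) : Prop :=
  subclass V W /\ ~ same_class V W.

(* Closure under H (which includes isomorphic copies), S and P; the empty     *)
(* product forces the trivial monoids to be members.                          *)
Definition is_variety (V : mclass) : Prop :=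
  [/\ forall (M N : monoidType) (f : M -> N),
        monoid_morphism f -> (forall y, exists x, f x = y) -> V M -> V N,
      forall (M N : monoidType) (f : N -> M),
        monoid_morphism f -> injective f -> V M -> V N
    & forall (I : Type) (F : I -> monoidType),
        (forall i, V (F i)) -> V (dprod_monoid F)].

(* An identity u ≈ v over the countable alphabet {0, 1, 2, ...}. *)
Definition identity : Type := (seq nat * seq nat)%type.

Definition eval (M : monoidType) (h : nat -> M) (w : seq nat) : M :=
  \prod_(i <- w) h i.

Definition satisfies (M : monoidType) (e : identity) : Prop :=
  forall h : nat -> M, eval h e.1 = eval h e.2.

Definition models (Sigma : set identity) : mclass :=
  fun M => forall e, Sigma e -> satisfies M e.

Definition var_gen (K : mclass) : mclass :=
  fun M => forall V, is_variety V -> subclass K V -> V M.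

Definition var_of (M : monoidType) : mclass := var_gen (fun N => N = M).

Definition var_join (V W : mclass) : mclass :=
  var_gen (fun M => V M \/ W M).

Definition subvar_by (V : mclass) (Sigma : set identity) : mclass :=
  fun M => V M /\ models Sigma M.

Definition finitely_based (V : mclass) : Prop :=
  exists Sigma : set identity, finite_set Sigma /\ same_class V (models Sigma).

Definition finitely_generated (V : mclass) : Prop :=
  exists M : monoidType, finite_set [set: M] /\ same_class V (var_of M).

(* Some finite list of classes exhausts the subvarieties of V. *)
Definition small (V : mclass) : Prop :=
  exists (n : nat) (F : 'I_n -> mclass), forall W, is_variety W ->
    subclass W V -> exists i, same_class W (F i).

Definition cross (V : mclass) : Prop :=
  [/\ finitely_based V, finitely_generated V & small V].

Definition almost_cross (V : mclass) : Prop :=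
  ~ cross V /\ forall W, is_variety W -> proper_subclass W V -> cross W.

Inductive A_monoid : Type := A_1 | A_0 | A_a | A_b | A_c | A_ba | A_bc.

Definition A_code (x : A_monoid) : 'I_7 :=
  match x with
  | A_1 => inord 0 | A_0 => inord 1 | A_a => inord 2 | A_b => inord 3
  | A_c => inord 4 | A_ba => inord 5 | A_bc => inord 6
  end.
Definition A_decode (i : 'I_7) : A_monoid :=
  nth A_0 [:: A_1; A_0; A_a; A_b; A_c; A_ba; A_bc] i.
Fact A_codeK : cancel A_code A_decode.
Proof. by case; rewrite /A_decode inordK. Qed.

HB.instance Definition _ := Finite.copy A_monoid (can_type A_codeK).

(* The multiplication forced by a^2 = a, b^2 = b, ab = ca = 0, ac = cb = c    *)
(* (note c^2 = c(ac) = (ca)c = 0); see A_relations and A_universal.           *)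
Definition A_mul (x y : A_monoid) : A_monoid :=
  match x, y with
  | A_1, z | z, A_1 => z
  | A_a, A_a => A_a
  | A_a, A_c => A_c
  | A_b, A_a => A_ba
  | A_b, A_b => A_b
  | A_b, A_c => A_bc
  | A_b, A_ba => A_ba
  | A_b, A_bc => A_bc
  | A_c, A_b => A_c
  | A_ba, A_a => A_ba
  | A_ba, A_c => A_bc
  | A_bc, A_b => A_bc
  | _, _ => A_0
  end.

Fact A_mulA : associative A_mul. Proof. by do 3!case. Qed.
Fact A_mul1 : left_id A_1 A_mul. Proof. by case. Qed.
Fact A_mulr1 : right_id A_1 A_mul. Proof. by case. Qed.

HB.instance Definition _ := isSemigroup.Build A_monoid A_mulA.
HB.instance Definition _ := Magma_isUMagma.Build A_monoid A_mul1 A_mulr1.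

Inductive E_monoid : Type := E_1 | E_0 | E_a | E_b | E_c | E_ac.

Definition E_code (x : E_monoid) : 'I_6 :=
  match x with
  | E_1 => inord 0 | E_0 => inord 1 | E_a => inord 2 | E_b => inord 3
  | E_c => inord 4 | E_ac => inord 5
  end.
Definition E_decode (i : 'I_6) : E_monoid :=
  nth E_0 [:: E_1; E_0; E_a; E_b; E_c; E_ac] i.
Fact E_codeK : cancel E_code E_decode.
Proof. by case; rewrite /E_decode inordK. Qed.

HB.instance Definition _ := Finite.copy E_monoid (can_type E_codeK).

(* The multiplication forced by a^2 = ab = 0, ba = ca = a, b^2 = bc = b,      *)
(* c^2 = cb = c; see E_relations and E_universal.                             *)
Definition E_mul (x y : E_monoid) : E_monoid :=
  match x, y with
  | E_1, z | z, E_1 => z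
  | E_a, E_c => E_ac
  | E_b, E_a => E_a
  | E_b, E_b => E_b
  | E_b, E_c => E_b
  | E_b, E_ac => E_ac
  | E_c, E_a => E_a
  | E_c, E_b => E_c
  | E_c, E_c => E_c
  | E_c, E_ac => E_ac
  | E_ac, E_b => E_ac
  | E_ac, E_c => E_ac
  | _, _ => E_0
  end.

Fact E_mulA : associative E_mul. Proof. by do 3!case. Qed.
Fact E_mul1 : left_id E_1 E_mul. Proof. by case. Qed.
Fact E_mulr1 : right_id E_1 E_mul. Proof. by case. Qed.

HB.instance Definition _ := isSemigroup.Build E_monoid E_mulA.
HB.instance Definition _ := Magma_isUMagma.Build E_monoid E_mul1 E_mulr1.

(* A_monoid and E_monoid are the monoids with zero given by their             *)
(* presentations: they satisfy the defining relations, and every monoid with  *)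
(* zero containing elements that satisfy these relations receives exactly one *)
(* morphism matching the generators.                                          *)
Definition is_zero (M : monoidType) (z : M) : Prop :=
  forall x : M, z * x = z /\ x * z = z.

Definition A_rel (M : monoidType) (z a b c : M) : Prop :=
  [/\ is_zero z, a * a = a /\ b * b = b, a * b = z /\ c * a = z
    & a * c = c /\ c * b = c].

Definition E_rel (M : monoidType) (z a b c : M) : Prop :=
  [/\ is_zero z, a * a = z /\ a * b = z, b * a = a /\ c * a = a,
      b * b = b /\ b * c = b & c * c = c /\ c * b = c].

Lemma A_relations : A_rel A_0 A_a A_b A_c.
Proof. by split=> //; case. Qed.

Lemma E_relations : E_rel E_0 E_a E_b E_c.
Proof. by split=> //; case. Qed.

Lemma A_universal (M : monoidType) (z a b c : M) : A_rel z a b c ->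
  exists! f : A_monoid -> M, monoid_morphism f /\
    [/\ f A_0 = z, f A_a = a, f A_b = b & f A_c = c].
Proof.
case=> z0 [aa bb] [ab ca] [ac cb].
have zl x : z * x = z by have [] := z0 x.
have zr x : x * z = z by have [] := z0 x.
have cc : c * c = z by rewrite -{2}ac mulgA ca zl.
have aa' x : x * a * a = x * a by rewrite -mulgA aa.
have bb' x : x * b * b = x * b by rewrite -mulgA bb.
have ab' x : x * a * b = z by rewrite -mulgA ab zr.
have ca' x : x * c * a = z by rewrite -mulgA ca zr.
have ac' x : x * a * c = x * c by rewrite -mulgA ac.
have cb' x : x * c * b = x * c by rewrite -mulgA cb.
have cc' x : x * c * c = z by rewrite -mulgA cc zr.
pose f x := match x with
  | A_1 => 1 | A_0 => z | A_a => a | A_b => b | A_c => c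
  | A_ba => b * a | A_bc => b * c end.
exists f; split=> [|g [[g1 gM] [g_0 ga gb gc]]].
  split=> //; split=> //; do 2!case; rewrite /= ?mul1g ?mulg1 //= ?mulgA;
    by rewrite ?(aa', bb', ab', ca', ac', cb', cc', aa, bb, ab, ca, ac, cb, cc, zl, zr).
apply: functional_extensionality_dep; case=> //=.
  by rewrite -ga -gb -gM.
by rewrite -gb -gc -gM.
Qed.

Lemma E_universal (M : monoidType) (z a b c : M) : E_rel z a b c ->
  exists! f : E_monoid -> M, monoid_morphism f /\
    [/\ f E_0 = z, f E_a = a, f E_b = b & f E_c = c].
Proof.
case=> z0 [aa ab] [ba ca] [bb bc] [cc cb].
have zl x : z * x = z by have [] := z0 x.
have zr x : x * z = z by have [] := z0 x.
have ca' x : x * c * a = x * a by rewrite -mulgA ca.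
have cb' x : x * c * b = x * c by rewrite -mulgA cb.
have cc' x : x * c * c = x * c by rewrite -mulgA cc.
pose f x := match x with
  | E_1 => 1 | E_0 => z | E_a => a | E_b => b | E_c => c
  | E_ac => a * c end.
exists f; split=> [|g [[g1 gM] [g_0 ga gb gc]]].
  split=> //; split=> //; do 2!case; rewrite /= ?mul1g ?mulg1 //= ?mulgA;
    by rewrite ?(ca', cb', cc', aa, ab, ba, ca, bb, bc, cb, cc, zl, zr).
apply: functional_extensionality_dep; case=> //=.
by rewrite -ga -gc -gM.
Qed.

Definition varA : mclass := var_of A_monoid.
Definition varE : mclass := var_of E_monoid.

(* y t2 x t1 x y ≈ y t2 x t1 y x *)
Definition R2_identity : identity :=
  let x := 0%N in let y := 1%N in let t1 := 2%N in let t2 := 3%N in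
  ([:: y; t2; x; t1; x; y], [:: y; t2; x; t1; y; x]).

Definition varR2 : mclass := subvar_by varE [set R2_identity].

Definition varN : mclass := var_join varA varR2.

(* Main.v *)
(* In a word, call a letter simple if it occurs once; the simple letters cut the
   word into blocks.  A word is determined modulo N by the order of its simple
   letters, the contents of its blocks, the order in each block between the first
   occurrences in the word and the first occurrences in the block (this is
   detected by R_2), and the order between the first occurrence of y and the last
   x of the block whenever x does not reappear before the end of the last block
   containing y (this is detected by A).  The variety R_2 is generated by a monoid
   with seven elements, so N is generated by a finite monoid.

   An identity failing in N fails in A or in R_2, and then, writing e, f for
   idempotents, it implies one of e t e s e = e t s e (sig1), e f s e = e f e s e
   (sig2) and e t e f e = e t f e (eta).  Under each of the three, words have
   normal forms that are compared by exchanging adjacent occurrences; an exchange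
   required by an identity of the subvariety follows from a short consequence of
   that identity, taken from a list of ten.  Hence a proper subvariety is
   determined within a finitely based variety by the members of this list that it
   satisfies, which makes it finitely based and small, and generated by its free
   monoid of rank four.

   N satisfies x y t y z_1^2 ... z_n^2 x = x y x t y z_1^2 ... z_n^2 x for all n.
   In the left-hand side everything but the block before t is rigid, so a
   substitution instance of an identity with few letters must cover some factor
   z_i z_(i+1) by a single simple letter; A, with this letter sent to c, then
   prevents x from appearing between y and t. *)

From HB Require Import structures.
From mathcomp Require Import all_boot.
From mathcomp Require Import boolp classical_sets cardinality.
Require Import Defs.

Set Implicit Arguments.
Unset Strict Implicit.
Unset Printing Implicit Defensive.

Local Open Scope group_scope.
Local Open Scope classical_set_scope.

(** The laws on the list are stated for idempotents because the first two identities of [base] allow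
    every repeated letter to be squared; afterwards only simple letters have arbitrary values. A law
    is extracted from an identity by keeping two or three letters and sending the others to 1;
    products of e and f then collapse, since e f e absorbs both on the right.

    Under sig1 and sig2 a normal form arises by deleting occurrences. Under eta alone this fails,
    because A may see an occurrence in the middle of a block. The block is instead saturated with
    all occurrences whose insertion A does not notice. What remains to be compared is the order of
    the first occurrences, and to exchange two of them the gap between them has to be emptied and
    filled again.

    The absence of a finite basis is shown without derivations: a set of words equal to the
    left-hand side modulo N has a syntactic monoid that satisfies all identities of N with short
    sides, but not the long one. *)

(** * Evaluation of words and substitution *)

Lemma eval_nil (M : monoidType) (h : nat -> M) : eval h [::] = 1.
Proof. exact: big_nil. Qed.

Lemma eval_cons (M : monoidType) (h : nat -> M) c w :
  eval h (c :: w) = h c * eval h w.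
Proof. exact: big_cons. Qed.

Lemma eval_cat (M : monoidType) (h : nat -> M) u v :
  eval h (u ++ v) = eval h u * eval h v.
Proof. exact: big_cat. Qed.

Lemma eval_morph (M N : monoidType) (f : M -> N) (h : nat -> M) w :
  monoid_morphism f -> f (eval h w) = eval (f \o h) w.
Proof.
case=> f1 fM; elim: w => [|c w IH]; first by rewrite !eval_nil.
by rewrite !eval_cons fM IH.
Qed.

Lemma eq_in_eval (M : monoidType) (g h : nat -> M) w :
  {in w, g =1 h} -> eval g w = eval h w.
Proof. by move=> gh; apply: eq_big_seq => c; exact: gh. Qed.

Definition subst (phi : nat -> seq nat) (w : seq nat) : seq nat :=
  flatten (map phi w).

Lemma subst_cons phi c w : subst phi (c :: w) = phi c ++ subst phi w.
Proof. by []. Qed.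

Lemma subst_cat phi u v : subst phi (u ++ v) = subst phi u ++ subst phi v.
Proof. by rewrite /subst map_cat flatten_cat. Qed.

Lemma eval_subst (M : monoidType) (h : nat -> M) phi w :
  eval h (subst phi w) = eval (fun c => eval h (phi c)) w.
Proof.
by elim: w => [|c w IH]; rewrite ?eval_nil // subst_cons eval_cat eval_cons IH.
Qed.

Lemma satisfies_image (M N : monoidType) (f : M -> N) e :
  monoid_morphism f -> (forall y, exists x, f x = y) ->
  satisfies M e -> satisfies N e.
Proof.
move=> fm fs Me h.
have [g gP] : {g : N -> M & forall y, f (g y) = y}.
  exists (fun y => xget 1 [set x | f x = y]) => y.
  by case: xgetP => [x _ //|none]; have [x] := fs y; move/(none x).
suff hE w : eval h w = f (eval (g \o h) w) by rewrite !hE Me.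
by rewrite (eval_morph _ _ fm); apply: eq_in_eval => c _ /=; rewrite gP.
Qed.

Lemma satisfies_sub (M N : monoidType) (f : N -> M) e :
  monoid_morphism f -> injective f -> satisfies M e -> satisfies N e.
Proof. by move=> fm fi Me h; apply: fi; rewrite !(eval_morph _ _ fm). Qed.

Lemma eval_dprod (I : Type) (F : I -> monoidType) (h : nat -> dprod_monoid F) w i :
  eval h w i = eval (fun c => h c i) w.
Proof.
by elim: w => [|c w IH]; rewrite ?eval_nil // !eval_cons -IH.
Qed.

Lemma models_variety Sigma : is_variety (models Sigma).
Proof.
split.
- by move=> M N f fm fs ME e /ME; apply: satisfies_image fm fs.
- by move=> M N f fm fi ME e /ME; apply: satisfies_sub fm fi.
- move=> I F FE e eS h; apply: functional_extensionality_dep => i.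
  by rewrite !eval_dprod; apply: FE.
Qed.

(** * Equational theories and Birkhoff's theorem *)

Definition theory (V : mclass) : set identity :=
  fun e => forall M, V M -> satisfies M e.

Lemma models_theory (V : mclass) M : V M -> models (theory V) M.
Proof. by move=> VM e; apply. Qed.

Section Generated.
Variables (M : monoidType) (X : Type) (h : X -> M).

Definition gen_monoid := {x : M | `[< exists w, x = \prod_(i <- w) h i >]}.
HB.instance Definition _ := Choice.copy gen_monoid
  {x : M | `[< exists w, x = \prod_(i <- w) h i >]}.

Fact gen_mul_subproof (x y : gen_monoid) :
  `[< exists w, val x * val y = \prod_(i <- w) h i >].
Proof.
case: x y => [x /= /asboolP[u ->]] [y /= /asboolP[v ->]].
by apply/asboolP; exists (u ++ v); rewrite big_cat.
Qed.
Fact gen_one_subproof : `[< exists w, 1 = \prod_(i <- w) h i >].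
Proof. by apply/asboolP; exists [::]; rewrite big_nil. Qed.
Definition gen_mul (x y : gen_monoid) : gen_monoid :=
  exist _ (val x * val y) (gen_mul_subproof x y).
Definition gen_one : gen_monoid := exist _ 1 gen_one_subproof.

Fact gen_mulA : associative gen_mul.
Proof. by move=> x y z; apply: val_inj; exact: mulgA. Qed.
Fact gen_mul1 : left_id gen_one gen_mul.
Proof. by move=> x; apply: val_inj; exact: mul1g. Qed.
Fact gen_mulr1 : right_id gen_one gen_mul.
Proof. by move=> x; apply: val_inj; exact: mulg1. Qed.
HB.instance Definition _ := isSemigroup.Build gen_monoid gen_mulA.
HB.instance Definition _ := Magma_isUMagma.Build gen_monoid gen_mul1 gen_mulr1.

End Generated.

(* Words over the carrier of M are renamed into words over nat through their
   index in the concatenation of the two words. *)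
Lemma models_theory_gen (V : mclass) (M : monoidType) (u v : seq M) :
  models (theory V) M ->
  (forall (G : monoidType) (g : M -> G), V G -> \prod_(i <- u) g i = \prod_(i <- v) g i) ->
  \prod_(i <- u) i = \prod_(i <- v) i.
Proof.
move=> MV uv; pose s := u ++ v.
have rename (G : monoidType) (g : M -> G) w : {subset w <= s} ->
    \prod_(i <- w) g i = eval (fun k => g (nth 1 s k)) (map (index^~ s) w).
  move=> ws; rewrite /eval big_map; apply: eq_big_seq => i /ws iw.
  by rewrite nth_index.
have us : {subset u <= s} by move=> i iu; rewrite mem_cat iu.
have vs : {subset v <= s} by move=> i iv; rewrite mem_cat iv orbT.
rewrite (rename _ id u) // (rename _ id v) //.
apply: (MV (map (index^~ s) u, map (index^~ s) v)) => G VG k /=.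
have := uv _ (fun i => k (index i s)) VG; rewrite !(rename _ _ _ us) !(rename _ _ _ vs).
suff E w : {subset w <= s} ->
   eval (fun j => k (index (nth 1 s j) s)) (map (index^~ s) w) =
   eval k (map (index^~ s) w) by rewrite !E.
move=> ws; apply: eq_in_eval => _ /mapP[i /ws iw ->].
by rewrite nth_index.
Qed.

(** The HSP argument without a free object. For each pair of words over [M], a member of [V] with a
    map from [M] is chosen that separates the pair whenever some member does. The pairs form a
    legitimate index type, so the product lies in [V]. In the submonoid generated by the diagonal
    images of [M], products that agree also agree throughout [V], hence in [M]; evaluation in [M] is
    thus a well-defined morphism onto [M]. *)
Lemma birkhoff (V : mclass) : is_variety V -> forall M, models (theory V) M -> V M.
Proof.
case=> VH VS VP M MV.
pose bad (p : seq M * seq M) (G : {G : monoidType & M -> G}) :=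
  V (projT1 G) /\
  ((exists (H : monoidType) (g : M -> H), V H /\
     \prod_(i <- p.1) g i <> \prod_(i <- p.2) g i) ->
   \prod_(i <- p.1) projT2 G i <> \prod_(i <- p.2) projT2 G i).
(* A trivial monoid, in [V] as an empty product; it serves the pairs that no member of [V]
   separates. *)
pose T : monoidType := dprod_monoid (fun i : void => M).
have V0 : V T by apply: VP; case.
have badP p : exists G, bad p G.
  case: (pselect (exists (H : monoidType) (g : M -> H), V H /\
     \prod_(i <- p.1) g i <> \prod_(i <- p.2) g i)) => [[H [g [VG gp]]]|np].
    by exists (existT (fun G : monoidType => M -> G) H g); split.
  by exists (existT (fun G : monoidType => M -> G) T (fun _ => 1)); split=> //= /np.
have [G GP] : {G & forall p, bad p (G p)}.
  exists (fun p => projT1 (cid (badP p))) => p; exact: projT2 (cid (badP p)).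
pose P := dprod_monoid (fun p => projT1 (G p)).
have VPP : V P by apply: VP => p; case: (GP p).
pose d (i : M) : P := fun p => projT2 (G p) i.
have dE w p : (\prod_(i <- w) d i) p = \prod_(i <- w) projT2 (G p) i.
  by elim: w => [|i w IH]; rewrite ?big_nil // !big_cons -IH.
pose S := gen_monoid d.
have VSS : V S by apply: (VS P S val) => //; exact: val_inj.
have key u v : \prod_(i <- u) d i = \prod_(i <- v) d i ->
    \prod_(i <- u) i = \prod_(i <- v) i.
  move=> duv; apply: (models_theory_gen MV) => H g VG.
  apply: contrapT => gn; have [_ gp] := GP (u, v).
  apply: gp; first by exists H, g.
  by rewrite -!dE duv.
have rP (x : S) : exists w, val x = \prod_(i <- w) d i.
  by case: x => x /= /asboolP.
pose r (x : S) := projT1 (cid (rP x)).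
have rE (x : S) : val x = \prod_(i <- r x) d i := projT2 (cid (rP x)).
apply: (VH S M (fun x => \prod_(i <- r x) i)) => //.
  split=> [|x y].
    by rewrite (key _ [::]) ?big_nil // -rE.
  by rewrite (key _ (r x ++ r y)) ?big_cat // -!rE.
move=> m; have mP : `[< exists w, d m = \prod_(i <- w) d i >].
  by apply/asboolP; exists [:: m]; rewrite big_seq1.
exists (exist _ (d m) mP : S).
by rewrite (key _ [:: m]) ?big_seq1 // -rE.
Qed.

Lemma var_genP (K : mclass) M : var_gen K M <-> models (theory K) M.
Proof.
split=> [|MK V Vv KV]; first by apply; [exact: models_variety|exact: models_theory].
by apply: birkhoff => // e Ve; apply: MK => G /KV; exact: Ve.
Qed.

Lemma var_gen_variety K : is_variety (var_gen K).
Proof.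
split.
- move=> M N f fm fs MV V Vv KV; have [VH _ _] := Vv.
  by apply: VH fm fs _; apply: MV.
- move=> M N f fm fi MV V Vv KV; have [_ VS _] := Vv.
  by apply: VS fm fi _; apply: MV.
- move=> I F FV V Vv KV; have [_ _ VP] := Vv.
  by apply: VP => i; apply: FV.
Qed.

Lemma var_ofP (G M : monoidType) :
  var_of G M <-> forall e, satisfies G e -> satisfies M e.
Proof.
split=> [/var_genP MG e Ge|MG]; first by apply: MG => _ ->.
by apply/var_genP => e; move/(_ G erefl); exact: MG.
Qed.

(** * Quotients of the monoid of words by a congruence *)

Section Quotient.
Variable R : seq nat -> seq nat -> Prop.
Hypotheses (Rxx : forall u, R u u) (Rsym : forall u v, R u v -> R v u)
  (Rtr : forall u v w, R u v -> R v w -> R u w)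
  (Rcat : forall u u' v v', R u u' -> R v v' -> R (u ++ v) (u' ++ v')).

(** On a class, [choose] returns the same word whichever member it starts from, so the quotient can
    be realised as a subtype of words. *)
Definition qrepr (w : seq nat) := choose (fun v => `[< R w v >]) w.

Lemma qreprP w : R w (qrepr w).
Proof. by apply/asboolP; apply: (@chooseP _ (fun v => `[< R w v >])); apply/asboolP. Qed.

Lemma qrepr_eq u v : R u v -> qrepr u = qrepr v.
Proof.
move=> Ruv; rewrite /qrepr.
have E : (fun w => `[< R u w >]) =1 (fun w => `[< R v w >]).
  move=> w; apply/asboolP/asboolP; apply: Rtr => //; exact: Rsym.
rewrite (eq_choose E); apply: choose_id; apply/asboolP => //; exact: Rsym.
Qed.

Lemma qrepr_id w : qrepr (qrepr w) == qrepr w.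
Proof. by apply/eqP/esym/qrepr_eq/qreprP. Qed.

(** The four proofs are arguments of the carrier, so that the monoid structure built from them can
    be attached to the type. *)
Definition qmonoid (_ : forall u, R u u) (_ : forall u v, R u v -> R v u)
  (_ : forall u v w, R u v -> R v w -> R u w)
  (_ : forall u u' v v', R u u' -> R v v' -> R (u ++ v) (u' ++ v')) :=
  {w : seq nat | qrepr w == w}.
Local Notation Q := (qmonoid Rxx Rsym Rtr Rcat).
HB.instance Definition _ := Choice.copy Q {w : seq nat | qrepr w == w}.

Definition qclass w : Q := exist _ (qrepr w) (qrepr_id w).

Lemma qclass_eq u v : (qclass u = qclass v) <-> R u v.
Proof.
split=> [/(congr1 val) /= E|Ruv]; last by apply: val_inj; exact: qrepr_eq.
by apply: Rtr (qreprP u) _; rewrite E; apply/Rsym/qreprP.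
Qed.

Lemma qclassK (x : Q) : qclass (val x) = x.
Proof. by apply: val_inj => /=; case: x => w /= /eqP. Qed.

Definition qmul (x y : Q) : Q := qclass (val x ++ val y).

Lemma qmulE u v : qmul (qclass u) (qclass v) = qclass (u ++ v).
Proof. by apply/qclass_eq/Rcat; apply/Rsym/qreprP. Qed.

Fact qmulA : associative qmul.
Proof.
by move=> x y z; rewrite -(qclassK x) -(qclassK y) -(qclassK z) !qmulE catA.
Qed.
Fact qmul1 : left_id (qclass [::]) qmul.
Proof. by move=> x; rewrite -(qclassK x) qmulE. Qed.
Fact qmulr1 : right_id (qclass [::]) qmul.
Proof. by move=> x; rewrite -(qclassK x) qmulE cats0. Qed.
HB.instance Definition _ := isSemigroup.Build Q qmulA.
HB.instance Definition _ := Magma_isUMagma.Build Q qmul1 qmulr1.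

Lemma eval_qclass (phi : nat -> seq nat) w :
  eval (fun c => qclass (phi c)) w = qclass (subst phi w).
Proof.
elim: w => [|c w IH]; first by rewrite eval_nil.
by rewrite eval_cons IH subst_cons -qmulE.
Qed.

(** Every assignment into the quotient is a substitution by representatives. *)
Lemma qmonoid_satisfies e :
  satisfies Q e <-> forall phi, R (subst phi e.1) (subst phi e.2).
Proof.
split=> [Qe phi|Re h]; first by apply/qclass_eq; rewrite -!eval_qclass; exact: Qe.
have hE w : eval h w = qclass (subst (fun c => val (h c)) w).
  by rewrite -eval_qclass; apply: eq_in_eval => c _; rewrite qclassK.
by rewrite !hE; apply/qclass_eq.
Qed.

End Quotient.

(** * The monoid generating R_2 *)

(* A monoid generating R_2: its elements a, b, c satisfy aa = ab = ba = 0, ca = a,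
   bb = bc = b and cc = c. *)
Inductive R_monoid : Type := R_1 | R_0 | R_a | R_b | R_c | R_cb | R_ac.

Definition R_code (x : R_monoid) : 'I_7 :=
  match x with
  | R_1 => inord 0 | R_0 => inord 1 | R_a => inord 2 | R_b => inord 3
  | R_c => inord 4 | R_cb => inord 5 | R_ac => inord 6
  end.
Definition R_decode (i : 'I_7) : R_monoid :=
  nth R_0 [:: R_1; R_0; R_a; R_b; R_c; R_cb; R_ac] i.
Fact R_codeK : cancel R_code R_decode.
Proof. by case; rewrite /R_decode inordK. Qed.

HB.instance Definition _ := Finite.copy R_monoid (can_type R_codeK).

Definition R_mul (x y : R_monoid) : R_monoid :=
  match x, y with
  | R_1, z | z, R_1 => z
  | R_a, R_c | R_a, R_cb => R_ac
  | R_b, R_b | R_b, R_c | R_b, R_cb => R_b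
  | R_c, R_a => R_a
  | R_c, R_b | R_c, R_cb => R_cb
  | R_c, R_c => R_c
  | R_c, R_ac => R_ac
  | R_cb, R_b | R_cb, R_c | R_cb, R_cb => R_cb
  | R_ac, R_b | R_ac, R_c | R_ac, R_cb => R_ac
  | _, _ => R_0
  end.

Fact R_mulA : associative R_mul. Proof. by do 3!case. Qed.
Fact R_mul1 : left_id R_1 R_mul. Proof. by case. Qed.
Fact R_mulr1 : right_id R_1 R_mul. Proof. by case. Qed.

HB.instance Definition _ := isSemigroup.Build R_monoid R_mulA.
HB.instance Definition _ := Magma_isUMagma.Build R_monoid R_mul1 R_mulr1.

(* R_monoid is a Rees quotient of a submonoid of E x E; [RE] lifts an element
   to the submonoid and [ER] is the quotient map. *)
Definition RE (x : R_monoid) : E_monoid * E_monoid :=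
  match x with
  | R_1 => (E_1, E_1) | R_0 => (E_0, E_0) | R_a => (E_a, E_b)
  | R_b => (E_b, E_c) | R_c => (E_c, E_1) | R_cb => (E_c, E_c)
  | R_ac => (E_ac, E_b)
  end.

Definition ER (x : E_monoid * E_monoid) : R_monoid :=
  match x with
  | (E_1, E_1) => R_1 | (E_a, E_b) => R_a | (E_b, E_c) => R_b
  | (E_c, E_1) => R_c | (E_c, E_c) => R_cb | (E_ac, E_b) => R_ac
  | _ => R_0
  end.

Lemma R_sat_E e : satisfies E_monoid e -> satisfies R_monoid e.
Proof.
move=> Ee h.
(* The pairs that arise as products. Those with first component [E_0], together with [(E_a, E_c)]
   and [(E_ac, E_c)], form the ideal that [ER] collapses to [R_0]. *)
pose good (x : E_monoid * E_monoid) := match x with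
  | (E_0, _) | (E_1, E_1) | (E_a, E_b) | (E_b, E_c) | (E_c, E_1) | (E_c, E_c)
  | (E_ac, E_b) | (E_a, E_c) | (E_ac, E_c) => true | _ => false end.
pose ev w := (eval (fun c => (RE (h c)).1) w, eval (fun c => (RE (h c)).2) w).
suff step w : good (ev w) /\ eval h w = ER (ev w).
  by rewrite !(step _).2 /ev !Ee.
elim: w => [|c w [gw hw]]; first by rewrite /ev !eval_nil.
rewrite /ev !eval_cons hw.
move: gw; rewrite /ev.
move: (eval (fun c => (RE (h c)).1) w) (eval (fun c => (RE (h c)).2) w).
by case: (h c); do 2!case.
Qed.

(** Identities common to A and R_2, which define the finitely based variety in which proper
    subvarieties are compared. The first two square an occurrence of a repeated letter; the fourth
    inserts an x after y if x and then y recur. *)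
Definition base (G : monoidType) : Prop :=
  [/\ forall x t : G, x * t * x = x * x * t * x,
      forall x t : G, x * t * x = x * t * x * x,
      forall x y t s : G, y * s * x * t * x * y = y * s * x * t * y * x
    & forall x y t s : G, x * y * t * x * s * y = x * y * x * t * x * s * y].

(* The third of these identities makes adjacent non-first occurrences commute. *)
Definition base_ids : seq identity :=
  [:: ([:: 0; 2; 0], [:: 0; 0; 2; 0]); ([:: 0; 2; 0], [:: 0; 2; 0; 0]);
      R2_identity; ([:: 0; 1; 2; 0; 3; 1], [:: 0; 1; 0; 2; 0; 3; 1])]%N.

Definition assign4 (G : monoidType) (x y t s : G) (n : nat) : G :=
  nth 1 [:: x; y; t; s] n.

Ltac eval_word := rewrite ?(eval_cons, eval_nil) /= ?mulg1 ?mulgA.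

Lemma baseP (G : monoidType) :
  base G <-> forall e, e \in base_ids -> satisfies G e.
Proof.
split=> [[b1 b2 bC b3] e|b].
  rewrite !inE => /or4P[] /eqP -> h; eval_word.
  - exact: b1.
  - exact: b2.
  - exact: bC.
  - exact: b3.
split.
- move=> x t; have /b/(_ (assign4 x 1 t 1)) : nth ([::], [::]) base_ids 0 \in base_ids by
  [].
  by eval_word.
- move=> x t; have /b/(_ (assign4 x 1 t 1)) : nth ([::], [::]) base_ids 1 \in base_ids by
  [].
  by eval_word.
- move=> x y t s; have /b/(_ (assign4 x y t s)) : nth ([::], [::]) base_ids 2 \in
  base_ids by [].
  by eval_word.
- move=> x y t s; have /b/(_ (assign4 x y t s)) : nth ([::], [::]) base_ids 3 \in
  base_ids by [].
  by eval_word.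
Qed.

Lemma A_base : base A_monoid.
Proof. by split; do ?[case]. Qed.

Lemma R_base : base R_monoid.
Proof. by split; do ?[case]. Qed.

Lemma E_sat3 : satisfies E_monoid ([:: 0; 1; 2; 0; 3; 1], [:: 0; 1; 0; 2; 0; 3; 1])%N.
Proof.
by move=> h; eval_word; case: (h 0%N); case: (h 1%N); case: (h 2%N); case: (h 3%N).
Qed.

Lemma E_sat1 : satisfies E_monoid ([:: 0; 2; 0], [:: 0; 0; 2; 0])%N.
Proof. by move=> h; eval_word; case: (h 0%N); case: (h 2%N). Qed.

Lemma E_sat2 : satisfies E_monoid ([:: 0; 2; 0], [:: 0; 2; 0; 0])%N.
Proof. by move=> h; eval_word; case: (h 0%N); case: (h 2%N). Qed.

(** Yields e f e = e f for idempotents, a law of R_2 that fails in A. *)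
Lemma E_sat_lrb : satisfies E_monoid ([:: 0; 0; 1; 1; 0; 0], [:: 0; 0; 1; 1])%N.
Proof. by move=> h; eval_word; case: (h 0%N); case: (h 1%N). Qed.

Lemma varR2P M : varR2 M <->
  (forall e, satisfies E_monoid e -> satisfies M e) /\ satisfies M R2_identity.
Proof.
split=> [[/var_ofP ME MR]|[ME MR]]; first by split=> //; apply: MR.
by split; [apply/var_ofP|move=> _ ->].
Qed.

Lemma R2_base M : varR2 M -> base M.
Proof.
case/varR2P=> ME MR; apply/baseP => e; rewrite !inE => /or4P[] /eqP -> //;
  apply: ME; [exact: E_sat1|exact: E_sat2|exact: E_sat3].
Qed.

Lemma R_varR2 : varR2 R_monoid.
Proof.
apply/varR2P; split; first exact: R_sat_E.
by apply: (baseP _).1 R_base _ _; rewrite !inE eqxx !orbT.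
Qed.

(** * Identities on idempotents *)

Definition idem (G : monoidType) (e : G) : Prop := e * e = e.

(** The laws that decide which exchanges are possible: gam concerns the first occurrences of two new
    letters, eta those in a block of an old and a new letter, del a first and a last occurrence,
    tau1 and tau2 a simple letter next to a first or a last occurrence. *)
Definition p_triv (G : monoidType) := forall t : G, t = 1.
Definition p_band (G : monoidType) := forall t : G, t * t = t.
Definition p_comm (G : monoidType) := forall t s : G, t * s = s * t.
Definition p_tau1 (G : monoidType) :=
  forall e t : G, idem e -> e * t * e = t * e.
Definition p_tau2 (G : monoidType) :=
  forall e t : G, idem e -> e * t * e = e * t.
Definition p_sig1 (G : monoidType) :=
  forall e t s : G, idem e -> e * t * e * s * e = e * t * s * e.
Definition p_sig2 (G : monoidType) :=
  forall e f s : G, idem e -> idem f -> e * f * s * e = e * f * e * s * e.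
Definition p_eta (G : monoidType) :=
  forall e f t : G, idem e -> idem f -> e * t * e * f * e = e * t * f * e.
Definition p_gam (G : monoidType) :=
  forall e f : G, idem e -> idem f -> e * f * e = f * e * f.
Definition p_del (G : monoidType) :=
  forall e f : G, idem e -> idem f -> e * f = e * f * e.

Section IdempotentWords.
Variable G : monoidType.
Implicit Types (e f t : G) (g : nat -> G) (w : seq nat).

Lemma eval_all1 g w : {in w, forall c, g c = 1} -> eval g w = 1.
Proof.
elim: w => [|c w IH] g1; first exact: eval_nil.
by rewrite eval_cons g1 ?mem_head // mul1g IH // => d dw; apply: g1; rewrite inE dw orbT.
Qed.

Lemma eval_idem e g w : idem e -> {in w, forall c, g c = 1 \/ g c = e} ->
  e * eval g w = e /\ eval g w * e = e.
Proof.
move=> ee; elim: w => [|c w IH] ge; first by rewrite eval_nil mulg1 mul1g.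
have [|IHl IHr] := IH; first by move=> d dw; apply: ge; rewrite inE dw orbT.
rewrite eval_cons; case: (ge c (mem_head _ _)) => ->; rewrite ?mul1g //.
by rewrite mulgA ee IHl ee.
Qed.

Lemma eval_idem_mem e g w x : idem e -> {in w, forall c, g c = 1 \/ g c = e} ->
  x \in w -> g x = e -> eval g w = e.
Proof.
move=> ee; elim: w => // c w IH ge.
have ge' : {in w, forall c, g c = 1 \/ g c = e}.
  by move=> d dw; apply: ge; rewrite inE dw orbT.
rewrite inE eval_cons => /predU1P[-> -> |xw gx]; first by case: (eval_idem ee ge').
by rewrite IH //; case: (ge c (mem_head _ _)) => ->; rewrite ?mul1g.
Qed.

Hypothesis Gb : base G.

Lemma base_cube t : t * t * t = t * t.
Proof. by have [b1 _ _ _] := Gb; have := b1 t 1; rewrite !mulg1. Qed.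

Lemma idem_sq t : idem (t * t).
Proof. by rewrite /idem !mulgA !base_cube. Qed.

(** The identity of R_2 with x = f, y = e and the other letters empty. *)
Lemma base_efef e f : idem e -> idem f -> e * f * e * f = e * f * e.
Proof.
move=> ee ff; have [_ _ bC _] := Gb.
by have := bC f e 1 1; rewrite !mulg1 => <-; rewrite -(mulgA _ f f) ff.
Qed.

Lemma base_etfef e f t : idem e -> idem f -> e * t * f * e * f = e * t * f * e.
Proof.
move=> ee ff; have [_ _ bC _] := Gb.
by have := bC f e 1 t; rewrite !mulg1 => <-; rewrite -(mulgA _ f f) ff.
Qed.

(** By [base_efef], e f e is a left zero for e and f. *)
Lemma eval_ef e f g w : idem e -> idem f ->
  {in w, forall c, [\/ g c = 1, g c = e | g c = f]} ->
  e * f * e * eval g w = e * f * e /\ e * f * eval g w * e = e * f * e.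
Proof.
move=> ee ff; elim: w => [|c w IH] ge; first by rewrite eval_nil !mulg1.
have [|IH1 IH2] := IH; first by move=> d dw; apply: ge; rewrite inE dw orbT.
rewrite eval_cons; case: (ge c (mem_head _ _)) => ->.
- by rewrite mul1g.
- by rewrite !mulgA -(mulgA _ e e) ee IH1 -(mulgA _ e e) ee.
- by rewrite !mulgA base_efef // IH1 -(mulgA e f f) ff IH2.
Qed.

Lemma eval_etf t e f g w : idem e -> idem f ->
  {in w, forall c, [\/ g c = 1, g c = e | g c = f]} ->
  e * t * f * e * eval g w = e * t * f * e /\
  e * t * f * eval g w * e = e * t * f * e.
Proof.
move=> ee ff; elim: w => [|c w IH] ge; first by rewrite eval_nil !mulg1.
have [|IH1 IH2] := IH; first by move=> d dw; apply: ge; rewrite inE dw orbT.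
rewrite eval_cons; case: (ge c (mem_head _ _)) => ->.
- by rewrite mul1g.
- by rewrite !mulgA -(mulgA _ e e) ee IH1 -(mulgA _ e e) ee.
- by rewrite !mulgA base_etfef // IH1 -(mulgA (e * t) f f) ff IH2.
Qed.

Lemma tau1_sig1 : p_tau1 G -> p_sig1 G.
Proof.
move=> tau e t s ee.
by rewrite tau // -(mulgA e t) tau // -!mulgA (mulgA e s) tau.
Qed.

Lemma tau2_sig1 : p_tau2 G -> p_sig1 G.
Proof. by move=> tau e t s ee; rewrite tau. Qed.

Lemma triv_sig1 : p_triv G -> p_sig1 G.
Proof. by move=> tr e t s _; rewrite (tr (_ * e)) (tr (e * t * s * e)). Qed.

(** In a band e t = e t e t, which is e t e by [base_efef]; so tau2 holds. *)
Lemma band_sig1 : p_band G -> p_sig1 G.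
Proof.
move=> bd; apply: tau2_sig1 => e t ee.
by rewrite -(base_efef ee (bd t)) -mulgA bd.
Qed.

End IdempotentWords.

Lemma split_mem (x : nat) (w : seq nat) : x \in w ->
  exists w1 w2, w = w1 ++ x :: w2 /\ x \notin w1.
Proof.
move=> xw; exists (take (index x w) w), (drop (index x w).+1 w).
split; last by rewrite -has_pred1 has_take_leq ?index_size // ltnn.
rewrite -[LHS](cat_take_drop (index x w)); congr (_ ++ _).
by rewrite (drop_nth x) ?index_mem // nth_index.
Qed.

Section Derivations.
Variable G : monoidType.
Hypothesis Gb : base G.
Variables u v : seq nat.
Hypothesis Guv : satisfies G (u, v).

(** With x = t and the other letters erased, the identity gives t a right inverse; cancelling in t^3
    = t^2 leaves t = 1. *)
Lemma derive_triv x : x \in u -> x \notin v -> p_triv G.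
Proof.
move=> xu xv t.
have := Guv (fun c => if c == x then t else 1) => /=.
rewrite [RHS]eval_all1; last by move=> c cv; case: eqP => // cx; rewrite -cx cv in xv.
have [w1 [w2 [-> xw1]]] := split_mem xu.
rewrite eval_cat eval_cons eqxx eval_all1 ?mul1g; last first.
  by move=> c cw; case: eqP => // cx; rewrite -cx cw in xw1.
move: (eval _ w2) => a ta.
have tK z : z * t * a = z by rewrite -mulgA ta mulg1.
by have := congr1 (fun z => z * a * a) (base_cube Gb t); rewrite /= !tK ta.
Qed.

(** With x = t and the other letters erased, one side is t and the other a power of t with exponent
    at least 2, hence t^2. *)
Lemma derive_band x : count_mem x u = 1%N -> (1 < count_mem x v)%N -> p_band G.
Proof.
move=> xu xv t.
have := Guv (fun c => if c == x then t else 1) => /=.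
have xu' : x \in u by rewrite -has_pred1 has_count xu.
have xv' : x \in v by rewrite -has_pred1 has_count ltnW.
have one w : x \notin w -> eval (fun c => if c == x then t else 1) w = 1.
  by move=> xw; apply: eval_all1 => c cw; case: eqP => // cx; rewrite -cx cw in xw.
have [u1 [u2 [uE xu1]]] := split_mem xu'.
have [v1 [v2 [vE xv1]]] := split_mem xv'.
have xu2 : x \notin u2.
  move: xu; rewrite uE count_cat /= eqxx (count_memPn xu1) => -[].
  by move/eqP; rewrite -leqn0 leqNgt -has_count has_pred1.
have xv2 : x \in v2.
  move: xv; rewrite vE count_cat /= eqxx (count_memPn xv1).
  by rewrite add0n ltnS -has_count has_pred1.
have [v3 [v4 [v2E xv3]]] := split_mem xv2.
rewrite uE vE v2E !(eval_cat, eval_cons) eqxx (one u1) // (one u2) //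
  (one v1) // (one v3) // !mul1g mulg1 mulgA => ->.
have absorb w : t * t * eval (fun c => if c == x then t else 1) w = t * t.
  elim: w => [|c w IH]; first by rewrite eval_nil mulg1.
  by rewrite eval_cons mulgA; case: (c == x); rewrite ?mulg1 // base_cube.
by rewrite absorb idem_sq.
Qed.

End Derivations.

(** * Identities failing in A or in R_2 *)

Definition A_word (x : A_monoid) : seq nat :=
  match x with
  | A_1 => [::] | A_0 => [:: 0; 1] | A_a => [:: 0] | A_b => [:: 1] | A_c => [:: 2]
  | A_ba => [:: 1; 0] | A_bc => [:: 1; 2]
  end%N.

Definition A_letter (c : nat) : A_monoid := nth A_1 [:: A_a; A_b; A_c] c.

Lemma A_wordK x : eval A_letter (A_word x) = x.
Proof. by case: x; eval_word. Qed.

Ltac sep P Q := exists P, Q; by [left; split|right; split].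

Lemma A_separate (m m' : A_monoid) : m <> m' -> exists P Q,
  (P * m * Q = A_bc /\ P * m' * Q <> A_bc) \/
  (P * m' * Q = A_bc /\ P * m * Q <> A_bc).
Proof.
case: m; case: m' => // _;
  first [sep A_b A_c|sep A_b A_bc|sep A_ba A_c|sep A_ba A_1|sep A_b A_1].
Qed.

Lemma A_fail_words (u v : seq nat) (h : nat -> A_monoid) : eval h u <> eval h v ->
  exists U V, [/\ eval A_letter U = A_bc, eval A_letter V <> A_bc &
    forall G, satisfies G (u, v) -> satisfies G (U, V)].
Proof.
move=> huv; have [P [Q PQ]] := A_separate huv.
pose W w := A_word P ++ subst (A_word \o h) w ++ A_word Q.
have WE w : eval A_letter (W w) = P * eval h w * Q.
  rewrite /W !eval_cat eval_subst !A_wordK mulgA; congr (_ * _ * _).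
  by apply: eq_in_eval => c _ /=; rewrite A_wordK.
have Wsat G x y : satisfies G (x, y) -> satisfies G (W x, W y).
  by move=> Gxy k /=; rewrite /W !eval_cat !eval_subst Gxy.
case: PQ => -[E1 E2]; [exists (W u), (W v)|exists (W v), (W u)];
  rewrite !WE; split=> // G Guv; apply: Wsat => // k; exact/esym/Guv.
Qed.

Definition A_has_c (x : A_monoid) :=
  if x is (A_c | A_bc) then true else false.
Definition A_in_b (x : A_monoid) := if x is (A_1 | A_b) then true else false.
Definition A_in_a (x : A_monoid) := if x is (A_1 | A_a) then true else false.

Lemma A_eval_noc w : 2%N \notin w -> ~~ A_has_c (eval A_letter w).
Proof.
elim: w => [|c w IH]; first by rewrite eval_nil.
rewrite inE negb_or eval_cons => /andP[c2 /IH].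
by case: c c2 => [|[|[|[|c]]]] //= _; case: (eval _ w).
Qed.

Lemma A_eval_b w : 2%N \notin w -> 0%N \notin w -> A_in_b (eval A_letter w).
Proof.
elim: w => [|c w IH]; first by rewrite eval_nil.
rewrite !inE !negb_or eval_cons => /andP[c2 /IH{}IH] /andP[c0 /IH].
by case: c c0 c2 => [|[|[|[|c]]]] //= _; case: (eval _ w).
Qed.

Lemma A_eval_b_notin w : A_in_b (eval A_letter w) -> 0%N \notin w.
Proof.
elim: w => // c w IH; rewrite eval_cons inE negb_or => cw.
have /IH -> : A_in_b (eval A_letter w).
  by move: cw; case: c => [|[|[|[|c]]]]; case: (eval _ w).
by move: cw; case: c => //; case: (eval _ w).
Qed.

Lemma A_eval_a w : 2%N \notin w -> 1%N \notin w -> A_in_a (eval A_letter w).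
Proof.
elim: w => [|c w IH]; first by rewrite eval_nil.
rewrite !inE !negb_or eval_cons => /andP[c2 /IH{}IH] /andP[c1 /IH].
by case: c c1 c2 => [|[|[|[|c]]]] //= _; case: (eval _ w).
Qed.

Lemma A_eval_1in w : 1%N \in w -> ~~ A_in_a (eval A_letter w).
Proof.
elim: w => // c w IH; rewrite eval_cons inE => /predU1P[<-|/IH].
  by case: (eval _ w).
by case: c => [|[|[|[|c]]]]; case: (eval _ w).
Qed.

(** For every m one has c m c = 0, so c occurs once; no a may follow it, and without a b in front
    the value could not be bc. *)
Lemma A_eval_bc U : eval A_letter U = A_bc -> exists U1 U2,
  [/\ U = U1 ++ 2%N :: U2, 2%N \notin U1, 2%N \notin U2, 1%N \in U1 & 0%N \notin U2].
Proof.
move=> UE; have cU : 2%N \in U.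
  by case: (boolP (2%N \in U)) => // /A_eval_noc; rewrite UE.
have [U1 [U2 [defU cU1]]] := split_mem cU; exists U1, U2.
move: UE; rewrite defU eval_cat eval_cons => UE.
have n1 := A_eval_noc cU1.
have cU2 : 2%N \notin U2.
  apply/negP => /split_mem[w1 [w2 [defU2 /A_eval_noc]]]; move: UE n1.
  rewrite defU2 eval_cat eval_cons.
  by case: (eval _ U1); case: (eval _ w1); case: (eval _ w2).
split=> //.
  case: (boolP (1%N \in U1)) => // /(A_eval_a cU1); move: UE n1.
  by case: (eval _ U1); case: (eval _ U2).
by apply: A_eval_b_notin; move: UE n1; case: (eval _ U1); case: (eval _ U2).
Qed.

Lemma satisfies_sym (G : monoidType) u v : satisfies G (u, v) -> satisfies G (v, u).
Proof. by move=> Guv h; exact/esym/Guv. Qed.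

(** Put x = e, t = a, erase the other letters and multiply by e on the right: the sides become e a e
    and a e. *)
Lemma derive_tau1 (G : monoidType) (U1 U2 V1 V2 : seq nat) (x t : nat) : base G -> x != t ->
  satisfies G (U1 ++ t :: U2, V1 ++ t :: V2) ->
  t \notin U1 -> t \notin U2 -> t \notin V1 -> t \notin V2 ->
  x \in U1 -> x \notin V1 -> p_tau1 G.
Proof.
move=> Gb xt GUV tU1 tU2 tV1 tV2 xU1 xV1 e a ee.
pose g (c : nat) := if c == x then e else if c == t then a else 1.
have gE (w : seq nat) : t \notin w -> {in w, forall c, g c = 1 \/ g c = e}.
  move=> tw c cw; rewrite /g; case: eqP => _; first by right.
  by case: eqP => [ct|]; [rewrite -ct cw in tw|left].
have gx : g x = e by rewrite /g eqxx.
have gt : g t = a by rewrite /g eq_sym (negPf xt) eqxx.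
have := congr1 (fun z => z * e) (GUV g); rewrite /= !eval_cat !eval_cons gt.
rewrite (eval_idem_mem ee (gE _ tU1) xU1 gx) (@eval_all1 _ g V1).
  rewrite mul1g -!mulgA; have [_ ->] := eval_idem ee (gE _ tU2).
  by have [_ ->] := eval_idem ee (gE _ tV2); rewrite mulgA.
move=> c cV; rewrite /g; case: eqP => [cx|_]; first by rewrite -cx cV in xV1.
by case: eqP => // ct; rewrite -ct cV in tV1.
Qed.

(** Dual to [derive_tau1]: multiplication by e on the left gives e a e and e a. *)
Lemma derive_tau2 (G : monoidType) (U1 U2 V1 V2 : seq nat) (x t : nat) : base G -> x != t ->
  satisfies G (U1 ++ t :: U2, V1 ++ t :: V2) ->
  t \notin U1 -> t \notin U2 -> t \notin V1 -> t \notin V2 ->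
  x \in U2 -> x \notin V2 -> p_tau2 G.
Proof.
move=> Gb xt GUV tU1 tU2 tV1 tV2 xU2 xV2 e a ee.
pose g (c : nat) := if c == x then e else if c == t then a else 1.
have gE (w : seq nat) : t \notin w -> {in w, forall c, g c = 1 \/ g c = e}.
  move=> tw c cw; rewrite /g; case: eqP => _; first by right.
  by case: eqP => [ct|]; [rewrite -ct cw in tw|left].
have gx : g x = e by rewrite /g eqxx.
have gt : g t = a by rewrite /g eq_sym (negPf xt) eqxx.
have := congr1 (fun z => e * z) (GUV g); rewrite /= !eval_cat !eval_cons gt.
rewrite (eval_idem_mem ee (gE _ tU2) xU2 gx) (@eval_all1 _ g V2).
  rewrite mulg1 !mulgA; have [-> _] := eval_idem ee (gE _ tU1).
  by have [-> _] := eval_idem ee (gE _ tV1).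
move=> c cV; rewrite /g; case: eqP => [cx|_]; first by rewrite -cx cV in xV2.
by case: eqP => // ct; rewrite -ct cV in tV2.
Qed.

Lemma split_once (t : nat) (w : seq nat) : t \in w -> ~~ (1 < count_mem t w)%N ->
  exists w1 w2, [/\ w = w1 ++ t :: w2, t \notin w1 & t \notin w2].
Proof.
case/split_mem=> w1 [w2 [-> tw1]]; rewrite count_cat /= eqxx (count_memPn tw1).
rewrite add0n ltnS -has_count has_pred1 => tw2.
by exists w1, w2; split.
Qed.

Lemma count_once (t : nat) (w1 w2 : seq nat) : t \notin w1 -> t \notin w2 ->
  count_mem t (w1 ++ t :: w2) = 1%N.
Proof.
by move=> /count_memPn t1 /count_memPn t2; rewrite count_cat /= eqxx t1 t2.
Qed.

(** Let U have the value bc and V another one. Any disagreement about the multiplicity of c, the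
    presence of b before it or of a after it gives sig1. Otherwise the part of V before c has the
    value 0, so some a precedes some b there but not in U, and this gives sig2. *)
Lemma A_fail (u v : seq nat) : ~ satisfies A_monoid (u, v) ->
  (forall G, base G -> satisfies G (u, v) -> p_sig1 G) \/
  (forall G, base G -> satisfies G (u, v) -> p_sig2 G).
Proof.
move/existsNP=> [h /= /A_fail_words[U [V [UE VE UV]]]].
suff [H|H] : (forall G, base G -> satisfies G (U, V) -> p_sig1 G) \/
             (forall G, base G -> satisfies G (U, V) -> p_sig2 G).
- by left=> G Gb /UV; apply: H.
- by right=> G Gb /UV; apply: H.
have [U1 [U2 [defU cU1 cU2 bU1 aU2]]] := A_eval_bc UE.
have cU : 2%N \in U by rewrite defU mem_cat mem_head orbT.
case: (boolP (2%N \in V)) => cV; last first.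
  by left=> G Gb GUV; apply/triv_sig1/(derive_triv Gb GUV cU cV).
case: (boolP (1 < count_mem 2 V)%N) => c2V.
  left=> G Gb GUV; apply/(band_sig1 Gb)/(derive_band Gb GUV _ c2V).
  by rewrite defU count_once.
have [V1 [V2 [defV cV1 cV2]]] := split_once cV c2V.
case: (boolP (1%N \in V1)) => bV1; last first.
  left=> G Gb GUV; apply/tau1_sig1.
  by rewrite defU defV in GUV; apply: (derive_tau1 Gb (x := 1%N) _ GUV).
case: (boolP (0%N \in V2)) => aV2.
  left=> G Gb /satisfies_sym GUV; apply/tau2_sig1.
  by rewrite defU defV in GUV; apply: (derive_tau2 Gb (x := 0%N) _ GUV).
have V1E : eval A_letter V1 = A_0.
  move: VE; rewrite defV eval_cat eval_cons.
  move: (A_eval_noc cV1) (A_eval_1in bV1) (A_eval_b cV2 aV2).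
  by case: (eval _ V1) => //; case: (eval _ V2).
right=> G Gb GUV f e t ff ee.
(* The images of a, b, c. The choice e t f for c respects the relations a c = c and c b = c, so the
   two sides, multiplied by f on both ends, become f e t f and f e f t f. *)
pose g c := nth 1 [:: e; f; e * t * f] c.
have fE (w : seq nat) : 2%N \notin w -> f * eval g w =
    match eval A_letter w with
    | A_1 | A_b => f | A_a | A_ba => f * e | _ => f * e * f end.
  elim/last_ind: w => [|w c IH]; first by rewrite !eval_nil mulg1.
  rewrite -cats1 mem_cat negb_or !eval_cat !eval_cons !eval_nil !mulg1 mulgA.
  case/andP=> cw cc; rewrite IH //; move: (A_eval_noc cw).
  case: c cc => [|[|[|[|c]]]] //= _; case: (eval _ w) => //= _; rewrite ?mulg1 //;
  by rewrite -?(mulgA _ e e) -?(mulgA _ f f) ?ee ?ff // base_efef.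
have eE (w : seq nat) : 2%N \notin w -> 0%N \notin w -> f * eval g w * f = f.
  move=> cw aw; have [|-> _] := @eval_idem _ f g w ff; last exact: ff.
  move=> c cw'; case: c cw' => [|[|[|[|c]]]] cw'; rewrite ?/g /=; [|by right| |by left|by
    left].
    by rewrite cw' in aw.
  by rewrite cw' in cw.
have := congr1 (fun z => f * z * f) (GUV g).
rewrite /= defU defV !eval_cat !eval_cons !mulgA.
rewrite fE // fE // V1E /= -!(mulgA _ f (eval g _)) -!(mulgA _ _ f) !(mulgA f (eval g _))
  !eE //.
rewrite !mulgA base_efef //.
have ebc : eval A_letter U = A_bc := UE.
move: (A_eval_noc cU1) (A_eval_1in bU1) ebc; rewrite defU eval_cat eval_cons.
case: (eval _ U1) => //= _ _; case: (eval _ U2) => //= _; by rewrite -?(mulgA _ e e) ?ee.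
Qed.

Definition R_word (x : R_monoid) : seq nat :=
  match x with
  | R_1 => [::] | R_0 => [:: 0; 1] | R_a => [:: 0] | R_b => [:: 1] | R_c => [:: 2]
  | R_cb => [:: 2; 1] | R_ac => [:: 0; 2]
  end%N.

Definition R_letter (c : nat) : R_monoid := nth R_1 [:: R_a; R_b; R_c] c.

Lemma R_wordK x : eval R_letter (R_word x) = x.
Proof. by case: x; eval_word. Qed.

(** The counterpart of [A_separate], with ac in the role of bc. *)
Lemma R_separate (m m' : R_monoid) : m <> m' -> exists P Q,
  (P * m * Q = R_ac /\ P * m' * Q <> R_ac) \/
  (P * m' * Q = R_ac /\ P * m * Q <> R_ac).
Proof.
case: m; case: m' => // _;
  first [sep R_a R_1|sep R_a R_c|sep R_1 R_c|sep R_a R_b|sep R_1 R_ac|sep R_ac R_1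
        |sep R_1 R_1|sep R_1 R_b].
Qed.

Lemma R_fail_words (u v : seq nat) (h : nat -> R_monoid) : eval h u <> eval h v ->
  exists U V, [/\ eval R_letter U = R_ac, eval R_letter V <> R_ac &
    forall G, satisfies G (u, v) -> satisfies G (U, V)].
Proof.
move=> huv; have [P [Q PQ]] := R_separate huv.
pose W w := R_word P ++ subst (R_word \o h) w ++ R_word Q.
have WE w : eval R_letter (W w) = P * eval h w * Q.
  rewrite /W !eval_cat eval_subst !R_wordK mulgA; congr (_ * _ * _).
  by apply: eq_in_eval => c _ /=; rewrite R_wordK.
have Wsat G x y : satisfies G (x, y) -> satisfies G (W x, W y).
  by move=> Gxy k /=; rewrite /W !eval_cat !eval_subst Gxy.
case: PQ => -[E1 E2]; [exists (W u), (W v)|exists (W v), (W u)];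
  rewrite !WE; split=> // G Guv; apply: Wsat => // k; exact/esym/Guv.
Qed.

Definition R_no_a (x : R_monoid) :=
  if x is (R_1 | R_b | R_c | R_cb) then true else false.
Definition R_in_c (x : R_monoid) := if x is (R_1 | R_c) then true else false.
Definition R_in_b (x : R_monoid) := if x is (R_1 | R_b) then true else false.

Lemma R_eval_noa w : 0%N \notin w -> R_no_a (eval R_letter w).
Proof.
elim: w => [|c w IH]; first by rewrite eval_nil.
rewrite inE negb_or eval_cons => /andP[c2 /IH].
by case: c c2 => [|[|[|[|c]]]] //= _; case: (eval _ w).
Qed.

Lemma R_eval_nob w : 0%N \notin w -> R_in_c (eval R_letter w) = (1%N \notin w).
Proof.
elim: w => [|c w IH]; first by rewrite eval_nil.
rewrite !inE !negb_or eval_cons => /andP[c0 /[dup] /R_eval_noa nw /IH <-].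
by move: nw; case: c c0 => [|[|[|[|c]]]] //= _; case: (eval _ w).
Qed.

Lemma R_eval_2in w : 0%N \notin w -> 2%N \in w -> eval R_letter w <> R_1.
Proof.
elim: w => // c w IH; rewrite inE eval_cons negb_or => /andP[c0 aw] /predU1P[<-|].
  by case: (eval _ w).
move=> /(IH aw); move: (R_eval_noa aw).
by case: c c0 => [|[|[|[|c]]]] //= _; case: (eval _ w).
Qed.

Lemma R_eval_2notin w : 0%N \notin w -> 2%N \notin w -> R_in_b (eval R_letter w).
Proof.
elim: w => [|c w IH]; first by rewrite eval_nil.
rewrite !inE !negb_or eval_cons => /andP[c2 /IH{}IH] /andP[c0 /IH].
by case: c c0 c2 => [|[|[|[|c]]]] //= _; case: (eval _ w).
Qed.

Lemma R_eval_ac U : eval R_letter U = R_ac -> exists U1 U2,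
  [/\ U = U1 ++ 0%N :: U2, 0%N \notin U1 /\ 0%N \notin U2, 1%N \notin U1 &
      eval R_letter U2 = R_c \/ eval R_letter U2 = R_cb].
Proof.
move=> UE; have cU : 0%N \in U.
  by case: (boolP (0%N \in U)) => // /R_eval_noa; rewrite UE.
have [U1 [U2 [defU cU1]]] := split_mem cU; exists U1, U2.
move: UE; rewrite defU eval_cat eval_cons => UE.
have n1 := R_eval_noa cU1.
have cU2 : 0%N \notin U2.
  apply/negP => /split_mem[w1 [w2 [defU2 /R_eval_noa]]]; move: UE n1.
  rewrite defU2 eval_cat eval_cons.
  by case: (eval _ U1); case: (eval _ w1); case: (eval _ w2).
split=> //.
  by rewrite -R_eval_nob //; move: UE n1; case: (eval _ U1); case: (eval _ U2).
by move: UE n1; case: (eval _ U1); case: (eval _ U2) => //=; tauto.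
Qed.

(** Apart from contents, which give sig1 as for A, what R_2 sees is whether c or b comes first after
    the simple letter a, with no b before a. A disagreement on this is what eta resolves. *)
Lemma R_fail (u v : seq nat) : ~ satisfies R_monoid (u, v) ->
  (forall G, base G -> satisfies G (u, v) -> p_sig1 G) \/
  (forall G, base G -> satisfies G (u, v) -> p_eta G).
Proof.
move/existsNP=> [h /= /R_fail_words[U [V [UE VE UV]]]].
suff [H|H] : (forall G, base G -> satisfies G (U, V) -> p_sig1 G) \/
             (forall G, base G -> satisfies G (U, V) -> p_eta G).
- by left=> G Gb /UV; apply: H.
- by right=> G Gb /UV; apply: H.
have [U1 [U2 [defU [aU1 aU2] bU1 U2E]]] := R_eval_ac UE.
have aU : 0%N \in U by rewrite defU mem_cat mem_head orbT.
case: (boolP (0%N \in V)) => aV; last first.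
  by left=> G Gb GUV; apply/triv_sig1/(derive_triv Gb GUV aU aV).
case: (boolP (1 < count_mem 0 V)%N) => a2V.
  left=> G Gb GUV; apply/(band_sig1 Gb)/(derive_band Gb GUV _ a2V).
  by rewrite defU count_once.
have [V1 [V2 [defV aV1 aV2]]] := split_once aV a2V.
case: (boolP (1%N \in V1)) => bV1.
  left=> G Gb /satisfies_sym GUV; apply/tau1_sig1.
  by rewrite defU defV in GUV; apply: (derive_tau1 Gb (x := 1%N) _ GUV).
have cU2 : 2%N \in U2.
  case: (boolP (2%N \in U2)) => // /(R_eval_2notin aU2).
  by case: U2E => ->.
case: (boolP (2%N \in V2)) => cV2; last first.
  left=> G Gb GUV; apply/tau2_sig1.
  by rewrite defU defV in GUV; apply: (derive_tau2 Gb (x := 2%N) _ GUV).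
have V2E : eval R_letter V2 = R_b.
  move: VE; rewrite defV eval_cat eval_cons.
  move: (R_eval_noa aV2) (R_eval_2in aV2 cV2); rewrite -R_eval_nob // in bV1.
  by move: bV1; case: (eval _ V1) => //; case: (eval _ V2).
have bV2 : 1%N \in V2 by rewrite -[_ \in _]negbK -R_eval_nob // V2E.
case: (boolP (1%N \in U2)) => bU2; last first.
  left=> G Gb /satisfies_sym GUV; apply/triv_sig1/(derive_triv Gb GUV (x := 1%N)).
    by rewrite defV mem_cat inE bV2 !orbT.
  by rewrite defU mem_cat inE (negPf bU1) (negPf bU2).
have {}U2E : eval R_letter U2 = R_cb.
  by case: U2E => // E; have := R_eval_nob aU2; rewrite bU2 E.
right=> G Gb GUV e f t ee ff.
(* Multiplied by e on both ends, the side where c comes first becomes e t e f e and the other e t f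
   e. *)
pose g c := nth 1 [:: t; f; e] c.
have gE (w : seq nat) : 0%N \notin w -> {in w, forall c, [\/ g c = 1, g c = e | g c = f]}.
  move=> aw c cw; case: c cw => [|[|[|[|c]]]] cw; rewrite /g /=.
  - by rewrite cw in aw.
  - exact: Or33.
  - exact: Or32.
  - exact: Or31.
  - exact: Or31.
have eE (w : seq nat) : 0%N \notin w -> 1%N \notin w -> e * eval g w = e.
  move=> aw bw; have [|-> _] := @eval_idem _ e g w ee; last by [].
  move=> c cw'; case: c cw' => [|[|[|[|c]]]] cw'; rewrite ?/g /=; [| |by right|by left|by
    left].
    by rewrite cw' in aw.
  by rewrite cw' in bw.
have R1 (w : seq nat) : 0%N \notin w -> 1%N \notin w -> 2%N \notin w -> eval R_letter w =
  R_1.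
  move=> aw bw cw; apply: eval_all1 => c cin.
  case: c cin => [|[|[|[|c]]]] // cin; first by rewrite cin in aw.
    by rewrite cin in bw.
  by rewrite cin in cw.
have Rc (w : seq nat) : 0%N \notin w -> 1%N \notin w -> 2%N \in w -> eval R_letter w = R_c.
  move=> aw bw cw; move: bw (R_eval_noa aw) (R_eval_2in aw cw).
  by rewrite -R_eval_nob //; case: (eval _ w).
have [w1 [w2 [defU2 bw1]]] := split_mem bU2.
have [x1 [x2 [defV2 bx1]]] := split_mem bV2.
move: aU2; rewrite defU2 mem_cat inE !negb_or => /and3P[aw1 _ aw2].
move: aV2; rewrite defV2 mem_cat inE !negb_or => /and3P[ax1 _ ax2].
have cw1 : 2%N \in w1.
  case: (boolP (2%N \in w1)) => // cw1; move: U2E.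
  by rewrite defU2 eval_cat eval_cons R1 //=; case: (eval _ w2).
have cx1 : 2%N \notin x1.
  apply/negP => cx1; move: V2E; rewrite defV2 eval_cat eval_cons Rc //=.
  by case: (eval _ x2).
have w1E : eval g w1 = e.
  apply: (@eval_idem_mem _ e g w1 2%N ee) => // c cin.
  case: c cin => [|[|[|[|c]]]] cin; [|rewrite cin in bw1 => //|by right|by left|by left].
    by rewrite cin in aw1.
have x1E : eval g x1 = 1.
  apply: eval_all1 => c cin; case: c cin => [|[|[|[|c]]]] // cin; first by rewrite cin in
    ax1.
    by rewrite cin in bx1.
  by rewrite cin in cx1.
have := congr1 (fun z => e * z * e) (GUV g).
rewrite /= defU defV defU2 defV2 !(eval_cat, eval_cons) w1E x1E !mulgA mulg1 !eE //.
rewrite -![g 0%N]/t -![g 1%N]/f -(mulgA e t e).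
have [_ ->] := eval_etf Gb (t * e) ee ff (gE _ aw2).
by have [_ ->] := eval_etf Gb t ee ff (gE _ ax2); rewrite !mulgA.
Qed.

(** * Occurrences and blocks *)

Section Bubble.
Variable T : eqType.
Implicit Types (w p q : seq T).

(** Compares first occurrences; an absent letter counts as coming after all the others. *)
Definition before w (a b : T) := (index a w < index b w)%N.

Lemma before_mem p q a c : before (p ++ a :: q) c a -> a \notin p -> c \in p.
Proof.
rewrite /before !index_cat => + /negPf ap; rewrite ap /= eqxx addn0.
by case: ifP => // _; rewrite ltnNge leq_addr.
Qed.

Lemma before_memr p q a d : before (p ++ a :: q) a d -> a \notin p ->
  d \in p ++ a :: q -> d \in q.
Proof.
rewrite /before !index_cat mem_cat inE => + /negPf ap; rewrite ap /= eqxx addn0.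
case: (boolP (d \in p)) => [dp|_ /=].
  by move=> lt _; have := index_mem d p; rewrite dp => /(ltn_trans lt); rewrite ltnn.
rewrite -[X in (X < _)%N]addn0 ltn_add2l; case: eqP => //= ad _.
by case/predU1P=> // da; rewrite da in ad.
Qed.

Lemma before_split p q a c : a \notin p -> c \in p -> before (p ++ a :: q) c a.
Proof.
by move=> /negPf ap cp; rewrite /before !index_cat cp ap /= eqxx addn0 index_mem.
Qed.

Lemma before_total w a b : a \in w -> a != b -> before w a b || before w b a.
Proof.
move=> aw; rewrite /before; case: ltngtP => // /eqP; rewrite eq_sym => /eqP E.
rewrite -(nth_index a aw) -E.
have /(nth_index a) -> : b \in w by rewrite -index_mem E index_mem.
by rewrite eqxx.
Qed.

Lemma before_asym w a b : before w a b -> ~~ before w b a.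
Proof. by rewrite /before -leqNgt => /ltnW. Qed.

Lemma before_neq w a b : before w a b -> a != b.
Proof. by apply: contraTneq => ->; rewrite /before ltnn. Qed.

Lemma before_swap p q a b x y : before (p ++ a :: b :: q) x y ->
  ~~ ((x == a) && (y == b)) -> before (p ++ b :: a :: q) x y.
Proof.
rewrite /before !index_cat /= [x == a]eq_sym [y == b]eq_sym.
case: (boolP (x \in p)) => xp; case: (boolP (y \in p)) => yp //.
- by move=> _ _; rewrite ltn_addr // index_mem.
- by move=> lt _; have := leq_trans lt (index_size _ _); rewrite ltnNge leq_addr.
- rewrite !ltn_add2l; case: (a == x) => /=.
    by case: (b == x); case: (a == y); case: (b == y).
  by case: (b == x); case: (a == y); case: (b == y).
Qed.

(** Sorting of u towards v by exchanging neighbours. Only pairs on which u and v disagree are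
    exchanged, and by the invariant [ok] every order common to u and v persists; both facts are
    available when an exchange is to be justified. *)
Lemma bubble (R : seq T -> seq T -> Prop) u v :
  (forall w, R w w) -> (forall w1 w2 w3, R w1 w2 -> R w2 w3 -> R w1 w3) ->
  uniq u -> perm_eq u v ->
  (forall p a b q, perm_eq (p ++ a :: b :: q) u ->
     (forall c d, before u c d -> before v c d -> before (p ++ a :: b :: q) c d) ->
     before u a b -> before v b a -> R (p ++ a :: b :: q) (p ++ b :: a :: q)) ->
  R u v.
Proof.
move=> Rxx Rtr Uu puv swap.
pose ok w := perm_eq w u /\ (forall c d, before u c d -> before v c d -> before w c d).
have okU w : ok w -> uniq w by case=> /perm_uniq ->.
have Uv : uniq v by rewrite -(perm_uniq puv).
(* The next letter c of [v] moves left across [q], up to the part [v1] already in place. *)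
have move1 v1 c v3 : v = v1 ++ c :: v3 -> forall q r, ok (v1 ++ q ++ c :: r) ->
    R (v1 ++ q ++ c :: r) (v1 ++ c :: q ++ r) /\ ok (v1 ++ c :: q ++ r).
  move=> vE; elim/last_ind => [|q d IH] r okw; first by split.
  have wE : v1 ++ rcons q d ++ c :: r = (v1 ++ q) ++ d :: c :: r.
    by rewrite -cats1 -!catA.
  have Uw := okU _ okw; rewrite wE in Uw okw *.
  have [pw cw] := okw.
  have memv x : (x \in (v1 ++ q) ++ d :: c :: r) = (x \in v).
    by rewrite (perm_mem pw) (perm_mem puv).
  have [dq cv1 dc] : [/\ d \notin v1, c \notin v1 & d != c].
    move: Uw; rewrite -catA cat_uniq => /and3P[_ + Uw].
    rewrite has_cat /= !negb_or => /and4P[_ -> -> _].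
    move: Uw; rewrite cat_uniq /= => /and3P[_ _] /and3P[].
    by rewrite inE negb_or => /andP[].
  have bvcd : before v c d.
    rewrite /before vE !index_cat (negPf cv1) (negPf dq) /= eqxx.
    by rewrite eq_sym (negPf dc) addn0 addnS ltnS leq_addr.
  have bwdc : before ((v1 ++ q) ++ d :: c :: r) d c.
    rewrite -cat1s catA; apply: before_split; last by rewrite mem_cat inE eqxx orbT.
    move: Uw; rewrite -cat1s catA cat_uniq /= negb_or => /and3P[_ /andP[-> //]].
  have budc : before u d c.
    have du : d \in u by rewrite -(perm_mem pw) mem_cat mem_head orbT.
    case/orP: (before_total du dc) => // bucd.
    by have := before_asym (cw _ _ bucd bvcd); rewrite bwdc.
  have okw' : ok ((v1 ++ q) ++ c :: d :: r).
    split=> [|x y bu bv].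
      rewrite -(permPr pw) perm_cat2l -(cat1s c) -(cat1s d) -(cat1s d (c :: r)) -(cat1s c
        r).
      by rewrite perm_catCA.
    apply: before_swap; first exact: cw.
    by apply/negP => /andP[/eqP xd /eqP yc]; have := before_asym bv; rewrite xd yc bvcd.
  have [] := IH (d :: r); first by rewrite catA.
  rewrite cat_rcons -catA => R1 ok1; split=> //; apply: Rtr R1.
  by have := swap _ _ _ _ pw cw budc bvcd; rewrite -!catA.
have main v2 : forall v1 w2, v = v1 ++ v2 -> ok (v1 ++ w2) -> R (v1 ++ w2) v.
  elim: v2 => [|c v3 IH] v1 w2 vE okw.
    have : size (v1 ++ w2) = size v by rewrite (perm_size okw.1) (perm_size puv).
    rewrite vE !size_cat => /addnI/size0nil ->; exact: Rxx.
  have cw2 : c \in w2.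
    have : c \in v1 ++ w2 by rewrite (perm_mem okw.1) (perm_mem puv) vE mem_cat mem_head
      orbT.
    rewrite mem_cat => /orP[cv1|//].
    by move: Uv; rewrite vE cat_uniq /= cv1 andbF.
  have defw2 : w2 = take (index c w2) w2 ++ c :: drop (index c w2).+1 w2.
    by rewrite -{1}[w2](cat_take_drop (index c w2)) (drop_nth c) ?index_mem // nth_index.
  move: okw; rewrite defw2 => okw; have [R1 ok1] := move1 _ _ _ vE _ _ okw.
  apply: Rtr R1 _; rewrite -cat_rcons; apply: IH; last by rewrite cat_rcons.
  by rewrite vE cat_rcons.
by apply: (main v [::] u) => //; split.
Qed.

End Bubble.

(* b and b' are the corresponding blocks (maximal factors without simple letters)
   of u and v, where s is the set of simple letters. *)
Record blocks (s : pred nat) (u v u1 b u2 v1 b' v2 : seq nat) : Prop := Blocks {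
  blocks_u : u = u1 ++ b ++ u2;
  blocks_v : v = v1 ++ b' ++ v2;
  blocks_f1 : filter s u1 = filter s v1;
  blocks_f2 : filter s u2 = filter s v2;
  blocks_b : all (predC s) b;
  blocks_b' : all (predC s) b';
  blocks_l : (u1 = [::] /\ v1 = [::]) \/
    exists t u1' v1', [/\ s t, u1 = rcons u1' t & v1 = rcons v1' t];
  blocks_r : (u2 = [::] /\ v2 = [::]) \/
    exists t u2' v2', [/\ s t, u2 = t :: u2' & v2 = t :: v2'] }.

Lemma filter_split (s : pred nat) u t ts : filter s u = t :: ts ->
  exists b u', [/\ u = b ++ t :: u', all (predC s) b, s t & filter s u' = ts].
Proof.
elim: u => //= c u IH; case: ifP => sc.
  by case=> ct uts; rewrite ct in sc *; exists [::], u; split.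
case/IH=> b [u' [-> sb st <-]].
by exists (c :: b), u'; split=> //=; rewrite sc.
Qed.

Lemma filter_nilP (s : pred nat) u : filter s u = [::] -> all (predC s) u.
Proof. by elim: u => //= c u IH; case: ifP. Qed.

(** Blocks are replaced from left to right: what precedes the current one already comes from v, what
    follows still comes from u, whence [v1] and [u2] in the step. *)
Lemma block_ind (s : pred nat) (R : seq nat -> seq nat -> Prop) u v :
  (forall w, R w w) -> (forall w1 w2 w3, R w1 w2 -> R w2 w3 -> R w1 w3) ->
  (forall u1 b u2 v1 b' v2, blocks s u v u1 b u2 v1 b' v2 ->
     R (v1 ++ b ++ u2) (v1 ++ b' ++ u2)) ->
  filter s u = filter s v -> R u v.
Proof.
move=> Rxx Rtr step fuv.
suff main ts : forall u1 u' v1 v', u = u1 ++ u' -> v = v1 ++ v' ->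
    filter s u1 = filter s v1 -> filter s u' = ts -> filter s v' = ts ->
    (u1 = [::] /\ v1 = [::]) \/
      (exists t u1' v1', [/\ s t, u1 = rcons u1' t & v1 = rcons v1' t]) ->
    R (v1 ++ u') (v1 ++ v').
  by apply: (main (filter s v) [::] u [::] v) => //; left.
elim: ts => [|t ts IH] u1 u' v1 v' uE vE f1 fu fv l.
  have := step u1 u' [::] v1 v' [::]; rewrite !cats0; apply; split=> //.
  - by rewrite cats0.
  - by rewrite cats0.
  - exact: filter_nilP.
  - exact: filter_nilP.
  - by left.
have [b [u'' [u'E sb st fu'']]] := filter_split fu.
have [b' [v'' [v'E sb' _ fv'']]] := filter_split fv.
have filt0 (w : seq nat) : all (predC s) w -> filter s w = [::].
  by elim: w => //= c w IHw /andP[/negPf -> /IHw].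
apply: (Rtr _ (v1 ++ b' ++ t :: u'')).
  rewrite u'E; apply: (step u1 b (t :: u'') v1 b' (t :: v'')); split=> //.
  - by rewrite uE u'E.
  - by rewrite vE v'E.
  - by rewrite /= st fu'' fv''.
  - by right; exists t, u'', v''; split.
rewrite v'E -!(cat_rcons t b') !catA; apply: (IH (u1 ++ rcons b t)) => //.
- by rewrite uE u'E -catA cat_rcons.
- by rewrite vE v'E -catA cat_rcons.
- by rewrite !filter_cat f1 !filter_rcons st (filt0 b) // (filt0 b').
- by right; exists t, (u1 ++ b), (v1 ++ b'); rewrite !rcons_cat; split.
Qed.

(* [(x, true)] and [(x, false)] mark the first and the last occurrence of x;
   letters in [k] have no last token, letters in [seen] no first token. *)
Fixpoint toks (k : pred nat) (seen w : seq nat) : seq (nat * bool) :=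
  if w is c :: w' then
    (if c \in seen then [::] else [:: (c, true)]) ++
    (if (c \in w') || k c then [::] else [:: (c, false)]) ++ toks k (c :: seen) w'
  else [::].

Lemma mem_toksT k seen w x :
  ((x, true) \in toks k seen w) = (x \in w) && (x \notin seen).
Proof.
elim: w seen => //= c w IH seen; rewrite !mem_cat IH !inE negb_or.
have -> : ((x, true) \in (if (c \in w) || k c then [::] else [:: (c, false)])) = false.
  by case: ifP; rewrite // inE xpair_eqE andbF.
have -> : ((x, true) \in (if c \in seen then [::] else [:: (c, true)])) =
    (x == c) && (x \notin seen).
  by case: (eqVneq x c) => [->|xc]; case: ifP; rewrite // inE xpair_eqE ?eqxx ?(negPf xc).
by case: (eqVneq x c) => [->|xc] //=; rewrite andbF orbF.
Qed.

Lemma mem_toksF k seen w x : ((x, false) \in toks k seen w) = (x \in w) && ~~ k x.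
Proof.
elim: w seen => //= c w IH seen; rewrite !mem_cat IH !inE.
have -> : ((x, false) \in (if c \in seen then [::] else [:: (c, true)])) = false.
  by case: ifP; rewrite // inE xpair_eqE andbF.
case: (eqVneq x c) => [->|xc] /=.
  by case: (c \in w); case: (k c); rewrite //= inE eqxx.
by case: ifP; rewrite // inE xpair_eqE (negPf xc).
Qed.

Lemma toks_uniq k seen w : uniq (toks k seen w).
Proof.
elim: w seen => //= c w IH seen.
have cT : (c, true) \notin toks k (c :: seen) w by rewrite mem_toksT mem_head andbF.
have cF : ~~ ((c \in w) || k c) -> (c, false) \notin toks k (c :: seen) w.
  by rewrite mem_toksF negb_or => /andP[/negPf ->].
case: ifP => _; case: ifPn => [_|/cF h] /=;
  by rewrite ?inE ?xpair_eqE ?andbF /= ?IH ?cT ?h.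
Qed.

(** For [w1] the letters of [w2] join [k], as their last occurrences lie in [w2]; [catrev] reflects
    the growth of [seen] letter by letter. *)
Lemma toks_cat k seen w1 w2 : toks k seen (w1 ++ w2) =
  toks [pred c | (c \in w2) || k c] seen w1 ++ toks k (catrev w1 seen) w2.
Proof.
by elim: w1 seen => //= c w1 IH seen; rewrite IH mem_cat -!catA orbA.
Qed.

Lemma toks_at k (seen w1 w2 : seq nat) y : y \notin w1 -> y \notin seen -> exists Z,
  toks k seen (w1 ++ y :: w2) =
  toks [pred c | (c \in y :: w2) || k c] seen w1 ++ (y, true) :: Z.
Proof.
move=> yw1 ys; rewrite toks_cat /= catrevE mem_cat mem_rev (negPf yw1) (negPf ys) /=.
by eexists.
Qed.

Lemma beforeTT_seen k (seen w : seq nat) x y : x \in w -> x \notin seen -> y \notin seen ->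
  before (toks k seen w) (x, true) (y, true) ->
  exists w1 w2, [/\ w = w1 ++ x :: w2, x \notin w1 & y \notin w1].
Proof.
move=> /split_mem[w1 [w2 [wE xw1]]] xs ys bxy; exists w1, w2; split=> //.
apply/negP => yw1; have [Z tE] := toks_at k w2 xw1 xs; rewrite -wE in tE.
have := before_asym bxy; rewrite tE before_split //.
  by rewrite mem_toksT (negPf xw1).
by rewrite mem_toksT yw1.
Qed.

Lemma beforeTT k w x y : x \in w ->
  before (toks k [::] w) (x, true) (y, true) ->
  exists w1 w2, [/\ w = w1 ++ x :: w2, x \notin w1 & y \notin w1].
Proof. by move=> xw; apply: beforeTT_seen. Qed.

Lemma beforeFT k w x y : y \in w ->
  before (toks k [::] w) (x, false) (y, true) ->
  exists w1 w2, [/\ w = w1 ++ y :: w2, y \notin w1 & x \notin w2].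
Proof.
move=> /split_mem[w1 [w2 [wE yw1]]] bxy; exists w1, w2; split=> //.
apply/negP => xw2; have [Z tE] := @toks_at k [::] _ w2 _ yw1 isT; rewrite -wE in tE.
have := before_mem; rewrite tE in bxy => /(_ _ _ _ _ _ bxy).
by rewrite mem_toksT (negPf yw1) mem_toksF /= inE xw2 orbT andbF => /(_ isT).
Qed.

Lemma beforeTF k w x y : y \in w -> (x, false) \in toks k [::] w -> x != y ->
  before (toks k [::] w) (y, true) (x, false) ->
  exists w1 w2, [/\ w = w1 ++ y :: w2, y \notin w1 & x \in w2].
Proof.
move=> /split_mem[w1 [w2 [wE yw1]]]; rewrite mem_toksF => /andP[xw kx] xy bxy.
exists w1, w2; split=> //; case: (boolP (x \in w2)) => // xw2.
have [Z tE] := @toks_at k [::] _ w2 _ yw1 isT; rewrite -wE in tE.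
have := before_asym bxy; rewrite tE before_split //.
  by rewrite mem_toksT (negPf yw1).
rewrite mem_toksF /= inE (negPf xy) (negPf xw2) kx andbT.
by move: xw; rewrite wE mem_cat inE (negPf xy) (negPf xw2) /= orbF.
Qed.

Lemma beforeTF_self k w x : x \in w -> ~~ k x ->
  before (toks k [::] w) (x, true) (x, false).
Proof.
move=> /split_mem[w1 [w2 [-> xw1]]] kx; have [Z ->] := @toks_at k [::] _ w2 _ xw1 isT.
have xF : (x, false) \notin toks [pred c | (c \in x :: w2) || k c] [::] w1.
  by rewrite mem_toksF (negPf xw1).
have xT : (x, true) \notin toks [pred c | (c \in x :: w2) || k c] [::] w1.
  by rewrite mem_toksT (negPf xw1).
by rewrite /before !index_cat (negPf xF) (negPf xT) /= eqxx xpair_eqE andbF addn0 addnS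
  ltnS leq_addr.
Qed.

Lemma once_notin (z : nat) w1 w2 : count_mem z (w1 ++ z :: w2) = 1%N ->
  z \notin w1 /\ z \notin w2.
Proof.
rewrite count_cat /= eqxx addnCA add1n => -[] /eqP; rewrite addn_eq0.
by case/andP=> /eqP/count_memPn-> /eqP/count_memPn->.
Qed.

(** * Laws forced by a disagreement in the order of occurrences *)

Section DeriveOrder.
Variable G : monoidType.
Hypothesis Gb : base G.
Implicit Types (u v w : seq nat) (x y t : nat).

Definition assign2 x (e : G) y (f : G) t (a : G) (c : nat) : G :=
  if c == x then e else if c == y then f else if c == t then a else 1.

Lemma assign2P x e y f t a w : t \notin w \/ a = 1 ->
  {in w, forall c, [\/ assign2 x e y f t a c = 1, assign2 x e y f t a c = e |
                       assign2 x e y f t a c = f]}.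
Proof.
move=> tw c cw; rewrite /assign2; case: eqP => _; first exact: Or32.
case: eqP => _; first exact: Or33.
by case: eqP tw => [<- [/negP//|->]|_ _]; exact: Or31.
Qed.

Lemma assign2x x e y f t a w : t \notin w \/ a = 1 -> y \notin w ->
  {in w, forall c, assign2 x e y f t a c = 1 \/ assign2 x e y f t a c = e}.
Proof.
move=> tw yw c cw; rewrite /assign2; case: eqP => _; first by right.
case: eqP => [ct|_]; first by rewrite -ct cw in yw.
by left; case: eqP tw => // <- [/negP|].
Qed.

Lemma assign2y x e y f t a w : t \notin w \/ a = 1 -> x \notin w ->
  {in w, forall c, assign2 x e y f t a c = 1 \/ assign2 x e y f t a c = f}.
Proof.
move=> tw xw c cw; rewrite /assign2; case: eqP => [cx|_]; first by rewrite -cx cw in xw.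
case: eqP => _; first by right.
by left; case: eqP tw => // <- [/negP|].
Qed.

Lemma assign2_1 x e y f t a w : t \notin w \/ a = 1 -> x \notin w -> y \notin w ->
  eval (assign2 x e y f t a) w = 1.
Proof.
move=> tw xw yw; apply: eval_all1 => c cw; rewrite /assign2.
case: eqP => [cx|_]; first by rewrite -cx cw in xw.
case: eqP => [cx|_]; first by rewrite -cx cw in yw.
by case: eqP tw => // <- [/negP|].
Qed.

(** Only e's precede the first f, and from there on e f e absorbs everything. *)
Lemma eval_head (e f : G) (g : nat -> G) w y : idem e -> idem f -> g y = f ->
  {in w, forall c, [\/ g c = 1, g c = e | g c = f]} ->
  e * eval g w * f * e = e * f * e.
Proof.
move=> ee ff gy; elim: w => [|c w IH] gE; first by rewrite eval_nil mulg1.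
have gE' : {in w, forall c, [\/ g c = 1, g c = e | g c = f]}.
  by move=> d dw; apply: gE; rewrite inE dw orbT.
rewrite eval_cons; case: (gE c (mem_head _ _)) => ->.
- by rewrite mul1g IH.
- by rewrite mulgA ee IH.
have [|_] := @eval_ef _ Gb e f g (w ++ [:: y]) ee ff.
  by move=> d; rewrite mem_cat => /orP[/gE' //|]; rewrite inE => /eqP ->; apply: Or33.
by rewrite eval_cat eval_cons eval_nil gy mulg1 !mulgA.
Qed.

(** With x = e, y = f and the other letters erased, multiplication by f e f on the right turns the
    sides into e f e and f e f: only the letter that comes first matters. *)
Lemma derive_gam u1 u2 v1 v2 x y : x != y ->
  satisfies G (u1 ++ x :: u2, v1 ++ y :: v2) ->
  x \notin u1 -> y \notin u1 -> x \notin v1 -> y \notin v1 -> p_gam G.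
Proof.
move=> xy Guv xu1 yu1 xv1 yv1 e f ee ff.
pose g := assign2 x e y f 0 1.
have one w : 0%N \notin w \/ 1 = 1 :> G by right.
have gx : g x = e by rewrite /g /assign2 eqxx.
have gy : g y = f by rewrite /g /assign2 eq_sym (negPf xy) eqxx.
have := congr1 (fun z => z * f * e * f) (Guv g).
rewrite /= !eval_cat !eval_cons gx gy /g (@assign2_1 x e y f 0 1 u1) // (@assign2_1 x e y
  f 0 1 v1) // -/g !mul1g.
rewrite (eval_head ee ff gy (assign2P x e y f (one u2))) base_efef // => ->.
have := @eval_head f e g (v2 ++ [:: y]) x ff ee gx.
rewrite eval_cat eval_cons eval_nil gy mulg1 !mulgA; apply.
move=> c; rewrite mem_cat => /orP[cw|]; last first.
  by rewrite inE => /eqP ->; rewrite gy; apply: Or32.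
have [] := assign2P x e y f (one v2) cw; rewrite -/g => ->.
- exact: Or31.
- exact: Or33.
- exact: Or32.
Qed.

(** With x = e, y = f, t = a and the other letters erased, multiplication by f e on the right turns
    the sides into e a e f e and e a f e. *)
Lemma derive_eta U1 B1 U2 V1 B2 V2 x y t : x != y -> x != t -> y != t ->
  satisfies G (U1 ++ t :: B1 ++ x :: U2, V1 ++ t :: B2 ++ y :: V2) ->
  t \notin U1 ++ B1 ++ U2 -> t \notin V1 ++ B2 ++ V2 ->
  x \in U1 -> y \notin U1 -> x \notin B1 -> y \notin B1 ->
  x \in V1 -> y \notin V1 -> x \notin B2 -> y \notin B2 -> p_eta G.
Proof.
move=> xy xt yt Guv; rewrite !mem_cat !negb_or => /and3P[tU1 tB1 tU2] /and3P[tV1 tB2 tV2].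
move=> xU1 yU1 xB1 yB1 xV1 yV1 xB2 yB2 e f a ee ff.
pose g := assign2 x e y f t a.
have gx : g x = e by rewrite /g /assign2 eqxx.
have gy : g y = f by rewrite /g /assign2 eq_sym (negPf xy) eqxx.
have gt : g t = a by rewrite /g /assign2 eq_sym (negPf xt) eq_sym (negPf yt) eqxx.
have B1E : eval g B1 = 1 by apply: assign2_1 => //; left.
have B2E : eval g B2 = 1 by apply: assign2_1 => //; left.
have := congr1 (fun z => z * f * e) (Guv g).
rewrite /= !(eval_cat, eval_cons) gx gy gt B1E B2E !mul1g.
rewrite (eval_idem_mem ee (assign2x x e f (or_introl tU1) yU1) xU1 gx).
rewrite (eval_idem_mem ee (assign2x x e f (or_introl tV1) yV1) xV1 gx).
rewrite !mulgA -!(mulgA (e * a)) !mulgA -(mulgA (e * a) e) -(mulgA (e * a)) -(mulgA (e *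
  a)) (eval_head ee ff gy (assign2P x e y f (or_introl tU2))) !mulgA.
move=> ->; have [|_] := @eval_etf _ Gb a e f g (V2 ++ [:: y]) ee ff.
  move=> d; rewrite mem_cat => /orP[|]; first by apply: assign2P; left.
  by rewrite inE => /eqP ->; apply: Or33.
by rewrite eval_cat eval_cons eval_nil gy mulg1 !mulgA.
Qed.

(** After multiplication by e on the left, the side without an x after the first y is e f and the
    other e f e. *)
Lemma derive_del U1 U2 V1 V2 x y : x != y ->
  satisfies G (U1 ++ y :: U2, V1 ++ y :: V2) ->
  y \notin U1 -> x \in U1 -> x \notin U2 -> y \notin V1 -> x \in V2 -> p_del G.
Proof.
move=> xy Guv yU1 xU1 xU2 yV1 xV2 e f ee ff.
pose g := assign2 x e y f 0 1.
have one w : 0%N \notin w \/ 1 = 1 :> G by right.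
have gx : g x = e by rewrite /g /assign2 eqxx.
have gy : g y = f by rewrite /g /assign2 eq_sym (negPf xy) eqxx.
have [W1 [W2 [V2E xW1]]] := split_mem xV2.
have := congr1 (fun z => e * z) (Guv g).
rewrite /= V2E !(eval_cat, eval_cons) gx gy.
rewrite (eval_idem_mem ee (assign2x x e f (one U1) yU1) xU1 gx).
have [-> _] := eval_idem ff (assign2y e y f (one U2) xU2).
rewrite !mulgA; have [-> _] := eval_idem ee (assign2x x e f (one V1) yV1).
rewrite -(mulgA e f (eval g W1)).
have [-> _] := eval_idem ff (assign2y e y f (one W1) xW1).
have [-> _] := eval_ef Gb ee ff (assign2P x e y f (one W2)).
by rewrite ee.
Qed.

Lemma derive_comm U1 U2 V1 V2 x y : x != y ->
  satisfies G (U1 ++ x :: U2, V1 ++ y :: V2) ->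
  count_mem x (U1 ++ x :: U2) = 1%N -> count_mem y (U1 ++ x :: U2) = 1%N ->
  count_mem x (V1 ++ y :: V2) = 1%N -> count_mem y (V1 ++ y :: V2) = 1%N ->
  y \in U2 -> x \in V2 -> p_comm G.
Proof.
move=> xy Guv xu yu xv yv yU2 xV2 a b.
pose g := assign2 x a y b 0 1.
have one w : 0%N \notin w \/ 1 = 1 :> G by right.
have gx : g x = a by rewrite /g /assign2 eqxx.
have gy : g y = b by rewrite /g /assign2 eq_sym (negPf xy) eqxx.
have key z z' (w1 w2 : seq nat) : z != z' ->
    count_mem z (w1 ++ z :: w2) = 1%N -> count_mem z' (w1 ++ z :: w2) = 1%N ->
    z' \in w2 -> exists w3 w4, [/\ w2 = w3 ++ z' :: w4,
      (z \notin w1) && (z' \notin w1), (z \notin w3) && (z' \notin w3) &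
      (z \notin w4) && (z' \notin w4)].
  move=> zz cz cz' /split_mem[w3 [w4 [w2E z'w3]]]; exists w3, w4.
  have [zw1] := once_notin cz; rewrite w2E mem_cat inE !negb_or => /and3P[zw3 _ zw4].
  move: cz'; rewrite w2E -cat_cons catA => /once_notin[].
  rewrite mem_cat inE !negb_or => /and3P[z'w1 _ _] z'w4.
  by rewrite zw1 zw3 zw4 z'w1 z'w3 z'w4.
have [U3 [U4 [U2E /andP[? ?] /andP[? ?] /andP[? ?]]]] := key _ _ _ _ xy xu yu yU2.
have yx : y != x by rewrite eq_sym.
have [V3 [V4 [V2E /andP[? ?] /andP[? ?] /andP[? ?]]]] := key _ _ _ _ yx yv xv xV2.
have := Guv g; rewrite /= U2E V2E !(eval_cat, eval_cons) gx gy.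
by rewrite !(assign2_1 _ _ (one _)) // !mul1g !mulg1.
Qed.

(** With x = e, the simple letters t and t' arbitrary and the rest erased, multiplication by e at
    both ends leaves e a e b e = e a b e. *)
Lemma derive_sig1 U1 B U2 V1 B' V2 x t t' : x != t -> x != t' -> t != t' ->
  satisfies G (U1 ++ t :: B ++ t' :: U2, V1 ++ t :: B' ++ t' :: V2) ->
  t \notin U1 ++ B ++ U2 -> t \notin V1 ++ B' ++ V2 ->
  t' \notin U1 ++ B ++ U2 -> t' \notin V1 ++ B' ++ V2 ->
  x \in B -> x \notin B' -> p_sig1 G.
Proof.
move=> xt xt' tt' Guv; rewrite !mem_cat !negb_or.
move=> /and3P[tU1 tB tU2] /and3P[tV1 tB' tV2] /and3P[sU1 sB sU2] /and3P[sV1 sB' sV2].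
move=> xB xB' e a b ee.
pose g c := if c == x then e else if c == t then a else if c == t' then b else 1.
have gP (w : seq nat) : t \notin w -> t' \notin w -> {in w, forall c, g c = 1 \/ g c = e}.
  move=> tw tw' c cw; rewrite /g; case: eqP => _; first by right.
  case: eqP => [E|_]; first by rewrite -E cw in tw.
  by case: eqP => [E|_]; [rewrite -E cw in tw'|left].
have gx : g x = e by rewrite /g eqxx.
have gt : g t = a by rewrite /g eq_sym (negPf xt) eqxx.
have gt' : g t' = b by rewrite /g eq_sym (negPf xt') eq_sym (negPf tt') eqxx.
have B'1 : eval g B' = 1.
  apply: eval_all1 => c cw; rewrite /g; case: eqP => [E|_]; first by rewrite -E cw in xB'.
  case: eqP => [E|_]; first by rewrite -E cw in tB'.
  by case: eqP => [E|_] //; rewrite -E cw in sB'.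
have := congr1 (fun z => e * z * e) (Guv g).
rewrite /= !(eval_cat, eval_cons) gt gt' B'1 !mulgA mulg1.
rewrite (eval_idem_mem ee (gP _ tB sB) xB gx).
have [-> _] := eval_idem ee (gP _ tU1 sU1); have [-> _] := eval_idem ee (gP _ tV1 sV1).
rewrite -!(mulgA _ (eval g _) e).
by have [_ ->] := eval_idem ee (gP _ tU2 sU2); have [_ ->] := eval_idem ee (gP _ tV2 sV2).
Qed.

End DeriveOrder.

Lemma blocks_sym s u v u1 b u2 v1 b' v2 :
  blocks s u v u1 b u2 v1 b' v2 -> blocks s v u v1 b' v2 u1 b u2.
Proof.
case=> uE vE f1 f2 sb sb' l r; split=> //.
- by case: l => [[]|[t [x [y []]]]]; [left|right; exists t, y, x; split].
- by case: r => [[]|[t [x [y []]]]]; [left|right; exists t, y, x; split].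
Qed.

(** * Agreement of blocks when sig1 fails *)

Section BlockContent.
Variables (G : monoidType) (s : pred nat).
Hypotheses (Gb : base G) (nsig : ~ p_sig1 G).

(** A difference in content gives the trivial law, tau1, tau2 or sig1, according to which ends of
    the region are bounded by simple letters; each of these implies sig1. *)
Lemma blocks_content_sub u v u1 b u2 v1 b' v2 :
  satisfies G (u, v) -> (forall c, s c -> count_mem c u = 1%N) ->
  (forall c, s c -> count_mem c v = 1%N) -> blocks s u v u1 b u2 v1 b' v2 ->
  [/\ {subset u1 <= v1}, {subset b <= b'} & {subset u2 <= v2}].
Proof.
move=> Guv su sv [uE vE f1 f2 sb sb' l r].
have fmem (w w' : seq nat) x : filter s w = filter s w' -> s x -> x \in w -> x \in w'.
  move=> E sx xw; have : x \in filter s w by rewrite mem_filter sx.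
  by rewrite E mem_filter sx.
split=> x xin.
- case: (boolP (s x)) => sx; first exact: fmem f1 sx xin.
  case: l => [[u1E v1E]|[t [u1' [v1' [st u1E v1E]]]]]; first by rewrite u1E in xin.
  have xt : x != t by apply: contraNneq sx => ->.
  move: xin; rewrite u1E v1E !mem_rcons !inE (negPf xt) /= => xin.
  case: (boolP (x \in v1')) => // xv; case: nsig; apply: tau1_sig1.
  move: Guv (su t st) (sv t st); rewrite uE vE u1E v1E !cat_rcons => Guv'.
  move=> /once_notin[t1 t2] /once_notin[t3 t4].
  exact: (derive_tau1 Gb xt Guv').
- have sx : ~~ s x by have /allP/(_ _ xin) := sb.
  case: (boolP (x \in b')) => // xb'; case: nsig.
  case: l => [[u1E v1E]|[t [u1' [v1' [st u1E v1E]]]]];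
  case: r => [[u2E v2E]|[t' [u2' [v2' [st' u2E v2E]]]]].
  + apply: triv_sig1; rewrite uE vE u1E v1E u2E v2E /= !cats0 in Guv.
    exact: (derive_triv Gb Guv xin xb').
  + have xt : x != t' by apply: contraNneq sx => ->.
    apply: tau1_sig1; move: Guv (su t' st') (sv t' st').
    rewrite uE vE u1E v1E u2E v2E /= => Guv' /once_notin[t1 t2] /once_notin[t3 t4].
    exact: (derive_tau1 Gb xt Guv').
  + have xt : x != t by apply: contraNneq sx => ->.
    apply: tau2_sig1; move: Guv (su t st) (sv t st).
    rewrite uE vE u1E v1E u2E v2E !cats0 !cat_rcons.
    move=> Guv' /once_notin[t1 t2] /once_notin[t3 t4].
    exact: (derive_tau2 Gb xt Guv').
  + have xt : x != t by apply: contraNneq sx => ->.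
    have xt' : x != t' by apply: contraNneq sx => ->.
    move: Guv (su t st) (sv t st) (su t' st') (sv t' st').
    rewrite uE vE u1E v1E u2E v2E !cat_rcons => Guv'.
    move=> /once_notin[t1 t2] /once_notin[t3 t4].
    rewrite -!cat_cons !catA => /once_notin[t5 t6] /once_notin[t7 t8].
    move: t2 t4 t5 t7; rewrite !(mem_cat, inE) !negb_or.
    move=> /and3P[? ? ?] /and3P[? ? ?] /andP[? /andP[? ?]] /andP[? /andP[? ?]].
    apply: (derive_sig1 xt xt' _ Guv') => //; rewrite ?mem_cat ?negb_or; do ?[apply/andP;
      split=> //].
- case: (boolP (s x)) => sx; first exact: fmem f2 sx xin.
  case: r => [[u1E v1E]|[t [u2' [v2' [st u1E v1E]]]]]; first by rewrite u1E in xin.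
  have xt : x != t by apply: contraNneq sx => ->.
  move: xin; rewrite u1E v1E !inE (negPf xt) /= => xin.
  case: (boolP (x \in v2')) => // xv; case: nsig; apply: tau2_sig1.
  move: Guv (su t st) (sv t st); rewrite uE vE u1E v1E !catA => Guv'.
  move=> /once_notin[t1 t2] /once_notin[t3 t4].
  exact: (derive_tau2 Gb xt Guv').
Qed.

Lemma blocks_content u v u1 b u2 v1 b' v2 :
  satisfies G (u, v) -> (forall c, s c -> count_mem c u = 1%N) ->
  (forall c, s c -> count_mem c v = 1%N) -> blocks s u v u1 b u2 v1 b' v2 ->
  [/\ u1 =i v1, b =i b' & u2 =i v2].
Proof.
move=> Guv su sv bk; have [H1 H2 H3] := blocks_content_sub Guv su sv bk.
have [K1 K2 K3] := blocks_content_sub (satisfies_sym Guv) sv su (blocks_sym bk).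
by split=> x; apply/idP/idP; auto.
Qed.

(** Two simple letters in opposite orders would make [G] commutative, and commutativity implies
    tau1, hence sig1. *)
Lemma simple_order u v : satisfies G (u, v) ->
  (forall c, s c -> count_mem c u = 1%N) ->
  (forall c, s c -> count_mem c v = 1%N) -> filter s u = filter s v.
Proof.
move=> Guv su sv.
have memE c (w : seq nat) : (forall c, s c -> count_mem c w = 1%N) -> s c -> c \in w.
  by move=> sw sc; rewrite -has_pred1 has_count sw.
have uniqf (w : seq nat) : (forall c, s c -> count_mem c w = 1%N) -> uniq (filter s w).
  move=> sw; apply: count_mem_uniq => x; rewrite mem_filter.
  case: (boolP (s x)) => sx /=; last by apply/count_memPn; rewrite mem_filter (negPf sx).
  rewrite memE // count_filter -[RHS](sw x sx); apply: eq_count => y /=.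
  by case: eqP => // ->; rewrite sx.
have pE : perm_eq (filter s u) (filter s v).
  apply: uniq_perm; try exact: uniqf.
  by move=> x; rewrite !mem_filter; case: (boolP (s x)) => //= sx; rewrite !memE.
apply: (bubble (R := eq)) => //; [by move=> ? ? ? -> ->|exact: uniqf|].
move=> p a c q pu _ buac bvca; case: nsig; apply: tau1_sig1 => e t ee.
have bef (w : seq nat) x y : before (filter s w) x y -> x \in w -> y \in w ->
    s x -> s y -> count_mem x w = 1%N -> exists w1 w2, w = w1 ++ x :: w2 /\ y \in w2.
  move=> bxy xw yw sx sy cx; have [w1 [w2 [wE xw1]]] := split_mem xw.
  exists w1, w2; split=> //; have xy := before_neq bxy.
  move: yw; rewrite wE mem_cat inE eq_sym (negPf xy) => /orP[yw1|//].
  have := before_asym bxy; rewrite wE filter_cat /= sx before_split //.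
    by rewrite mem_filter (negPf xw1) andbF.
  by rewrite mem_filter sy.
have [ain cin] : a \in filter s u /\ c \in filter s u.
  by rewrite -!(perm_mem pu) !mem_cat !inE !eqxx !orbT.
move: ain cin; rewrite !mem_filter => /andP[sa au] /andP[sc cu].
have [w1 [w2 [uE cw2]]] := bef _ _ _ buac au cu sa sc (su _ sa).
have [w3 [w4 [vE aw4]]] := bef _ _ _ bvca (memE _ _ sv sc) (memE _ _ sv sa) sc sa (sv _ sc).
have ac : a != c by exact: before_neq buac.
have cm : p_comm G.
  move: Guv (su a sa) (su c sc) (sv a sa) (sv c sc); rewrite uE vE => Guv' *.
  exact: (derive_comm ac Guv').
by rewrite (cm e t) -mulgA ee.
Qed.

End BlockContent.

(** * Rewriting words with idempotent values *)

Section Rules.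
Variable M : monoidType.
Hypothesis Mb : base M.
Variable h : nat -> M.
Implicit Types (p q r w : seq nat) (x y c : nat).

(** The third identity of [base], which needs an order between an x and a y of [p]; the claim is
    symmetric, so either order will do. *)
Lemma comm_rule p q x y : x \in p -> y \in p ->
  eval h (p ++ x :: y :: q) = eval h (p ++ y :: x :: q).
Proof.
have [_ _ bC _] := Mb.
wlog [p1 [p2 [-> yp2]]] : x y / exists p1 p2, p = p1 ++ x :: p2 /\ y \in p2.
  move=> wl xp yp; case: (eqVneq x y) => [-> //|xy].
  have [p1 [p2 [pE xp1]]] := split_mem xp; have [yp2|yp2] := boolP (y \in p2).
    by apply: wl => //; exists p1, p2.
  have yp1 : y \in p1.
    by move: yp; rewrite pE mem_cat inE eq_sym (negPf xy) (negPf yp2) /= orbF.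
  have [p3 [p4 [p1E yp3]]] := split_mem yp1.
  symmetry; apply: wl => //; exists p3, (p4 ++ x :: p2); split.
    by rewrite pE p1E -catA cat_cons.
  by rewrite mem_cat mem_head orbT.
move=> _ _; have [p3 [p4 [-> _]]] := split_mem yp2.
rewrite !(eval_cat, eval_cons) !mulgA; congr (_ * _).
by have := congr1 (fun z => eval h p1 * z) (bC (h y) (h x) (eval h p4) (eval h p3));
  rewrite /= !mulgA.
Qed.

Lemma comm_word p w1 w2 q : {subset w1 <= p} -> {subset w2 <= p} ->
  eval h (p ++ w1 ++ w2 ++ q) = eval h (p ++ w2 ++ w1 ++ q).
Proof.
elim: w1 p => [//|x w1 IH] p s1 s2.
have xp : x \in p by apply: s1; rewrite mem_head.
have s1' : {subset w1 <= p} by move=> z zw; apply: s1; rewrite inE zw orbT.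
have -> : p ++ (x :: w1) ++ w2 ++ q = rcons p x ++ w1 ++ w2 ++ q by rewrite cat_rcons.
rewrite IH; last 2 first.
- by move=> z /s1'; rewrite mem_rcons inE => ->; rewrite orbT.
- by move=> z /s2; rewrite mem_rcons inE => ->; rewrite orbT.
rewrite cat_rcons; elim: w2 p {s1 s1'} xp s2 {IH} => [//|y w2 IH] p xp s2.
have yp : y \in p by apply: s2; rewrite mem_head.
rewrite cat_cons comm_rule // -(cat_rcons y p) IH //.
- by rewrite cat_rcons.
- by rewrite mem_rcons inE xp orbT.
by move=> z zw; rewrite mem_rcons inE (s2 z) ?orbT // inE zw orbT.
Qed.

(** The first two identities of [base] square an occurrence that has another one to its right or to
    its left. In the induction the prefix [p] is squared already. *)
Lemma eval_square (s : pred nat) (u : seq nat) :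
  (forall c, c \in u -> ~~ s c -> (1 < count_mem c u)%N) ->
  eval h u = eval (fun c => if s c then h c else h c * h c) u.
Proof.
move=> mu; pose h' c := if s c then h c else h c * h c.
change (eval h u = eval h' u).
suff main w : forall p, (forall c, c \in w -> ~~ s c -> (c \in p) || (1 < count_mem c
  w)%N) ->
    eval h' p * eval h w = eval h' p * eval h' w.
  by have := main u [::]; rewrite eval_nil !mul1g; apply => c cu sc; rewrite mu.
have [b1 b2 _ _] := Mb.
elim: w => [|c w IH] p cw; first by rewrite !eval_nil.
rewrite !eval_cons.
have -> : eval h' p * (h c * eval h w) = eval h' p * (h' c * eval h w).
  have [sc|sc] := boolP (s c); first by rewrite {3}/h' sc.
  have h'c : h' c = h c * h c by rewrite /h' (negPf sc).
  rewrite h'c; have [cp|cp] := boolP (c \in p).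
    have [p1 [p2 [-> _]]] := split_mem cp.
    rewrite eval_cat eval_cons h'c.
    have := congr1 (fun z => eval h' p1 * h c * z * eval h w) (b2 (h c) (eval h' p2)).
    by rewrite /= !mulgA.
  have cw' : c \in w.
    have := cw c (mem_head _ _) sc; rewrite (negPf cp) /= eqxx.
    by rewrite add1n ltnS -has_count has_pred1.
  congr (_ * _); have [w1 [w2 [-> _]]] := split_mem cw'.
  by rewrite eval_cat eval_cons !mulgA b1.
have := IH (p ++ [:: c]); rewrite !eval_cat eval_cons eval_nil mulg1 !mulgA.
apply=> d dw sd.
have := cw d _ sd; rewrite inE dw orbT => /(_ isT); rewrite mem_cat inE /=.
by rewrite eq_sym; case: (d == c); rewrite ?orbT ?add0n ?orbF.
Qed.

Lemma sig1_del p q c : p_sig1 M -> idem (h c) -> c \in p -> c \in q ->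
  eval h (p ++ c :: q) = eval h (p ++ q).
Proof.
move=> s1 cc /split_mem[p1 [p2 [-> _]]] /split_mem[q1 [q2 [-> _]]].
rewrite !(eval_cat, eval_cons) !mulgA; congr (_ * _).
by have := congr1 (fun z => eval h p1 * z) (s1 _ (eval h p2) (eval h q1) cc); rewrite
  !mulgA.
Qed.

Lemma sig1_sig2 : p_sig1 M -> p_sig2 M.
Proof. by move=> s1 e f t ee ff; rewrite s1. Qed.

(** The letters between the two c's are treated one at a time in [key]: sig2 inserts a c after each
    of them or removes it, as long as they are idempotent. *)
Lemma sig2_del p0 p1 r c : p_sig2 M -> c \in p1 -> {in p1, forall d, idem (h d)} ->
  c \in r -> eval h (p0 ++ p1 ++ c :: r) = eval h (p0 ++ p1 ++ r).
Proof.
move=> s2 cp1 ip1 /split_mem[r1 [r2 [-> _]]].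
have cc := ip1 _ cp1.
have [a [q [p1E _]]] := split_mem cp1.
have key w t : {in w, forall d, idem (h d)} ->
    h c * eval h w * h c * t * h c = h c * eval h w * t * h c.
  elim: w => [|d w IH] iw; first by rewrite eval_nil mulg1 cc.
  have dd : idem (h d) by apply: iw; rewrite mem_head.
  have {}IH : h c * eval h w * h c * t * h c = h c * eval h w * t * h c.
    by apply: IH => z zw; apply: iw; rewrite inE zw orbT.
  transitivity (h c * h d * (eval h w * h c * t) * h c); first by rewrite eval_cons !mulgA.
  rewrite s2 //; transitivity (h c * h d * (h c * eval h w * h c * t * h c)).
    by rewrite !mulgA.
  rewrite IH; transitivity (h c * h d * h c * (eval h w * t) * h c); first by rewrite
    !mulgA.
  by rewrite -s2 // eval_cons !mulgA.
have iq : {in q, forall d, idem (h d)}.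
  by move=> z zq; apply: ip1; rewrite p1E mem_cat inE zq !orbT.
have := congr1 (fun z => eval h p0 * eval h a * z * eval h r2) (key q (eval h r1) iq).
by rewrite p1E !(eval_cat, eval_cons) /= !mulgA.
Qed.

Lemma lrb_del p0 p1 r c : (forall e f : M, idem e -> idem f -> e * f * e = e * f) ->
  c \in p1 -> {in p1, forall d, idem (h d)} ->
  eval h (p0 ++ p1 ++ c :: r) = eval h (p0 ++ p1 ++ r).
Proof.
move=> lrb cp1 ip1; have cc := ip1 _ cp1.
have [a [q [p1E _]]] := split_mem cp1.
have key w : {in w, forall d, idem (h d)} -> h c * eval h w * h c = h c * eval h w.
  elim: w => [|d w IH] iw; first by rewrite eval_nil mulg1 cc.
  have dd : idem (h d) by apply: iw; rewrite mem_head.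
  have {}IH : h c * eval h w * h c = h c * eval h w.
    by apply: IH => z zw; apply: iw; rewrite inE zw orbT.
  rewrite eval_cons !mulgA -(lrb (h c) (h d)) //; transitivity (h c * h d * (h c * eval h
    w * h c)).
    by rewrite !mulgA.
  by rewrite IH !mulgA.
have iq : {in q, forall d, idem (h d)}.
  by move=> z zq; apply: ip1; rewrite p1E mem_cat inE zq !orbT.
have := congr1 (fun z => eval h p0 * eval h a * z * eval h r) (key q iq).
by rewrite p1E !(eval_cat, eval_cons) /= !mulgA.
Qed.

(** As x and y recur in [q], sig2 turns x y into x y x and y x into y x y, which gam equates. *)
Lemma gam_swap p q x y : p_sig2 M -> p_gam M -> idem (h x) -> idem (h y) ->
  x \in q -> y \in q -> eval h (p ++ x :: y :: q) = eval h (p ++ y :: x :: q).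
Proof.
move=> s2 gm xx yy xq yq.
have ins z z' : idem (h z) -> idem (h z') -> z \in q ->
    h z * (h z' * eval h q) = h z * h z' * h z * eval h q.
  move=> zz zz' /split_mem[q1 [q2 [-> _]]].
  by rewrite eval_cat eval_cons !mulgA s2.
by rewrite !eval_cat !eval_cons; congr (_ * _); rewrite !ins // gm.
Qed.

(** From x y, sig2 produces x y x because x recurs in [q]; then eta, with the x in [p], deletes the
    first of these two x's. *)
Lemma eta_swap p q x y : p_sig2 M -> p_eta M -> idem (h x) -> idem (h y) ->
  x \in p -> x \in q -> eval h (p ++ x :: y :: q) = eval h (p ++ y :: x :: q).
Proof.
move=> s2 et xx yy /split_mem[p1 [p2 [-> _]]] /split_mem[q1 [q2 [-> _]]].
have E1 := congr1 (fun z => eval h p1 * h x * eval h p2 * z * eval h q2)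
  (s2 _ _ (eval h q1) xx yy).
have E2 := congr1 (fun z => eval h p1 * z * eval h q1 * h x * eval h q2)
  (et _ _ (eval h p2) xx yy).
by rewrite /= !mulgA in E1 E2; rewrite !(eval_cat, eval_cons) !mulgA E1 E2.
Qed.

Lemma del_swap p q x y : p_del M -> idem (h x) -> idem (h y) ->
  eval h (p ++ x :: y :: x :: q) = eval h (p ++ y :: x :: q) ->
  eval h (p ++ x :: y :: q) = eval h (p ++ y :: x :: q).
Proof.
move=> dl xx yy <-; rewrite !(eval_cat, eval_cons); congr (_ * _).
by rewrite mulgA (dl _ _ xx yy) !mulgA.
Qed.

(** Reduction of the factor [w] to its tokens. [p1] is the part already reduced and [seen] its
    content; letters in [o] occur at most once and are kept; the deletion hypothesis removes a
    non-first occurrence that is followed by another one or whose letter is in [k]. An occurrence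
    that is both first and last and owns two tokens is doubled, its value being idempotent. *)
Lemma eval_toks (o k : pred nat) p0 Q w p1 seen :
  (forall c, o c -> k c) -> (forall c, o c -> (count_mem c (p1 ++ w) <= 1)%N) ->
  (forall c, c \in w -> ~~ k c -> idem (h c)) ->
  (forall p1' c r, {subset p1' <= p1 ++ w} -> c \in w -> ~~ o c -> c \in p1' ->
     (c \in r) || k c ->
     eval h (p0 ++ p1' ++ c :: r ++ Q) = eval h (p0 ++ p1' ++ r ++ Q)) ->
  p1 =i seen ->
  eval h (p0 ++ p1 ++ w ++ Q) =
  eval h (p0 ++ p1 ++ map fst (toks k seen w) ++ Q).
Proof.
move=> ok; elim: w p1 seen => [//|c w IH] p1 seen once idk del eqs.
have del' p1' d r : {subset p1' <= p1 ++ c :: w} -> d \in w -> ~~ o d -> d \in p1' ->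
    (d \in r) || k d ->
    eval h (p0 ++ p1' ++ d :: r ++ Q) = eval h (p0 ++ p1' ++ r ++ Q).
  by move=> sub dw; apply: del => //; rewrite inE dw orbT.
have idk' d : d \in w -> ~~ k d -> idem (h d).
  by move=> dw; apply: idk; rewrite inE dw orbT.
have [oc|oc] := boolP (o c).
  have cnt := once c oc; move: cnt; rewrite count_cat /= eqxx addnCA add1n ltnS leqn0.
  rewrite addn_eq0 => /andP[/eqP/count_memPn cp1 /eqP/count_memPn cw].
  rewrite /= -eqs (negPf cp1) (ok _ oc) orbT /=.
  have -> : p0 ++ p1 ++ c :: w ++ Q = p0 ++ rcons p1 c ++ w ++ Q by rewrite cat_rcons.
  rewrite (IH (rcons p1 c) (c :: seen)) ?cat_rcons //.
  by move=> z; rewrite mem_rcons !inE eqs.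
have [cs|cs] := boolP (c \in seen).
  have [cl|cl] := boolP ((c \in w) || k c).
    rewrite /= cs cl /= del ?mem_head //; last 2 first.
    - by move=> z zp; rewrite mem_cat zp.
    - by rewrite eqs.
    rewrite (IH p1 (c :: seen)) //.
    - move=> d od; apply: leq_trans (once d od).
      by rewrite !count_cat /= leq_add2l leq_addl.
    - move=> p1' d r sub; apply: del' => z /sub.
      by rewrite !mem_cat inE => /orP[->|->]; rewrite ?orbT.
    - by move=> z; rewrite inE eqs; case: eqP => // ->.
  rewrite /= cs (negPf cl) /=.
  have -> : p0 ++ p1 ++ c :: w ++ Q = p0 ++ rcons p1 c ++ w ++ Q by rewrite cat_rcons.
  rewrite (IH (rcons p1 c) (c :: seen)) ?cat_rcons //.
  by move=> z; rewrite mem_rcons !inE eqs.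
rewrite /= (negPf cs) /=.
have [cl|cl] := boolP ((c \in w) || k c) => /=.
  have -> : p0 ++ p1 ++ c :: w ++ Q = p0 ++ rcons p1 c ++ w ++ Q by rewrite cat_rcons.
  rewrite (IH (rcons p1 c) (c :: seen)) ?cat_rcons //.
  by move=> z; rewrite mem_rcons !inE eqs.
have cc : idem (h c) by apply: idk; rewrite ?mem_head //; move: cl; rewrite negb_or =>
  /andP[].
transitivity (eval h (p0 ++ (p1 ++ [:: c; c]) ++ w ++ Q)).
  rewrite !eval_cat !eval_cons eval_nil mulg1 -!mulgA; congr (_ * (_ * _)).
  by rewrite !mulgA cc eval_cat mulgA.
rewrite (IH (p1 ++ [:: c; c]) (c :: seen)) -?catA //.
- move=> d od; have dc : d != c by apply: contraNneq oc => <-.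
  by move: (once d od); rewrite !count_cat /= eq_sym (negPf dc).
- move=> p1' d r sub; apply: del' => z /sub.
  by rewrite !(mem_cat, inE); case: (z \in p1); case: (z == c); case: (z \in w).
- by move=> z; rewrite !(mem_cat, inE) eqs; case: (z == c); rewrite ?orbT ?orbF.
Qed.

End Rules.

(** * Tokens exchanged in the sorting argument *)

Section TokenSwaps.
Variables (k : pred nat) (w w' : seq nat).
Hypothesis ww' : w =i w'.
Local Notation A := (toks k [::] w).
Local Notation A' := (toks k [::] w').

Lemma toks_perm : perm_eq A A'.
Proof.
apply: uniq_perm; try exact: toks_uniq.
by case=> x []; rewrite ?mem_toksT ?mem_toksF ww'.
Qed.

Lemma toks_neq x i y j : (x, i) \in A -> (y, j) \in A ->
  before A (x, i) (y, j) -> before A' (y, j) (x, i) -> x != y.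
Proof.
move=> xA yA bA bA'; apply/eqP => xy; rewrite xy in xA bA bA'.
have self v : v =i w -> (y, false) \in A -> before (toks k [::] v) (y, true) (y, false).
  by move=> vw; rewrite mem_toksF => /andP[yw yk]; apply: beforeTF_self; rewrite ?vw.
have w'w : w' =i w by move=> z; rewrite ww'.
have := before_neq bA; case: i j {xy} xA yA bA bA' => [] [] xA yA bA bA'; rewrite ?eqxx
  // => _.
  by have := before_asym (self _ w'w yA); rewrite bA'.
by have := before_asym (self _ (fun=> erefl) xA); rewrite bA.
Qed.

(** Both words have the first token of x before its last one, so this order survives in every
    intermediate list; it tells where the other token of an exchanged letter lies. *)
Lemma toks_self L x :
  (forall c d, before A c d -> before A' c d -> before L c d) ->
  x \in w -> ~~ k x -> before L (x, true) (x, false).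
Proof. by move=> cs xw kx; apply: cs; apply: beforeTF_self; rewrite -?ww'. Qed.

Variables (p q : seq (nat * bool)) (a b : nat * bool).
Hypothesis pL : perm_eq (p ++ a :: b :: q) A.
Hypothesis cL : forall c d, before A c d -> before A' c d ->
  before (p ++ a :: b :: q) c d.

Lemma swap_mem : [/\ a \in A, b \in A, a \notin p & b \notin p].
Proof.
have : uniq (p ++ a :: b :: q) by rewrite (perm_uniq pL) toks_uniq.
rewrite cat_uniq /= !negb_or => /and3P[_ /and3P[ap bp _] _].
by split=> //; rewrite -(perm_mem pL) mem_cat !inE eqxx ?orbT.
Qed.

Lemma swap_prevl x : a = (x, false) -> x \in map fst p.
Proof.
move=> aE; have [aA _ ap _] := swap_mem; rewrite aE in aA ap.
move: aA; rewrite mem_toksF => /andP[xw kx].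
have := toks_self cL xw kx; rewrite aE => /before_mem -/(_ ap) xp.
by apply/mapP; exists (x, true).
Qed.

Lemma swap_prevr y : b = (y, false) -> y != a.1 -> y \in map fst p.
Proof.
move=> bE ya; have [_ bA _ bp] := swap_mem; rewrite bE in bA bp.
move: bA; rewrite mem_toksF => /andP[yw ky].
have ne z : (y, z) != a by apply: contra ya => /eqP <-.
have E : p ++ a :: b :: q = (p ++ [:: a]) ++ b :: q by rewrite -catA.
have bn : b \notin p ++ [:: a] by rewrite mem_cat inE negb_or bE bp ne.
have := toks_self cL yw ky; rewrite -bE E => /before_mem -/(_ bn).
rewrite mem_cat inE (negPf (ne _)) orbF => yp.
by apply/mapP; exists (y, true).
Qed.

Lemma swap_nextl x : a = (x, true) -> x != b.1 -> ~~ k x -> x \in map fst q.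
Proof.
move=> aE xb kx; have [aA _ ap _] := swap_mem.
have xw : x \in w by move: aA; rewrite aE mem_toksT => /andP[].
have xF : (x, false) \in p ++ a :: b :: q.
  by rewrite (perm_mem pL) mem_toksF xw kx.
have := toks_self cL xw kx; rewrite -aE => /before_memr -/(_ ap xF).
rewrite inE => /orP[/eqP E|xq]; first by rewrite -E eqxx in xb.
by apply/mapP; exists (x, false).
Qed.

Lemma swap_nextr y : b = (y, true) -> y != a.1 -> ~~ k y -> y \in map fst q.
Proof.
move=> bE ya ky; have [_ bA _ bp] := swap_mem.
have yw : y \in w by move: bA; rewrite bE mem_toksT => /andP[].
have yF : (y, false) \in p ++ a :: b :: q.
  by rewrite (perm_mem pL) mem_toksF yw ky.
have ne z : (y, z) != a by apply: contra ya => /eqP <-.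
have E : p ++ a :: b :: q = (p ++ [:: a]) ++ b :: q by rewrite -catA.
have bn : b \notin p ++ [:: a] by rewrite mem_cat inE negb_or bp bE ne.
have := toks_self cL yw ky; rewrite -bE E => /before_memr -/(_ bn); rewrite -E => /(_ yF)
  yq.
by apply/mapP; exists (y, false).
Qed.

End TokenSwaps.

(** * Transfer of an identity from [W] to [M] under sig1 *)

Section Transfer.
Variables (W : mclass) (M : monoidType) (u v : seq nat) (s : pred nat).
Hypotheses (Wb : forall G, W G -> base G) (Mb : base M).
Hypothesis Wuv : forall G, W G -> satisfies G (u, v).
Hypotheses (su : forall c, s c -> count_mem c u = 1%N)
  (sv : forall c, s c -> count_mem c v = 1%N).
Variable h : nat -> M.
Hypothesis hs : forall c, ~~ s c -> idem (h c).

Let Wvu G : W G -> satisfies G (v, u).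
Proof. by move=> WG; apply/satisfies_sym/Wuv. Qed.

Lemma sig1_case : u =i v -> p_sig1 M ->
  ((forall G, W G -> p_gam G) -> p_gam M) ->
  ((forall G, W G -> p_del G) -> p_del M) ->
  ((forall G, W G -> p_tau1 G) -> p_tau1 M) ->
  ((forall G, W G -> p_tau2 G) -> p_tau2 M) ->
  ((forall G, W G -> p_comm G) -> p_comm M) ->
  eval h u = eval h v.
Proof.
move=> uv s1 tgam tdel ttau1 ttau2 tcomm.
have red w : (forall c, s c -> count_mem c w = 1%N) ->
    eval h w = eval h (map fst (toks s [::] w)).
  move=> sw; have := @eval_toks _ h s s [::] [::] w [::] [::]; rewrite /= !cats0; apply=>
    //.
  - by move=> c sc; rewrite sw.
  - by move=> c _; apply: hs.
  - move=> p1' c r _ _ sc cp; rewrite (negPf sc) orbF !cats0 => cr.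
    exact: sig1_del (hs sc) _ _.
rewrite (red u) // (red v) //.
apply: (bubble (R := fun A B => eval h (map fst A) = eval h (map fst B))) => //.
- by move=> ? ? ? -> ->.
- exact: toks_uniq.
- exact: toks_perm.
move=> p a b q pL cL bu bv; rewrite !map_cat /=.
have [aA bA ap bp] := swap_mem pL.
have xy : a.1 != b.1 by case: a b aA bA bu bv {ap bp pL cL} => [x i] [y j]; exact: toks_neq.
have yx : b.1 != a.1 by rewrite eq_sym.
have vu : v =i u by move=> z; rewrite uv.
case: a b xy yx aA bA bu bv {ap bp} pL cL => [x i] [y j] /= xy yx aA bA bu bv pL cL.
have xu : x \in u by case: (i) aA; rewrite ?mem_toksT ?mem_toksF => /andP[].
have yu : y \in u by case: (j) bA; rewrite ?mem_toksT ?mem_toksF => /andP[].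
have xv : x \in v by rewrite -uv.
have yv : y \in v by rewrite -uv.
have tau1_swap z t (P Q : seq nat) : p_tau1 M -> ~~ s z -> z \in Q ->
    eval h (P ++ z :: t :: Q) = eval h (P ++ t :: z :: Q).
  move=> tau sz zQ; rewrite !eval_cat !eval_cons; congr (_ * _).
  have [Q1 [Q2 [-> _]]] := split_mem zQ; rewrite eval_cat eval_cons !mulgA.
  by rewrite -(s1 (h z) (h t) _ (hs sz)) (tau (h z) (h t) (hs sz)).
have tau2_swap z t (P Q : seq nat) : p_tau2 M -> ~~ s z -> z \in P ->
    eval h (P ++ z :: t :: Q) = eval h (P ++ t :: z :: Q).
  move=> tau sz zP; rewrite -[RHS](@sig1_del _ h P (t :: z :: Q) z) //.
  - by rewrite !eval_cat !eval_cons; congr (_ * _); rewrite !mulgA (tau (h z) (h t) (hs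
    sz)).
  - exact: hs.
  - by rewrite !inE eqxx orbT.
have del_sw z z' (P Q : seq nat) : p_del M -> ~~ s z -> ~~ s z' -> z \in P ->
    eval h (P ++ z :: z' :: Q) = eval h (P ++ z' :: z :: Q).
  move=> dl sz sz' zP; apply: del_swap => //; try exact: hs.
  by apply: sig1_del => //; [exact: hs|rewrite !inE eqxx orbT].
have get_tau1 z t w w' : (forall G, W G -> satisfies G (w, w')) ->
    (forall c, s c -> count_mem c w = 1%N) -> (forall c, s c -> count_mem c w' = 1%N) ->
    z \in w -> t \in w -> t \in w' -> s t -> z != t ->
    before (toks s [::] w) (z, true) (t, true) ->
    before (toks s [::] w') (t, true) (z, true) -> forall G, W G -> p_tau1 G.
  move=> Www sw sw' zw tw tw' st zt b1 b2 G WG.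
  have [w1 [w2 [wE _ tw1]]] := beforeTT zw b1.
  have [w3 [w4 [w'E _ zw3]]] := beforeTT tw' b2.
  have tw2 : t \in w2.
    by move: tw; rewrite wE mem_cat inE (negPf tw1) eq_sym (negPf zt).
  have [w5 [w6 [w2E _]]] := split_mem tw2.
  have := Www G WG; have := sw t st; have := sw' t st.
  rewrite wE w'E w2E -cat_cons catA => /once_notin[? ?] /once_notin[? ?] GG.
  apply: (derive_tau1 (Wb WG) zt GG) => //.
  by rewrite mem_cat mem_head orbT.
have get_tau2 z t w w' : (forall G, W G -> satisfies G (w, w')) ->
    (forall c, s c -> count_mem c w = 1%N) -> (forall c, s c -> count_mem c w' = 1%N) ->
    (z, false) \in toks s [::] w' -> t \in w -> t \in w' -> s t -> z != t ->
    before (toks s [::] w) (z, false) (t, true) ->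
    before (toks s [::] w') (t, true) (z, false) -> forall G, W G -> p_tau2 G.
  move=> Www sw sw' zw' tw tw' st zt b1 b2 G WG.
  have [w1 [w2 [wE _ zw2]]] := beforeFT tw b1.
  have [w3 [w4 [w'E _ zw4]]] := beforeTF tw' zw' zt b2.
  have := satisfies_sym (Www G WG); have := sw t st; have := sw' t st.
  rewrite wE w'E => /once_notin[? ?] /once_notin[? ?] GG.
  exact: (derive_tau2 (Wb WG) zt GG).
have get_del z t w w' : (forall G, W G -> satisfies G (w, w')) ->
    (z, false) \in toks s [::] w' -> z \in w -> t \in w -> t \in w' -> z != t ->
    before (toks s [::] w) (z, false) (t, true) ->
    before (toks s [::] w') (t, true) (z, false) -> forall G, W G -> p_del G.
  move=> Www zw' zw tw tw' zt b1 b2 G WG.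
  have [w1 [w2 [wE tw1 zw2]]] := beforeFT tw b1.
  have [w3 [w4 [w'E tw3 zw4]]] := beforeTF tw' zw' zt b2.
  have zw1 : z \in w1 by move: zw; rewrite wE mem_cat inE (negPf zt) (negPf zw2) /= orbF.
  have := Www G WG; rewrite wE w'E => GG.
  exact: (derive_del (Wb WG) zt GG).
have FA z : (z, false) \in toks s [::] u -> ~~ s z /\ (z, false) \in toks s [::] v.
  by rewrite !mem_toksF uv => /andP[-> ->].
case: i j aA bA bu bv pL cL => [] [] aA bA bu bv pL cL.
- have [sx|sx] := boolP (s x); have [sy|sy] := boolP (s y).
  + have [w1 [w2 [uE _ yw1]]] := beforeTT xu bu.
    have [w3 [w4 [vE _ xw3]]] := beforeTT yv bv.
    have yw2 : y \in w2 by move: yu; rewrite uE mem_cat inE (negPf yw1) (negPf yx).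
    have xw4 : x \in w4 by move: xv; rewrite vE mem_cat inE (negPf xw3) (negPf xy).
    have cm : p_comm M.
      apply: tcomm => G WG; have := Wuv WG; move: (su sx) (su sy) (sv sx) (sv sy).
      by rewrite uE vE => c1 c2 c3 c4 GG; apply: (derive_comm xy GG).
    by rewrite !eval_cat !eval_cons !mulgA -(mulgA _ (h x)) (cm (h x)) !mulgA.
  + symmetry; apply: tau1_swap => //; last exact: (swap_nextr uv pL cL erefl yx sy).
    by apply: ttau1; exact: (get_tau1 y x v u (@Wvu)).
  + apply: tau1_swap => //; last exact: (swap_nextl uv pL cL erefl xy sx).
    by apply: ttau1; exact: (get_tau1 x y u v).
  + apply: gam_swap; rewrite ?(swap_nextl uv pL cL erefl xy sx) ?(swap_nextr uv pL cL
    erefl yx sy) //;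
      try exact: hs.
      exact: sig1_sig2.
    apply: tgam => G WG; have [w1 [w2 [uE xw1 yw1]]] := beforeTT xu bu.
    have [w3 [w4 [vE yw3 xw3]]] := beforeTT yv bv.
    by have := Wuv WG; rewrite uE vE => GG; apply: (derive_gam (Wb WG) xy GG).
- have [sy yF] := FA y bA.
  have yp := swap_prevr uv pL cL erefl yx.
  symmetry; have [sx|sx] := boolP (s x).
    apply: tau2_swap => //; apply: ttau2.
    exact: (get_tau2 y x v u (@Wvu)).
  apply: del_sw => //; apply: tdel.
  exact: (get_del y x v u (@Wvu)).
- have [sx xF] := FA x aA.
  have xp := swap_prevl uv pL cL erefl.
  have [sy|sy] := boolP (s y).
    apply: tau2_swap => //; apply: ttau2.
    exact: (get_tau2 x y u v).
  apply: del_sw => //; apply: tdel.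
  exact: (get_del x y u v).
- apply: comm_rule => //; first exact: (swap_prevl uv pL cL erefl).
  exact: (swap_prevr uv pL cL erefl yx).
Qed.

End Transfer.

(** * Transfer block by block *)

Lemma derive_eta_block (G : monoidType) (s : pred nat) (u v u1 b u2 v1 b' v2 : seq nat)
  (x y : nat) : base G ->
  satisfies G (u, v) -> (forall c, s c -> count_mem c u = 1%N) ->
  (forall c, s c -> count_mem c v = 1%N) -> blocks s u v u1 b u2 v1 b' v2 ->
  x \in b -> x \in b' -> y \in b -> x != y -> x \in u1 -> x \in v1 ->
  y \notin u1 -> y \notin v1 ->
  (exists B1 B2, [/\ b = B1 ++ x :: B2, x \notin B1 & y \notin B1]) ->
  (exists B1 B2, [/\ b' = B1 ++ y :: B2, y \notin B1 & x \notin B1]) -> p_eta G.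
Proof.
move=> Gb Guv su sv [uE vE _ _ sb sb' l _] xb xb' yb xy xu1 xv1 yu1 yv1.
case=> B1 [B2 [bE xB1 yB1]] [B3 [B4 [b'E yB3 xB3]]].
case: l => [[u1E _]|[t [u1' [v1' [st u1E v1E]]]]]; first by rewrite u1E in xu1.
have nst z : z \in b -> z != t.
  by move=> zb; apply: contraTneq zb => ->; apply/negP => /(allP sb); rewrite /= st.
have [xt yt] := (nst _ xb, nst _ yb).
move: xu1 xv1 yu1 yv1; rewrite u1E v1E !mem_rcons !inE (negPf xt) (negPf yt) /=.
move=> xu1 xv1 yu1 yv1; move: Guv (su t st) (sv t st).
rewrite uE vE u1E v1E bE b'E !cat_rcons -!catA !cat_cons => Guv.
case/once_notin=> t1; rewrite mem_cat inE !negb_or => /and3P[t2 _ t3].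
case/once_notin=> t4; rewrite mem_cat inE !negb_or => /and3P[t5 _ t6].
apply: (derive_eta Gb xy xt yt Guv) => //.
  by rewrite mem_cat negb_or t1 mem_cat negb_or t2.
by rewrite mem_cat negb_or t4 mem_cat negb_or t5.
Qed.

Lemma derive_gam_block (G : monoidType) (s : pred nat) (u v u1 b u2 v1 b' v2 : seq nat)
  (x y : nat) : base G ->
  satisfies G (u, v) -> blocks s u v u1 b u2 v1 b' v2 -> x != y ->
  x \notin u1 -> x \notin v1 -> y \notin u1 -> y \notin v1 ->
  (exists B1 B2, [/\ b = B1 ++ x :: B2, x \notin B1 & y \notin B1]) ->
  (exists B1 B2, [/\ b' = B1 ++ y :: B2, y \notin B1 & x \notin B1]) -> p_gam G.
Proof.
move=> Gb Guv bk xy xu1 xv1 yu1 yv1 [B1 [B2 [bE xB1 yB1]]] [B3 [B4 [b'E yB3 xB3]]].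
move: Guv; rewrite (blocks_u bk) (blocks_v bk) bE b'E -!catA !catA => Guv.
move: Guv; rewrite -!catA !cat_cons !(catA u1) !(catA v1) => Guv.
by apply: (derive_gam Gb xy Guv); rewrite mem_cat negb_or; apply/andP; split.
Qed.

Section BlockTransfer.
Variables (W : mclass) (M : monoidType) (u v : seq nat) (s : pred nat).
Hypotheses (Wb : forall G, W G -> base G) (Mb : base M).
Hypothesis Wuv : forall G, W G -> satisfies G (u, v).
Hypotheses (su : forall c, s c -> count_mem c u = 1%N)
  (sv : forall c, s c -> count_mem c v = 1%N).
Variable h : nat -> M.
Hypothesis hs : forall c, ~~ s c -> idem (h c).
Variables u1 b u2 v1 b' v2 : seq nat.
Hypothesis bk : blocks s u v u1 b u2 v1 b' v2.
Hypotheses (c1 : u1 =i v1) (cb : b =i b') (c2 : u2 =i v2).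

Let Wvu G : W G -> satisfies G (v, u).
Proof. by move=> WG; apply/satisfies_sym/Wuv. Qed.

Let idb : {in b, forall c, idem (h c)}.
Proof. by move=> c /(allP (blocks_b bk)); apply: hs. Qed.

Let idb' : {in b', forall c, idem (h c)}.
Proof. by move=> c; rewrite -cb; apply: idb. Qed.

(** Letters that occur before the block are not new. Two such letters commute in [base]; two new
    ones call for gam, and one of each kind for eta. *)
Lemma block_TT k x y : x \in b -> y \in b -> x != y ->
  before (toks k [::] b) (x, true) (y, true) ->
  before (toks k [::] b') (y, true) (x, true) ->
  [\/ x \in v1 /\ y \in v1, [/\ x \notin v1, y \notin v1 & forall G, W G -> p_gam G],
      [/\ x \in v1, y \notin v1 & forall G, W G -> p_eta G] |
      [/\ x \notin v1, y \in v1 & forall G, W G -> p_eta G]].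
Proof.
move=> xb yb xy bx by'; have dx := beforeTT xb bx.
have yb' : y \in b' by rewrite -cb.
have xb' : x \in b' by rewrite -cb.
have dy := beforeTT yb' by'.
have yx : y != x by rewrite eq_sym.
have [xv|xv] := boolP (x \in v1); have [yv|yv] := boolP (y \in v1).
- exact: Or41.
- apply: Or43; split=> // G WG.
  by apply: (derive_eta_block (Wb WG) (Wuv WG) su sv bk xb xb' yb xy); rewrite ?c1.
- apply: Or44; split=> // G WG.
  by apply: (derive_eta_block (Wb WG) (Wvu WG) sv su (blocks_sym bk) yb' yb xb' yx);
    rewrite ?c1.
- apply: Or42; split=> // G WG.
  by apply: (derive_gam_block (Wb WG) (Wuv WG) bk xy); rewrite ?c1.
Qed.

(** Meant for the generator of R_2: with e f e = e f only first occurrences in the block survive,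
    and as [W] has neither gam nor eta, only letters occurring before the block are ever
    exchanged. *)
Lemma lrb_block : (forall e f : M, idem e -> idem f -> e * f * e = e * f) ->
  ~ (forall G, W G -> p_gam G) -> ~ (forall G, W G -> p_eta G) ->
  eval h (v1 ++ b ++ u2) = eval h (v1 ++ b' ++ u2).
Proof.
move=> lrb ngam neta.
have red w : {in w, forall c, idem (h c)} ->
    eval h (v1 ++ w ++ u2) = eval h (v1 ++ map fst (toks predT [::] w) ++ u2).
  move=> iw; have := @eval_toks _ h pred0 predT v1 u2 w [::] [::]; apply=> //=.
  by move=> p1' c r sub cw _ cp _; apply: lrb_del => // d /sub; apply: iw.
rewrite (red b) // (red b') //.
apply: (bubble (R := fun A B => eval h (v1 ++ map fst A ++ u2) = eval h (v1 ++ map fst B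
  ++ u2))) => //.
- by move=> ? ? ? -> ->.
- exact: toks_uniq.
- exact: toks_perm.
move=> p a b0 q pL cL bu bv; rewrite !map_cat /= -!catA !(catA v1).
have [aA bA ap bp] := swap_mem pL.
case: a b0 aA bA bu bv {ap bp} pL cL => [x i] [y j] /= aA bA bu bv pL cL.
have xy := toks_neq cb aA bA bu bv.
case: i aA bu bv pL cL => [] aA bu bv pL cL; last by move: aA; rewrite mem_toksF andbF.
case: j bA bu bv pL cL => [] bA bu bv pL cL; last by move: bA; rewrite mem_toksF andbF.
move: aA bA; rewrite !mem_toksT !andbT => xb yb.
case: (block_TT xb yb xy bu bv) => [[xv yv]|[_ _ /ngam]|[_ _ /neta]|[_ _ /neta]] //.
by apply: comm_rule => //; rewrite mem_cat ?xv ?yv.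
Qed.

(** In a block, sig2 deletes a non-first occurrence whenever its letter occurs later in the word, so
    last tokens are kept only for letters absent from [u2]. Exchanging a first and a last token
    takes del, unless the letter of the first token occurs before the block. *)
Lemma sig2_block : p_sig2 M ->
  ((forall G, W G -> p_gam G) -> p_gam M) ->
  ((forall G, W G -> p_eta G) -> p_eta M) ->
  ((forall G, W G -> p_del G) -> p_del M) ->
  eval h (v1 ++ b ++ u2) = eval h (v1 ++ b' ++ u2).
Proof.
move=> s2 tgam teta tdel; pose k := mem u2.
have red w : {in w, forall c, idem (h c)} ->
    eval h (v1 ++ w ++ u2) = eval h (v1 ++ map fst (toks k [::] w) ++ u2).
  move=> iw; have := @eval_toks _ h pred0 k v1 u2 w [::] [::]; apply=> //=.
    by move=> c cw _; apply: iw.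
  move=> p1' c r sub cw _ cp cr; apply: sig2_del => //.
    by move=> d /sub; apply: iw.
  by rewrite mem_cat.
rewrite (red b) // (red b') //.
apply: (bubble (R := fun A B => eval h (v1 ++ map fst A ++ u2) = eval h (v1 ++ map fst B
  ++ u2))) => //.
- by move=> ? ? ? -> ->.
- exact: toks_uniq.
- exact: toks_perm.
move=> p a b0 q pL cL bu bv; rewrite !map_cat /= -!catA.
have [aA bA ap bp] := swap_mem pL.
have sub : {subset map fst p <= b}.
  move=> z /mapP[[z' l] zp /= ->].
  have : (z', l) \in toks k [::] b by rewrite -(perm_mem pL) mem_cat zp.
  by case: l {zp}; rewrite ?mem_toksT ?mem_toksF => /andP[].
case: a b0 aA bA bu bv {ap bp} pL cL => [x i] [y j] /= aA bA bu bv pL cL.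
have xy := toks_neq cb aA bA bu bv.
have yx : y != x by rewrite eq_sym.
have xb : x \in b by case: (i) aA; rewrite ?mem_toksT ?mem_toksF => /andP[].
have yb : y \in b by case: (j) bA; rewrite ?mem_toksT ?mem_toksF => /andP[].
have [xx yy] := (idb xb, idb yb).
have del_sw z z' : p_del M -> idem (h z) -> idem (h z') -> z \in map fst p ->
    eval h (v1 ++ map fst p ++ z :: z' :: map fst q ++ u2) =
    eval h (v1 ++ map fst p ++ z' :: z :: map fst q ++ u2).
  move=> dl zz zz' zp; rewrite !catA; apply: del_swap => //; rewrite -!catA.
  apply: sig2_del => //; last by rewrite !inE eqxx orbT.
  by move=> d /sub; apply: idb.
have get_del z t w w' x1 x2 y1 y2 : (forall G, W G -> satisfies G (x1 ++ w ++ x2, y1 ++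
  w' ++ y2)) ->
    (z, false) \in toks k [::] w' -> z \in w -> t \in w -> t \in w' -> z != t ->
    t \notin x1 -> t \notin y1 -> z \notin x2 ->
    before (toks k [::] w) (z, false) (t, true) ->
    before (toks k [::] w') (t, true) (z, false) -> forall G, W G -> p_del G.
  move=> Www zw' zw tw tw' zt tx1 ty1 zx2 b1 b2 G WG.
  have [w1 [w2 [wE tw1 zw2]]] := beforeFT tw b1.
  have [w3 [w4 [w'E tw3 zw4]]] := beforeTF tw' zw' zt b2.
  have zw1 : z \in w1 by move: zw; rewrite wE mem_cat inE (negPf zt) (negPf zw2) /= orbF.
  have := Www G WG; rewrite wE w'E -!catA !cat_cons !(catA x1) !(catA y1) => GG.
  apply: (derive_del (Wb WG) zt GG).
  - by rewrite mem_cat negb_or tx1 tw1.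
  - by rewrite mem_cat zw1 orbT.
  - by rewrite mem_cat negb_or zw2 zx2.
  - by rewrite mem_cat negb_or ty1 tw3.
  - by rewrite mem_cat zw4.
have Wuv' G : W G -> satisfies G (u1 ++ b ++ u2, v1 ++ b' ++ v2).
  by move=> WG; rewrite -(blocks_u bk) -(blocks_v bk); apply: Wuv.
have Wvu' G : W G -> satisfies G (v1 ++ b' ++ v2, u1 ++ b ++ u2).
  by move=> WG; rewrite -(blocks_u bk) -(blocks_v bk); apply: Wvu.
have nextx : (i = true) -> x \in map fst q ++ u2.
  move=> iT; rewrite mem_cat orbC; have [//|ku] := boolP (x \in u2); move: iT => /= iT.
  by rewrite iT in pL cL; rewrite (swap_nextl cb pL cL erefl xy ku).
have nexty : (j = true) -> y \in map fst q ++ u2.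
  move=> jT; rewrite mem_cat orbC; have [//|ku] := boolP (y \in u2); move: jT => /= jT.
  by rewrite jT in pL cL; rewrite (swap_nextr cb pL cL erefl yx ku).
have prevx : (i = false) -> x \in map fst p.
  by move=> iT; rewrite iT in pL cL; exact: (swap_prevl cb pL cL erefl).
have prevy : (j = false) -> y \in map fst p.
  by move=> jT; rewrite jT in pL cL; exact: (swap_prevr cb pL cL erefl yx).
case: i j {pL cL} aA bA bu bv nextx nexty prevx prevy => [] [] aA bA bu bv nextx nexty
  prevx prevy.
- rewrite !(catA v1); case: (block_TT xb yb xy bu bv).
  + by case=> xv yv; apply: comm_rule => //; rewrite mem_cat ?xv ?yv.
  + by case=> _ _ /tgam gm; apply: gam_swap => //; [exact: nextx|exact: nexty].
  + by case=> xv _ /teta et; apply: eta_swap => //; [rewrite mem_cat xv|exact: nextx].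
  + by case=> _ yv /teta et; symmetry; apply: eta_swap => //; [rewrite mem_cat yv|exact:
    nexty].
- have [xv|xv] := boolP (x \in v1).
    by rewrite !(catA v1); apply: comm_rule => //; rewrite mem_cat ?xv ?prevy ?orbT.
  have ku : y \notin u2 by move: bA; rewrite mem_toksF => /andP[].
  symmetry; apply: del_sw => //; last exact: prevy.
  apply: tdel; apply: (get_del y x b' b v1 v2 u1 u2 Wvu') => //; rewrite -?cb -?c2 ?c1 //.
- have [yv|yv] := boolP (y \in v1).
    by rewrite !(catA v1); apply: comm_rule => //; rewrite mem_cat ?yv ?prevx ?orbT.
  have ku : x \notin u2 by move: aA; rewrite mem_toksF => /andP[].
  apply: del_sw => //; last exact: prevx.
  apply: tdel; apply: (get_del x y b b' u1 u2 v1 v2 Wuv') => //; rewrite -?cb ?c1 //.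
  by rewrite mem_toksF -cb xb; move: aA; rewrite mem_toksF => /andP[].
- by rewrite !(catA v1); apply: comm_rule => //; rewrite mem_cat ?prevx ?prevy ?orbT.
Qed.

End BlockTransfer.

(** * Saturated blocks *)

Lemma A_not_sig1 : ~ p_sig1 A_monoid.
Proof. by move/(_ A_b A_a A_c erefl). Qed.

Lemma A_mul0l (x : A_monoid) : A_0 * x = A_0. Proof. by case: x. Qed.
Lemma A_mul0r (x : A_monoid) : x * A_0 = A_0. Proof. by case: x. Qed.

Lemma split_last (x : nat) (w : seq nat) : x \in w ->
  exists w1 w2, w = w1 ++ x :: w2 /\ x \notin w2.
Proof.
rewrite -mem_rev => /split_mem[w1 [w2 [E xw1]]]; exists (rev w2), (rev w1).
by rewrite mem_rev -[w]revK E rev_cat rev_cons cat_rcons.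
Qed.

Lemma split_block (s : pred nat) (r : seq nat) : exists r1 r2,
  [/\ r = r1 ++ r2, all (predC s) r1 & r2 = [::] \/ exists t r3, s t /\ r2 = t :: r3].
Proof.
elim: r => [|c r [r1 [r2 [-> s1 s2]]]]; first by exists [::], [::]; split=> //; left.
have [sc|sc] := boolP (s c).
  by exists [::], (c :: r1 ++ r2); split=> //; right; exists c, (r1 ++ r2).
by exists (c :: r1), r2; split=> //=; rewrite sc.
Qed.

(* Let q be what follows a block b in which y occurs for the first time.  If
   [obst s q y x], then mapping y to a, x to b and the simple letter that starts
   q2 to c shows that A sees whether some x follows the first y in b. *)
Definition obst (s : pred nat) (q : seq nat) (y x : nat) : Prop :=
  exists q1 q2, [/\ q = q1 ++ q2, y \notin q2, x \notin q1 &
    q2 = [::] \/ exists t q3, s t /\ q2 = t :: q3].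

Definition after (w : seq nat) (y x : nat) : Prop :=
  exists w1 w2, [/\ w = w1 ++ y :: w2, y \notin w1 & x \in w2].

Lemma after_trans w x y z : after w x z ->
  (exists w1 w2, [/\ w = w1 ++ y :: w2, y \notin w1 & x \notin w1]) -> y != x ->
  after w y z.
Proof.
case=> w1 [w2 [wE xw1 zw2]] [w3 [w4 [wE' yw3 xw3]]] yx.
exists w3, w4; split=> //.
have : x \in w4.
  have : x \in w by rewrite wE mem_cat mem_head orbT.
  by rewrite wE' mem_cat inE (negPf xw3) eq_sym (negPf yx).
case/split_mem=> w5 [w6 [w4E xw5]].
suff E2 : w2 = w6 by rewrite w4E mem_cat inE -E2 zw2 !orbT.
have E : w1 ++ x :: w2 = (w3 ++ y :: w5) ++ x :: w6 by rewrite -wE wE' w4E -catA.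
have xn : x \notin w3 ++ y :: w5.
  by rewrite mem_cat inE !negb_or xw3 xw5 eq_sym yx.
have := congr1 (index x) E; rewrite !index_cat (negPf xw1) (negPf xn) /= eqxx !addn0 => sz.
by move/eqP: E; rewrite eqseq_cat // => /andP[_]; rewrite eqseq_cons => /andP[_ /eqP].
Qed.

Lemma first_after w x y : x \in w ->
  (exists w1 w2, [/\ w = w1 ++ y :: w2, y \notin w1 & x \notin w1]) -> x != y ->
  after w y x.
Proof.
move=> xw [w1 [w2 [wE yw1 xw1]]] xy; exists w1, w2; split=> //.
by move: xw; rewrite wE mem_cat inE (negPf xw1) (negPf xy).
Qed.

Section AfterA.
Variables (s : pred nat).

(** The stretches that witness an obstruction are bounded by simple letters, and u and v agree on
    the content of such stretches because A fails sig1. *)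
Lemma obst_transfer u v u1 b u2 v1 b' v2 x y :
  satisfies A_monoid (u, v) -> (forall c, s c -> count_mem c u = 1%N) ->
  (forall c, s c -> count_mem c v = 1%N) -> blocks s u v u1 b u2 v1 b' v2 ->
  ~~ s x -> ~~ s y -> obst s u2 y x -> obst s v2 y x.
Proof.
move=> Auv su sv bk sx sy [q1 [q2 [u2E yq2 xq1 cut]]].
have [c1 cb c2] := blocks_content A_base A_not_sig1 Auv su sv bk.
case: cut => [q2E|[t [q3 [st q2E]]]].
  exists v2, [::]; split=> //; [by rewrite cats0|rewrite -c2 u2E q2E cats0 //|by left].
have tv2 : t \in v2 by rewrite -c2 u2E q2E mem_cat mem_head orbT.
have [r1 [r3 [v2E tr1]]] := split_mem tv2.
exists r1, (t :: r3); split=> //; last by right; exists t, r3.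
- have yt : y != t by apply: contraNneq sy => ->.
  move: yq2; rewrite q2E !inE !negb_or yt /= => yq3; apply/negP => yr3.
  apply: A_not_sig1; apply: tau2_sig1.
  move: (satisfies_sym Auv) (su t st) (sv t st); rewrite (blocks_u bk) (blocks_v bk).
  rewrite u2E q2E v2E !catA => Avu /once_notin[t1 t2] /once_notin[t3 t4].
  exact: (derive_tau2 A_base yt Avu).
- have xt : x != t by apply: contraNneq sx => ->.
  case: (blocks_r bk) => [[u2E' _]|[t0 [u3 [v3 [st0 u2E' v2E']]]]].
    by move: u2E; rewrite u2E' q2E; case: (q1).
  have xt0 : x != t0 by apply: contraNneq sx => ->.
  case: q1 u2E xq1 => [|c q1] u2E xq1.
    have tt0 : t0 = t by move: u2E; rewrite u2E' q2E => -[].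
    by move: v2E tr1; rewrite v2E' tt0; case: r1 => //= c r1 [->]; rewrite inE eqxx.
  have cE : c = t0 by move: u2E; rewrite u2E' => -[].
  case: r1 v2E tr1 => [//|d r1] v2E tr1.
  have dE : d = t0 by move: v2E; rewrite v2E' => -[].
  have tt0 : t0 != t by move: tr1; rewrite dE inE negb_or eq_sym => /andP[].
  rewrite inE negb_or dE xt0 /=; apply/negP => xr1; apply: A_not_sig1.
  move: (satisfies_sym Auv) (su t st) (sv t st) (su t0 st0) (sv t0 st0).
  rewrite (blocks_u bk) (blocks_v bk) u2E q2E v2E cE dE.
  rewrite !cat_cons !(catA v1 b') !(catA u1 b) => Avu t1 t2.
  move=> /once_notin[t3 t4] /once_notin[t5 t6].
  move: t1 t2; rewrite -!(cat_cons t0) !catA => /once_notin[t7 t8] /once_notin[t9 t10].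
  move: t4 t6 t7 t9 xq1; rewrite !(mem_cat, inE) !negb_or.
  move=> /and3P[? ? ?] /and3P[? ? ?] /andP[/andP[? ?] /andP[? ?]] /andP[/andP[? ?]
    /andP[? ?]] /andP[? ?].
  move: t3 t5; rewrite !mem_cat !negb_or => /andP[? ?] /andP[? ?].
  apply: (derive_sig1 xt0 xt tt0 Avu) => //;
    by rewrite !mem_cat !negb_or; do ?[apply/andP; split].
Qed.

(** If x followed the first y in [b'] but not in [b], the evaluation described for [obst] would give
    v a factor a b = 0, whereas b times the value of u is b a times the value of [q2], which is not
    0. *)
Lemma after_sub u v u1 b u2 v1 b' v2 x y :
  satisfies A_monoid (u, v) -> (forall c, s c -> count_mem c u = 1%N) ->
  blocks s u v u1 b u2 v1 b' v2 -> b =i b' -> x != y -> ~~ s x ->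
  y \notin u1 -> y \notin v1 -> obst s u2 y x -> after b' y x -> after b y x.
Proof.
move=> Auv su bk cb xy sx yu1 yv1 [q1 [q2 [u2E yq2 xq1 cut]]] [w1 [w2 [b'E yw1 xw2]]].
have : y \in b by rewrite cb b'E mem_cat mem_head orbT.
case/split_mem=> b1 [b2 [bE yb1]]; exists b1, b2; split=> //.
case: (boolP (x \in b2)) => // xb2; exfalso.
have sy : ~~ s y by apply: (allP (blocks_b bk)); rewrite bE mem_cat mem_head orbT.
have [w3 [w4 [w2E xw3]]] := split_mem xw2.
(* Serves both shapes of [q2]: the simple letter t goes to c, or, if [q2] is empty, a dummy letter
   goes to 1. *)
have fin t a : let off w := t \notin w \/ a = 1 in
    off (u1 ++ b1) -> off (b2 ++ q1) -> off w3 ->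
    A_ba * eval (assign2 x A_b y A_a t a) q2 <> A_0 -> False.
  move=> off o1 o2 o3; set g := assign2 _ _ _ _ _ _ => nz; apply: nz.
  have gx : g x = A_b by rewrite /g /assign2 eqxx.
  have gy : g y = A_a by rewrite /g /assign2 eq_sym (negPf xy) eqxx.
  have vE : eval g v = A_0.
    rewrite (blocks_v bk) b'E w2E !(eval_cat, eval_cons) gx gy -!mulgA (mulgA A_a).
    have [-> _] := @eval_idem A_monoid A_a g w3 erefl (assign2y _ _ _ o3 xw3).
    by rewrite (mulgA A_a A_b) -[A_a * A_b]/A_0 A_mul0l !A_mul0r.
  have := congr1 (mul A_b) (Auv g); rewrite /= vE (blocks_u bk) u2E bE.
  have yu : y \notin u1 ++ b1 by rewrite mem_cat negb_or yu1 yb1.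
  have xb : x \notin b2 ++ q1 by rewrite mem_cat negb_or xb2 xq1.
  have [E1 _] := @eval_idem A_monoid A_b g _ erefl (assign2x _ _ _ o1 yu).
  have [E2 _] := @eval_idem A_monoid A_a g _ erefl (assign2y _ _ _ o2 xb).
  rewrite -!catA catA eval_cat cat_cons eval_cons mulgA E1 gy catA eval_cat.
  by rewrite (mulgA A_a) E2 mulgA.
case: cut => [q2E|[t [q3 [st q2E]]]].
  by apply: (fin 0%N 1); [right|right|right|rewrite q2E eval_nil].
have yt : y != t by apply: contraNneq sy => ->.
have xt : x != t by apply: contraNneq sx => ->.
have := su t st; rewrite (blocks_u bk) u2E q2E !catA => /once_notin[].
rewrite bE !(mem_cat, inE) !negb_or => /andP[/andP[t1 /and3P[t2 _ t3]] t4] t5.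
apply: (fin t A_c); try (left; rewrite ?mem_cat ?negb_or ?t1 ?t2 ?t3 ?t4 //).
  apply/negP => tw3; have : t \in b' by rewrite b'E w2E !(mem_cat, inE) tw3 !orbT.
  by move/(allP (blocks_b' bk)); rewrite /= st.
have yq3 : y \notin q3 by move: yq2; rewrite q2E inE negb_or => /andP[].
rewrite q2E eval_cons; set g := assign2 _ _ _ _ _ _.
have -> : g t = A_c by rewrite /g /assign2 eq_sym (negPf xt) eq_sym (negPf yt) eqxx.
have [E1 _] := @eval_idem A_monoid A_b g _ erefl (assign2x _ _ _ (or_introl t5) yq3).
by rewrite -[A_c]/(A_c * A_b) -mulgA E1.
Qed.

End AfterA.

Ltac norm_cat := rewrite /= -?catA /= -?catA /= -?catA /=.

(** * Insertions allowed by eta *)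

Section EtaRules.
Variables (M : monoidType) (h : nat -> M).
Hypotheses (Mb : base M) (et : p_eta M).

(** Read from right to left, e t e f e = e t f e inserts an x in front of f between two x's;
    induction extends this to a word of idempotents. *)
Lemma ins_left (P w Z : seq nat) x : x \in P -> idem (h x) ->
  {in w, forall d, idem (h d)} ->
  eval h (P ++ w ++ x :: Z) = eval h (P ++ x :: w ++ x :: Z).
Proof.
move=> /split_mem[P1 [P2 [-> _]]] xx iw.
have key (w' : seq nat) t : {in w', forall d, idem (h d)} ->
    h x * t * eval h w' * h x = h x * t * h x * eval h w' * h x.
  elim: w' t => [|d w' IH] t iw'; first by rewrite eval_nil !mulg1 -!mulgA xx.
  have dd : idem (h d) by apply: iw'; rewrite mem_head.
  have {}IH t' : h x * t' * eval h w' * h x = h x * t' * h x * eval h w' * h x.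
    by apply: IH => z zw; apply: iw'; rewrite inE zw orbT.
  have := IH (t * h d); have := IH (t * h x * h d).
  have := congr1 (fun z => z * eval h w' * h x) (et t xx dd).
  by rewrite eval_cons /= !mulgA => -> -> ->.
have := congr1 (fun z => eval h P1 * z * eval h Z) (key w (eval h P2) iw).
by rewrite /= !(eval_cat, eval_cons) !mulgA.
Qed.

(** As y does not obstruct x, y recurs in [u2], and x occurs either before the last y of [u2] or
    after it with no simple letter between. The first case is the fourth identity of [base]; in the
    second, [ins_left] brings an x in front of that last y. *)
Lemma obst_ins (s : pred nat) (u2 P R : seq nat) x y :
  (forall c, ~~ s c -> idem (h c)) ->
  u2 = [::] \/ (exists t q, s t /\ u2 = t :: q) ->
  x != y -> ~~ s x -> ~~ s y -> ~ obst s u2 y x ->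
  eval h (P ++ x :: y :: R ++ u2) = eval h (P ++ x :: y :: x :: R ++ u2).
Proof.
move=> hs st xy sx sy no; have [_ _ _ b3] := Mb.
have yu2 : y \in u2.
  by case: (boolP (y \in u2)) => // yn; case: no; exists [::], u2; split.
have [a [r [u2E yr]]] := split_last yu2.
have [r1 [r2 [rE sr1 cut]]] := split_block s r.
have n3 (t1 t2 Z : seq nat) : eval h (P ++ x :: y :: t1 ++ x :: t2 ++ y :: Z) =
    eval h (P ++ x :: y :: x :: t1 ++ x :: t2 ++ y :: Z).
  have := congr1 (fun z => eval h P * z * eval h Z) (b3 (h x) (h y) (eval h t1) (eval h
    t2)).
  by rewrite /= !(eval_cat, eval_cons) !mulgA.
have [xa|xa] := boolP (x \in a).
  have [a1 [a2 [aE _]]] := split_mem xa.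
  by have := n3 (R ++ a1) a2 r; rewrite u2E aE; norm_cat.
have xr1 : x \in r1.
  case: (boolP (x \in r1)) => // xr1; case: no; exists (a ++ y :: r1), r2; split=> //.
  - by rewrite u2E rE -catA.
  - by move: yr; rewrite rE mem_cat negb_or => /andP[].
  - by rewrite mem_cat inE !negb_or xa xy xr1.
have [r3 [r4 [r1E _]]] := split_mem xr1.
have iw : {in y :: r3, forall d, idem (h d)}.
  move=> d; rewrite inE => /predU1P[->|dr]; first exact: hs.
  by apply/hs/(allP sr1); rewrite r1E mem_cat dr.
have xx := hs _ sx.
have W1 : P ++ x :: y :: R ++ u2 = (P ++ x :: y :: R ++ a) ++ (y :: r3) ++ x :: (r4 ++ r2).
  by rewrite u2E rE r1E; norm_cat.
have W2 : P ++ x :: y :: x :: R ++ u2 =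
    (P ++ x :: y :: x :: R ++ a) ++ (y :: r3) ++ x :: (r4 ++ r2).
  by rewrite u2E rE r1E; norm_cat.
rewrite W1 W2 !ins_left ?mem_cat ?mem_head ?orbT //.
by have := n3 (R ++ a) [::] (r3 ++ x :: r4 ++ r2); norm_cat.
Qed.

(** All letters involved are non-first occurrences, so c moves up to the c inside [l] and merges
    with it. *)
Lemma absorb (P l Z : seq nat) c : {subset l <= P} -> c \in l -> idem (h c) ->
  eval h (P ++ c :: l ++ Z) = eval h (P ++ l ++ Z).
Proof.
move=> lP cl cc; have [l1 [l2 [lE _]]] := split_mem cl.
have cP : c \in P by exact: lP.
have := @comm_word _ Mb h P [:: c] l1 (c :: l2 ++ Z).
rewrite lE -!catA /= => ->.
- by rewrite !(eval_cat, eval_cons) (mulgA (h c)) cc.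
- by move=> z; rewrite inE => /eqP ->.
- by move=> z zl; apply: lP; rewrite lE mem_cat zl.
Qed.

Lemma absorb_all (P l l' Z : seq nat) : {subset l <= P} -> {subset l' <= l} ->
  {in l, forall c, idem (h c)} -> eval h (P ++ l' ++ l ++ Z) = eval h (P ++ l ++ Z).
Proof.
move=> lP + il; elim: l' P lP => [//|c l' IH] P lP l'l.
rewrite cat_cons -cat_rcons IH; last 2 first.
- by move=> z /lP; rewrite mem_rcons inE => ->; rewrite orbT.
- by move=> z zl; apply: l'l; rewrite inE zl orbT.
by rewrite cat_rcons absorb //; [|apply: il]; apply: l'l; rewrite mem_head.
Qed.

End EtaRules.

(** [F] with a word written into every gap; the word depends through [S] on [Y] extended by the
    letters of [F] already passed. [satp] leaves out the final gap, as is needed to split a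
    saturated word at a letter. *)
Fixpoint satw (S : seq nat -> seq nat) (Y F : seq nat) : seq nat :=
  S Y ++ if F is y :: F' then y :: satw S (rcons Y y) F' else [::].

Fixpoint satp (S : seq nat -> seq nat) (Y F : seq nat) : seq nat :=
  if F is y :: F' then S Y ++ y :: satp S (rcons Y y) F' else [::].

Lemma satw_cat S Y F F' : satw S Y (F ++ F') = satp S Y F ++ satw S (Y ++ F) F'.
Proof.
elim: F Y => [|y F IH] Y /=; first by rewrite cats0.
by rewrite IH cat_rcons -catA.
Qed.

Lemma satp_mem S Y F : {subset F <= satp S Y F}.
Proof.
elim: F Y => //= y F IH Y z; rewrite inE mem_cat inE => /predU1P[->|/IH ->].
  by rewrite eqxx orbT.
by rewrite !orbT.
Qed.

Section EtaBlock.
Variables (W : mclass) (M : monoidType) (u v : seq nat) (s : pred nat).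
Hypotheses (Wb : forall G, W G -> base G) (Mb : base M) (et : p_eta M).
Hypothesis Wuv : forall G, W G -> satisfies G (u, v).
Hypothesis Auv : satisfies A_monoid (u, v).
Hypotheses (su : forall c, s c -> count_mem c u = 1%N)
  (sv : forall c, s c -> count_mem c v = 1%N).
Variable h : nat -> M.
Hypothesis hs : forall c, ~~ s c -> idem (h c).
Hypothesis tgam : (forall G, W G -> p_gam G) -> p_gam M.
Variables u1 b u2 v1 b' v2 : seq nat.
Hypothesis bk : blocks s u v u1 b u2 v1 b' v2.

Let content := blocks_content A_base A_not_sig1 Auv su sv bk.
Let c1 : u1 =i v1. Proof. by case: content. Qed.
Let cb : b =i b'. Proof. by case: content. Qed.
Let c2 : u2 =i v2. Proof. by case: content. Qed.
Let sb x : x \in b -> ~~ s x. Proof. by move/(allP (blocks_b bk)). Qed.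
Let idb : {in b, forall c, idem (h c)}. Proof. by move=> c /sb/hs. Qed.

Let st2 : u2 = [::] \/ (exists t q, s t /\ u2 = t :: q).
Proof.
by case: (blocks_r bk) => [[]|[t [q [_ [? ? _]]]]]; [left|right; exists t, q].
Qed.

Local Notation ob := (obst s u2).

Lemma afterE x y : x \in b -> y \in b -> x != y -> y \notin v1 -> ob y x ->
  after b y x <-> after b' y x.
Proof.
move=> xb yb xy yv oyx; have yu : y \notin u1 by rewrite c1.
split=> ab; last exact: (after_sub Auv su bk cb xy (sb xb)).
have o2 := obst_transfer Auv su sv bk (sb xb) (sb yb) oyx.
exact: (after_sub (satisfies_sym Auv) sv (blocks_sym bk) _ xy (sb xb)).
Qed.

(* [al x Y]: x may be inserted in the block right after a prefix with content Y
   without changing the word modulo A. *)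
Definition al (x : nat) (Y : seq nat) : Prop :=
  [/\ x \in b, x \in v1 ++ Y &
      forall y, y \in v1 ++ Y -> y \notin v1 -> x != y -> ob y x -> after b y x].

Definition satS (Y : seq nat) : seq nat := [seq x <- undup b | `[< al x Y >]].

Lemma mem_satS x Y : x \in satS Y <-> al x Y.
Proof.
rewrite mem_filter mem_undup; split=> [/andP[/asboolP]//|xY].
by apply/andP; split; [apply/asboolP|case: xY].
Qed.

Lemma satS_sub Y x : x \in satS Y -> x \in b /\ x \in v1 ++ Y.
Proof. by move/mem_satS => []. Qed.

Lemma eq_satS Y Y' : v1 ++ Y =i v1 ++ Y' -> satS Y = satS Y'.
Proof.
move=> E; apply: eq_filter => x; apply: asbool_equiv_eq.
split=> -[xb xY H]; split=> //.
- by rewrite -E.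
- by move=> y; rewrite -E; apply: H.
- by rewrite E.
- by move=> y; rewrite E; apply: H.
Qed.

Lemma eq_satw Y Y' F : v1 ++ Y =i v1 ++ Y' -> satw satS Y F = satw satS Y' F.
Proof.
elim: F Y Y' => [|y F IH] Y Y' E /=; rewrite (eq_satS E) //.
congr (_ ++ _ :: _); apply: IH => z; move: (E z).
by rewrite !mem_cat !mem_rcons !inE; case: (z == y); rewrite ?orbT.
Qed.

Lemma satw_sub Y F : {subset F <= b} -> {subset satw satS Y F <= b}.
Proof.
elim: F Y => [|y F IH] Y Fb z /=; rewrite mem_cat => /orP[/satS_sub[] //|//].
rewrite inE => /predU1P[->|zF]; first by apply: Fb; rewrite mem_head.
by apply: IH zF => c cF; apply: Fb; rewrite inE cF orbT.
Qed.

(* The insertion of x is licensed by the same conditions whether the block is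
   [b] or [b'], since A satisfies u = v. *)
Definition good (w : seq nat) : Prop := w =i b /\
  forall x Y, {subset Y <= b} -> (al x Y <-> [/\ x \in b, x \in v1 ++ Y &
    forall y, y \in v1 ++ Y -> y \notin v1 -> x != y -> ob y x -> after w y x]).

Lemma good_b : good b. Proof. by []. Qed.

Lemma good_b' : good b'.
Proof.
split=> [z|x Y Yb]; first by rewrite cb.
split=> -[xb xY H]; split=> // y yY yv xy oyx.
  apply/afterE => //; last exact: H.
  by move: yY; rewrite mem_cat (negPf yv) => /Yb.
apply/afterE => //; last exact: H.
by move: yY; rewrite mem_cat (negPf yv) => /Yb.
Qed.

(** If x occurs in [R], eta inserts it. Otherwise it is carried to the gap from its last occurrence
    in [q], over letters that occurred earlier and so commute with it, or that do not obstruct it; a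
    new letter that obstructs x would, by [good], be followed by x. [R] may exceed [r] since later
    gaps may be filled already. *)
Lemma sat_ins w q r R x : good w -> w = q ++ r -> {subset r <= R} -> {subset R <= b} ->
  al x q -> eval h (v1 ++ q ++ R ++ u2) = eval h (v1 ++ q ++ x :: R ++ u2).
Proof.
move=> [wb gw] wE rR Rb alx.
have qb : {subset q <= b} by move=> z zq; rewrite -wb wE mem_cat zq.
have [xb xq H] := (gw x q qb).1 alx; have xx := idb xb.
have [xR|xR] := boolP (x \in R).
  have [R1 [R2 [RE _]]] := split_mem xR.
  have := @ins_left _ h et (v1 ++ q) R1 (R2 ++ u2) x xq xx.
  rewrite RE; norm_cat=> -> // d dR; apply/idb/Rb.
  by rewrite RE mem_cat dR.
have xr : x \notin r by apply: contra xR => /rR.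
have xq' : x \in q by move: xb; rewrite -wb wE mem_cat (negPf xr) orbF.
have [q1 [q2 [qE xq2]]] := split_last xq'.
have chain (q3 P Z : seq nat) : {subset q3 <= b} -> x \notin q3 ->
    (forall y, y \in q3 -> y \in P \/ ~ ob y x) ->
    eval h (P ++ x :: q3 ++ Z ++ u2) = eval h (P ++ x :: q3 ++ x :: Z ++ u2).
  elim: q3 P => [|y q3 IH] P q3b xq3 cond.
    by rewrite /= !(eval_cat, eval_cons) (mulgA (h x) (h x)) xx.
  have yb : y \in b by apply: q3b; rewrite mem_head.
  have xy : x != y by move: xq3; rewrite inE negb_or => /andP[].
  have ins (Z' : seq nat) : eval h (P ++ x :: y :: Z' ++ u2) = eval h (P ++ x :: y :: x
    :: Z' ++ u2).
    case: (cond y (mem_head _ _)) => [yP|no].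
      transitivity (eval h (P ++ x :: x :: y :: Z' ++ u2)).
        by rewrite !(eval_cat, eval_cons) (mulgA (h x) (h x)) xx.
      have := @comm_rule _ Mb h (rcons P x) (Z' ++ u2) x y.
      by rewrite !cat_rcons !mem_rcons !inE eqxx yP orbT; apply.
    exact: (obst_ins Mb et _ _ hs st2 xy (sb xb) (sb yb) no).
  have IH' := IH (P ++ [:: x; y]).
  have E (Z' : seq nat) : P ++ [:: x, y, x & Z'] = (P ++ [:: x; y]) ++ x :: Z' by rewrite
    -catA.
  have := ins (q3 ++ Z); have := ins (q3 ++ x :: Z); norm_cat=> -> ->; rewrite !E IH' //.
  - by move=> z zq; apply: q3b; rewrite inE zq orbT.
  - by move: xq3; rewrite inE negb_or => /andP[].
  - move=> z zq; case: (cond z); first by rewrite inE zq orbT.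
      by move=> zP; left; rewrite mem_cat zP.
    by right.
have := chain q2 (v1 ++ q1) R; rewrite qE; norm_cat; apply=> //.
  by move=> z zq; apply: qb; rewrite qE mem_cat inE zq !orbT.
move=> y yq2; have [yP|yP] := boolP (y \in v1 ++ q1); first by left.
right=> oyx; move: yP; rewrite mem_cat negb_or => /andP[yv yq1].
have xy : x != y by apply: contraNneq xq2 => ->.
have [] := H y _ yv xy oyx; first by rewrite qE !(mem_cat, inE) yq2 !orbT.
move=> w1 [w2 [wE' yw1 xw2]].
have [q3 [q4 [q2E yq3]]] := split_mem yq2.
have E : w1 ++ y :: w2 = (q1 ++ x :: q3) ++ y :: (q4 ++ r).
  by rewrite -wE' wE qE q2E; norm_cat.
have yn : y \notin q1 ++ x :: q3 by rewrite mem_cat inE !negb_or yq1 yq3 eq_sym xy.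
have := congr1 (index y) E; rewrite !index_cat (negPf yw1) (negPf yn) /= eqxx !addn0 => sz.
move/eqP: E; rewrite eqseq_cat // => /andP[_]; rewrite eqseq_cons => /andP[_ /eqP w2E].
move: xw2; rewrite w2E mem_cat (negPf xr) orbF => xq4.
by move: xq2; rewrite q2E mem_cat inE xq4 !orbT.
Qed.

Lemma sat_ins_list w q r R l : good w -> w = q ++ r -> {subset r <= R} ->
  {subset R <= b} -> {subset l <= satS q} ->
  eval h (v1 ++ q ++ R ++ u2) = eval h (v1 ++ q ++ l ++ R ++ u2).
Proof.
move=> gw wE rR Rb; elim: l => [//|c l IH] lS.
have lS' : {subset l <= satS q} by move=> z zl; apply: lS; rewrite inE zl orbT.
rewrite IH // catA (catA l); have := @sat_ins w q r (l ++ R) c gw wE; norm_cat; apply.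
- by move=> z /rR zR; rewrite mem_cat zR orbT.
- by move=> z; rewrite mem_cat => /orP[/lS'/satS_sub[]|/Rb].
- by apply/mem_satS/lS; rewrite mem_head.
Qed.

Lemma satw_mem Y F : {subset F <= satw satS Y F}.
Proof.
elim: F Y => //= y F IH Y z; rewrite inE mem_cat inE => /predU1P[->|/IH ->].
  by rewrite eqxx orbT.
by rewrite !orbT.
Qed.

(** Gaps are filled from right to left, so that each insertion is certified by an unaltered prefix
    of [w]. *)
Lemma to_satw w q r : good w -> w = q ++ r ->
  eval h (v1 ++ q ++ r ++ u2) = eval h (v1 ++ q ++ satw satS q r ++ u2).
Proof.
move=> gw; elim: r q => [|c r IH] q wE.
  by rewrite (sat_ins_list (l := satS q) gw wE) //=; norm_cat.
have wE' : w = rcons q c ++ r by rewrite cat_rcons.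
have rb : {subset c :: r <= b} by move=> z zr; rewrite -(gw.1) wE mem_cat zr orbT.
have := IH _ wE'; rewrite !cat_rcons => ->.
have := @sat_ins_list w q (c :: r) (c :: satw satS (rcons q c) r) (satS q) gw wE.
norm_cat; apply=> //.
- by move=> z; rewrite !inE => /predU1P[->|/satw_mem ->]; rewrite ?eqxx ?orbT.
- move=> z; rewrite inE => /predU1P[->|]; first by apply: rb; rewrite mem_head.
  by apply: satw_sub => d dr; apply: rb; rewrite inE dr orbT.
Qed.

(** An occurrence of a letter seen before belongs to the set that saturates its gap and is absorbed
    there. [q] is the original prefix, [Y] the list of its new letters and [pre] what has been
    written so far. *)
Lemma drop_nonfirst w r : good w -> forall q Y seen pre, w = q ++ r ->
  v1 ++ Y =i v1 ++ q -> {subset Y <= b} -> seen =i v1 ++ Y ->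
  {subset v1 ++ Y <= v1 ++ pre} ->
  eval h (v1 ++ pre ++ satw satS Y r ++ u2) =
  eval h (v1 ++ pre ++ satw satS Y (map fst (toks predT seen r)) ++ u2).
Proof.
move=> gw; elim: r => [//|c r IH] q Y seen pre wE YE Yb sE preE.
have wE' : w = rcons q c ++ r by rewrite cat_rcons.
have cb' : c \in b by rewrite -(gw.1) wE mem_cat mem_head orbT.
have Ssub z : z \in satS Y -> z \in v1 ++ pre by case/satS_sub=> _ /preE.
rewrite /= orbT; have [cs|cs] := boolP (c \in seen) => /=.
  have cY : c \in v1 ++ Y by rewrite -sE.
  (* Nothing in the prefix prevents this: the present occurrence of c follows all of it. *)
  have cS : c \in satS Y.
    apply/mem_satS/(gw.2 _ _ Yb); split=> // y; rewrite YE mem_cat => + yv.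
    rewrite (negPf yv) /= => /split_mem[q1 [q2 [qE yq1]]] _ _.
    exists q1, (q2 ++ c :: r); split=> //; last by rewrite mem_cat mem_head orbT.
    by rewrite wE qE -catA.
  have YcE : v1 ++ rcons Y c =i v1 ++ Y.
    move=> z; rewrite !mem_cat mem_rcons inE; case: eqP => [->|//].
    by rewrite orbT -mem_cat cY.
  rewrite (eq_satw _ YcE) -(IH (rcons q c)) //.
  - have [T TE] : exists T, satw satS Y r = satS Y ++ T by case: (r) => [|d r'] /=; eexists.
    rewrite TE; have := @absorb_all _ h Mb (v1 ++ pre) (satS Y) (rcons (satS Y) c) (T ++
      u2).
    rewrite cat_rcons; norm_cat; apply=> //.
      by move=> z; rewrite mem_rcons inE => /predU1P[->|].
    by move=> z /satS_sub[/idb].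
  - move=> z; rewrite YE !mem_cat mem_rcons inE; case: eqP => // ->.
    by rewrite orTb orbT -mem_cat -YE.
  - by move=> z; rewrite inE sE; case: eqP => // ->.
have := IH (rcons q c) (rcons Y c) (c :: seen) (pre ++ satS Y ++ [:: c]) wE'.
norm_cat; apply.
- by move=> z; move: (YE z); rewrite !mem_cat !mem_rcons !inE; case: (z == c); rewrite
  ?orbT.
- by move=> z; rewrite mem_rcons inE => /predU1P[->|/Yb].
- by move=> z; rewrite inE sE !mem_cat mem_rcons inE; case: (z == c); rewrite ?orbT.
- move=> z; move: (preE z); rewrite !mem_cat mem_rcons !inE; case: (z == c); rewrite
  ?orbT //.
  by move=> H /H /orP[->|->]; rewrite ?orbT.
Qed.

Lemma to_firsts w : good w -> eval h (v1 ++ w ++ u2) =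
  eval h (v1 ++ satw satS [::] (map fst (toks predT v1 w)) ++ u2).
Proof.
move=> gw; rewrite (to_satw (q := [::]) gw) // /=.
by apply: (drop_nonfirst gw (q := [::]) (pre := [::])) => // z; rewrite cats0.
Qed.

(** Empties the gap [l] between x and y. A letter z of [l] goes either by eta, because a z follows
    in [S3], or by [obst_ins] read backwards, because a z stands in [S0] and x does not obstruct
    z. *)
Lemma sat_rem P x y l S0 S3 T : {subset S0 <= P} -> {subset S0 <= b} -> {subset S3 <= b} ->
  {subset l <= b} -> {subset l <= rcons P x} -> x \in b -> y \in b ->
  (forall z, z \in l -> z \in S3 \/ [/\ z \in S0, z != x & ~ ob x z]) ->
  eval h (P ++ S0 ++ x :: l ++ y :: S3 ++ T ++ u2) =
  eval h (P ++ S0 ++ x :: y :: S3 ++ T ++ u2).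
Proof.
move=> S0P S0b S3b + + xb yb; elim: l => [//|z l IH] lb lP H.
have lb' : {subset l <= b} by move=> c cl; apply: lb; rewrite inE cl orbT.
have lP' : {subset l <= rcons P x} by move=> c cl; apply: lP; rewrite inE cl orbT.
rewrite -IH //; last by move=> c cl; apply: H; rewrite inE cl orbT.
have zb : z \in b by apply: lb; rewrite mem_head.
have zP : z \in rcons P x by apply: lP; rewrite mem_head.
have zz := idb zb.
case: (H z (mem_head _ _)) => [zS3|[zS0 zx no]].
  have [S4 [S5 [S3E _]]] := split_mem zS3.
  have := @ins_left _ h et (P ++ S0 ++ [:: x]) (l ++ y :: S4) (S5 ++ T ++ u2) z.
  rewrite S3E; norm_cat => -> //.
    by move: zP; rewrite !mem_cat mem_rcons !inE => /orP[->|->]; rewrite ?orbT.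
  move=> d; rewrite mem_cat inE => /or3P[/lb'/idb //|/eqP->|dS]; apply: idb => //.
  by apply: S3b; rewrite S3E mem_cat dS.
have ab Z : eval h (P ++ S0 ++ Z) = eval h (P ++ S0 ++ z :: Z).
  have [S4 [S5 [S0E _]]] := split_mem zS0.
  have sub4 : {subset S5 <= P ++ S4 ++ [:: z]}.
    by move=> c cS; rewrite mem_cat S0P // S0E mem_cat inE cS !orbT.
  have sub5 : {subset [:: z] <= P ++ S4 ++ [:: z]}.
    by move=> c; rewrite !mem_cat => ->; rewrite !orbT.
  have := @comm_word _ Mb h (P ++ S4 ++ [:: z]) [:: z] S5 Z sub5 sub4.
  rewrite S0E; norm_cat => <-.
  by rewrite !(eval_cat, eval_cons) (mulgA (h z) (h z)) zz.
rewrite ab [RHS]ab.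
have := @obst_ins _ h Mb et s u2 (P ++ S0) (l ++ y :: S3 ++ T) z x hs st2 zx (sb zb) (sb
  xb) no.
by norm_cat => ->.
Qed.

(** A saturated block is determined by the order of its new letters. To exchange neighbours x and y,
    the gap between them is emptied, gam exchanges them, and the new gap is filled. Emptying is
    possible because a letter allowed in the gap is allowed after both x and y, or else already
    before both. *)
Lemma eta_block : eval h (v1 ++ b ++ u2) = eval h (v1 ++ b' ++ u2).
Proof.
rewrite (to_firsts good_b) (to_firsts good_b').
pose A := toks predT v1 b; pose A' := toks predT v1 b'.
apply: (bubble (R := fun A B => eval h (v1 ++ satw satS [::] (map fst A) ++ u2) =
                                eval h (v1 ++ satw satS [::] (map fst B) ++ u2))) => //.
- by move=> ? ? ? -> ->.
- exact: toks_uniq.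
- apply: uniq_perm; try exact: toks_uniq.
  by case=> x []; rewrite ?mem_toksT ?mem_toksF cb.
move=> p a0 b0 q pL cL bu bv.
have memA z i : (z, i) \in p ++ a0 :: b0 :: q -> [/\ z \in b, z \notin v1 & i = true].
  rewrite (perm_mem pL); case: i; rewrite ?mem_toksT ?mem_toksF ?andbF // => /andP[].
  by split.
have UL : uniq (p ++ a0 :: b0 :: q) by rewrite (perm_uniq pL) toks_uniq.
case: a0 b0 bu bv pL cL memA UL => [x i] [y j] bu bv pL cL memA UL.
have [xb xv iT] : [/\ x \in b, x \notin v1 & i = true].
  by apply: memA; rewrite mem_cat mem_head orbT.
have [yb yv jT] : [/\ y \in b, y \notin v1 & j = true].
  by apply: memA; rewrite mem_cat !inE eqxx !orbT.
rewrite iT jT in bu bv pL cL memA UL *.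
have xb' : x \in b' by rewrite -cb.
have yb' : y \in b' by rewrite -cb.
have xy : x != y.
  by have := before_neq bu; rewrite xpair_eqE eqxx andbT.
have yx : y != x by rewrite eq_sym.
have ordb z z' : z \in b -> z' \in b -> z \notin v1 -> z' \notin v1 ->
    before A (z, true) (z', true) -> after b z z'.
  move=> zb zb' zv zv' bz; have neq := before_neq bz.
  apply: first_after => //; first exact: (beforeTT_seen zb zv zv' bz).
  by apply: contraNneq neq => ->.
have ordb' z z' : z \in b -> z' \in b -> z \notin v1 -> z' \notin v1 ->
    before A' (z, true) (z', true) -> after b' z z'.
  move=> zb zb' zv zv' bz; have neq := before_neq bz.
  apply: first_after => //; first by rewrite -cb.
    by apply: (beforeTT_seen _ zv zv' bz); rewrite -cb.
  by apply: contraNneq neq => ->.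
have gm : p_gam M.
  apply: tgam => G WG.
  apply: (derive_gam_block (Wb WG) (Wuv WG) bk xy); rewrite ?c1 //.
    exact: (beforeTT_seen xb xv yv bu).
  exact: (beforeTT_seen yb' yv xv bv).
have yx_after : ob y x -> after b y x.
  by move=> oyx; apply/afterE => //; apply: ordb'.
have xy_after : after b x y by exact: ordb.
have prev z z' : z \in map fst p -> z' \in [:: x; y] -> ob z z' -> after b z z'.
  move=> /mapP[[z0 i0] zp /= ->] z'in oz.
  have [zb zv i0T] : [/\ z0 \in b, z0 \notin v1 & i0 = true].
    by apply: memA; rewrite mem_cat zp.
  rewrite i0T in zp.
  have [z'b z'v] : z' \in b /\ z' \notin v1.
    by move: z'in; rewrite !inE => /orP[] /eqP ->.
  have z'p : (z', true) \notin p.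
    move: UL; rewrite cat_uniq => /and3P[_ + _]; rewrite /= !negb_or => /and3P[? ? _].
    by move: z'in; rewrite !inE => /orP[] /eqP ->.
  have zz' : z' != z0 by apply: contraNneq z'p => ->.
  have bL : before (p ++ (x, true) :: (y, true) :: q) (z0, true) (z', true).
    rewrite /before !index_cat zp (negPf z'p).
    by apply: leq_trans (leq_addr _ _); rewrite index_mem.
  have zA : (z0, true) \in A by rewrite mem_toksT zb zv.
  have ne : (z0, true) != (z', true) by rewrite xpair_eqE eqxx andbT eq_sym.
  case/orP: (before_total zA ne) => [bz|bz1]; first exact: ordb.
  have zA' : (z0, true) \in A' by rewrite mem_toksT -cb zb zv.
  case/orP: (before_total zA' ne) => [bz2|bz2]; last first.
    by have := before_asym (cL _ _ bz1 bz2); rewrite bL.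
  by apply/afterE => //; apply: ordb'.
rewrite !map_cat /= !satw_cat /=.
set pf := map fst p; set qf := map fst q.
set P := satp satS [::] pf.
have pfb : {subset pf <= b}.
  by move=> z /mapP[[z0 i0] zp /= ->]; have [] := memA z0 i0; rewrite ?mem_cat ?zp.
have EY : v1 ++ rcons (rcons pf y) x =i v1 ++ rcons (rcons pf x) y.
  by move=> z; rewrite !mem_cat !mem_rcons !inE !mem_rcons !inE; case: (z == x); case: (z
    == y).
rewrite (eq_satw qf EY).
have [T TE] : exists T, satw satS (rcons (rcons pf x) y) qf = satS (rcons (rcons pf x) y)
  ++ T.
  by case: (qf) => [|d r'] /=; eexists.
rewrite TE; set S0 := satS pf; set S1 := satS _; set S3 := satS _; set S2 := satS _.
(* x and y are both allowed in the gap after them, which can therefore lend a third letter; gam then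
   applies as x y x = y x y. *)
have xS3 : x \in S3.
  apply/mem_satS; split=> //; first by rewrite !mem_cat !mem_rcons !inE !mem_rcons !inE
    eqxx !orbT.
  move=> z; rewrite mem_cat !mem_rcons !inE !mem_rcons !inE => + zv xz oz.
  rewrite (negPf zv) [z == x]eq_sym (negPf xz) /= => /orP[/eqP zy|zp]; first by rewrite
    zy in oz *; exact: yx_after.
  by apply: prev => //; rewrite !inE eqxx.
have yS3 : y \in S3.
  apply/mem_satS; split=> //; first by rewrite !mem_cat !mem_rcons !inE eqxx !orbT.
  move=> z; rewrite mem_cat !mem_rcons !inE !mem_rcons !inE => + zv yz oz.
  rewrite (negPf zv) [z == y]eq_sym (negPf yz) /= => /orP[/eqP -> //|zp].
  by apply: prev => //; rewrite !inE eqxx orbT.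
have subP Y z : z \in v1 ++ Y -> {subset Y <= pf} -> z \in v1 ++ P.
  by move=> + Yp; rewrite !mem_cat => /orP[->//|/Yp/(@satp_mem satS [::]) ->]; rewrite orbT.
have S0P : {subset S0 <= v1 ++ P} by move=> z /satS_sub[_ zp]; exact: (subP pf).
have Sb Y : {subset satS Y <= b} by move=> z /satS_sub[].
have SP z t : z \in satS (rcons pf t) -> z \in rcons (v1 ++ P) t.
  case/satS_sub=> _; rewrite mem_cat !mem_rcons !inE => /or3P[zv|->//|zp].
    by rewrite mem_cat zv orbT.
  by rewrite orbC (subP pf) // mem_cat zp orbT.
have S3P (c d : nat) : {subset [:: x; y] <= [:: c; d]} -> {subset S3 <= (v1 ++ P ++ S0)
  ++ [:: c; d]}.
  move=> cd z /satS_sub[_]; rewrite !mem_cat !mem_rcons inE mem_rcons inE.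
  move=> /or4P[->//|zy|zx|zp]; rewrite ?orbT //.
  - by rewrite (cd z) ?orbT // !inE zy orbT.
  - by rewrite (cd z) ?orbT // !inE zx.
  - by have := subP pf z; rewrite !mem_cat zp orbT => /(_ isT (fun _ => id)) /orP[] ->;
    rewrite ?orbT.
have stepb : eval h ((v1 ++ P) ++ S0 ++ x :: y :: S3 ++ T ++ u2) =
    eval h ((v1 ++ P) ++ S0 ++ y :: x :: S3 ++ T ++ u2).
  have [xx yy] := (idb xb, idb yb).
  have := @absorb _ h Mb ((v1 ++ P ++ S0) ++ [:: x; y]) S3 (T ++ u2) x (S3P x y (fun _ =>
    id)) xS3 xx.
  have := @absorb _ h Mb ((v1 ++ P ++ S0) ++ [:: y; x]) S3 (T ++ u2) y _ yS3 yy.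
  norm_cat => H2 H1; rewrite -H1 -H2; last first.
    by have := S3P y x; norm_cat; apply=> z; rewrite !inE orbC.
  rewrite !(eval_cat, eval_cons); do 3!congr (_ * _).
  by rewrite !mulgA gm.
have alsub z Y Y' : al z Y -> (forall y, y \in v1 ++ Y' -> y \in v1 ++ Y) -> z \in v1 ++
  Y' -> al z Y'.
  by case=> zb zY H sub zY'; split=> // t /sub; apply: H.
have inY t : t \in [:: x; y] -> forall z, z \in v1 ++ rcons pf t -> z \in v1 ++ rcons
  (rcons pf x) y.
  move=> tin z; rewrite !mem_cat !mem_rcons !inE !mem_rcons !inE =>
    /or3P[->//|/eqP->|->]; rewrite ?orbT //.
  by move: tin; rewrite !inE => /orP[->|->]; rewrite ?orbT.
(* A letter allowed after one of x, y but not after both can only be blocked by the other one. *)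
have nal z t t' : t \in [:: x; y] -> al z (rcons pf t) -> ~ al z (rcons (rcons pf x) y) ->
    t' \in [:: x; y] -> t != t' -> [/\ z != t', ob t' z & ~ after b t' z].
  move=> tin alz nalz t'in tt'.
  have [zz'|zt'] := eqVneq z t'.
    by case: nalz; apply/mem_satS; rewrite zz'; move: t'in; rewrite !inE => /orP[] /eqP ->.
  apply: contrapT => nn; apply: nalz; case: (alz) => zb zY H.
  split=> //; first exact: inY tin _ zY.
  move=> c cY cv zc oc; have [ct|ct] := eqVneq c t'.
    by apply: contrapT => na; apply: nn; rewrite -ct; split=> //; rewrite ct.
  apply: H => //; move: cY; rewrite !mem_cat !mem_rcons !inE !mem_rcons !inE.
  move: tin t'in tt' ct; rewrite !inE => /orP[] /eqP -> /orP[] /eqP -> ; rewrite ?eqxx //.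
    by move=> _ /negPf ->.
  by move=> _ /negPf ->; case: (c == y); rewrite ?orbT.
have stepa : eval h ((v1 ++ P) ++ S0 ++ x :: S1 ++ y :: S3 ++ T ++ u2) =
    eval h ((v1 ++ P) ++ S0 ++ x :: y :: S3 ++ T ++ u2).
  apply: sat_rem => //; try exact: Sb.
    by move=> z; exact: SP.
  move=> z /mem_satS alz; have [zS|zS] := boolP (z \in S3); [by left|right].
  have nalz : ~ al z (rcons (rcons pf x) y) by move/mem_satS; rewrite (negPf zS).
  have [|||zy oz na] := nal z x y _ alz nalz; rewrite ?inE ?eqxx ?orbT //.
  have zx : z != x by apply: contraNneq zS => ->.
  split=> //.
    apply/mem_satS; apply: (alsub _ _ _ alz).
      by move=> c; rewrite !mem_cat mem_rcons inE => /orP[->//|->]; rewrite !orbT.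
    by case: alz => _; rewrite !mem_cat mem_rcons inE (negPf zx).
  (* If x obstructed z, then z would follow the first x in [b], hence in [b'], where y comes before
     x; so z would follow y in [b'] and thus in [b], against [na]. *)
  move=> oxz; apply: na; apply/afterE => //; first by case: alz.
  apply: (@after_trans _ x) => //; last exact: (beforeTT_seen yb' yv xv bv).
  apply/afterE => //; first by case: alz.
  by case: alz => _ _; apply => //; rewrite mem_cat mem_rcons mem_head orbT.
have stepc : eval h ((v1 ++ P) ++ S0 ++ y :: S2 ++ x :: S3 ++ T ++ u2) =
    eval h ((v1 ++ P) ++ S0 ++ y :: x :: S3 ++ T ++ u2).
  apply: sat_rem => //; try exact: Sb.
    by move=> z; exact: SP.
  move=> z /mem_satS alz; have [zS|zS] := boolP (z \in S3); [by left|right].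
  have nalz : ~ al z (rcons (rcons pf x) y) by move/mem_satS; rewrite (negPf zS).
  have [|||zx oz na] := nal z y x _ alz nalz; rewrite ?inE ?eqxx ?orbT //.
  have zy : z != y by apply: contraNneq zS => ->.
  split=> //.
    apply/mem_satS; apply: (alsub _ _ _ alz).
      by move=> c; rewrite !mem_cat mem_rcons inE => /orP[->//|->]; rewrite !orbT.
    by case: alz => _; rewrite !mem_cat mem_rcons inE (negPf zy).
  move=> oyz; apply: na.
  apply: (@after_trans _ y) => //; last exact: (beforeTT_seen xb xv yv bu).
  by case: alz => _ _; apply => //; rewrite mem_cat mem_rcons mem_head orbT.
by move: stepa stepb stepc; norm_cat => -> -> ->.
Qed.

End EtaBlock.

(** * Proper subvarieties are Cross *)

Lemma R_not_triv : ~ p_triv R_monoid. Proof. by move/(_ R_a). Qed.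
Lemma R_not_band : ~ p_band R_monoid. Proof. by move/(_ R_a). Qed.
Lemma R_not_sig1 : ~ p_sig1 R_monoid. Proof. by move/(_ R_c R_a R_b erefl). Qed.
Lemma R_not_gam : ~ p_gam R_monoid. Proof. by move/(_ R_b R_c erefl erefl). Qed.
Lemma R_not_eta : ~ p_eta R_monoid. Proof. by move/(_ R_c R_b R_a erefl erefl). Qed.

(** [s] collects the letters simple on both sides; the others receive squares. A letter simple on
    one side only forces the band law, under which squaring changes nothing, and different contents
    force triviality. *)
Lemma reduce_simple (W : mclass) (M : monoidType) (u v : seq nat) (h : nat -> M) :
  (forall G, W G -> base G) -> base M -> (forall G, W G -> satisfies G (u, v)) ->
  ((forall G, W G -> p_triv G) -> p_triv M) ->
  ((forall G, W G -> p_band G) -> p_band M) ->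
  eval h u = eval h v \/ exists (s : pred nat) (h' : nat -> M),
    [/\ (forall c, s c -> count_mem c u = 1%N) /\ (forall c, s c -> count_mem c v = 1%N),
        forall c, ~~ s c -> idem (h' c), u =i v, eval h u = eval h' u &
        eval h v = eval h' v].
Proof.
move=> Wb Mb Wuv ttriv tband.
have [uv|/existsNP[c cuv]] := pselect (u =i v); last first.
  left; suff tr : p_triv M by rewrite (tr (eval h u)) (tr (eval h v)).
  apply: ttriv => G WG; have [cu|cu] := boolP (c \in u).
    have cv : c \notin v by apply/negP => cv; apply: cuv; rewrite cu cv.
    exact: (derive_triv (Wb _ WG) (Wuv _ WG) cu cv).
  have cv : c \in v by apply: contrapT => /negP cv; apply: cuv; rewrite (negPf cu) (negPf
    cv).
  exact: (derive_triv (Wb _ WG) (satisfies_sym (Wuv _ WG)) cv cu).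
right; pose s c := (count_mem c u == 1%N) && (count_mem c v == 1%N).
exists s, (fun c => if s c then h c else h c * h c); split=> //.
- by split=> c /andP[/eqP ? /eqP].
- by move=> c /negPf ->; exact: idem_sq.
- have [bd|nbd] := pselect (p_band M).
    by apply: eq_in_eval => c _; case: ifP; rewrite ?bd.
  apply: eval_square => // c cu sc; rewrite ltnNge; apply/negP => cle.
  have c1 : count_mem c u = 1%N.
    by apply/eqP; rewrite eqn_leq cle -has_count has_pred1.
  apply: nbd; apply: tband => G WG; apply: (derive_band (Wb _ WG) (Wuv _ WG) c1).
  move: sc; rewrite /s c1 eqxx /= ltn_neqAle eq_sym => ->.
  by rewrite -has_count has_pred1 -uv.
- have [bd|nbd] := pselect (p_band M).
    by apply: eq_in_eval => c _; case: ifP; rewrite ?bd.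
  apply: eval_square => // c cv sc; rewrite ltnNge; apply/negP => cle.
  have c1 : count_mem c v = 1%N.
    by apply/eqP; rewrite eqn_leq cle -has_count has_pred1.
  apply: nbd; apply: tband => G WG.
  apply: (derive_band (Wb _ WG) (satisfies_sym (Wuv _ WG)) c1).
  move: sc; rewrite /s c1 eqxx andbT /= ltn_neqAle eq_sym => ->.
  by rewrite -has_count has_pred1 uv.
Qed.

(** This shows that [R_monoid] generates R_2: the block argument is run for the class consisting of
    [R_monoid] alone, which has none of the trivial law, the band law, sig1, gam and eta. *)
Lemma R_sat_R2 e : satisfies R_monoid e ->
  forall M, varR2 M -> satisfies M e.
Proof.
case: e => u v Ruv M MR h /=; have Mb := R2_base MR.
have lrb (e f : M) : idem e -> idem f -> e * f * e = e * f.
  move=> ee ff; have [/varR2P[ME _]] := (MR, I).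
  have := ME _ E_sat_lrb (assign4 e f 1 1); eval_word.
  by rewrite /assign4 /= -!(mulgA _ e e) !ee -(mulgA e f f) ff.
pose W : mclass := fun G => G = R_monoid.
have Wb G : W G -> base G by move=> ->; exact: R_base.
have Wuv G : W G -> satisfies G (u, v) by move=> ->.
have [//|[s [h' [[su sv] hs uv -> ->]]]] := reduce_simple h Wb Mb Wuv
  (fun H => False_ind _ (R_not_triv (H _ erefl)))
  (fun H => False_ind _ (R_not_band (H _ erefl))).
apply: (block_ind (s := s) (R := fun x y => eval h' x = eval h' y)) => //.
- by move=> ? ? ? -> ->.
- move=> u1 b u2 v1 b' v2 bk.
  have [c1 cb c2] := blocks_content R_base R_not_sig1 Ruv su sv bk.
  apply: (lrb_block Wb Mb Wuv su sv hs bk) => //.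
    by move/(_ _ erefl); exact: R_not_gam.
  by move/(_ _ erefl); exact: R_not_eta.
- exact: (simple_order R_not_sig1 Ruv su sv).
Qed.

Lemma varNP M : varN M <->
  forall e, satisfies A_monoid e -> satisfies R_monoid e -> satisfies M e.
Proof.
split=> [/var_genP MN e Ae Re|MN].
  apply: MN => G [/var_ofP GA|GR]; first exact: GA.
  exact: R_sat_R2 Re _ GR.
apply/var_genP => e eN; apply: MN; apply: eN.
  by left; apply/var_ofP.
by right; exact: R_varR2.
Qed.

Lemma varN_base M : varN M -> base M.
Proof.
move/varNP => MN; apply/baseP => e eb; apply: MN.
  by apply: (baseP _).1 A_base _ eb.
by apply: (baseP _).1 R_base _ eb.
Qed.

(* The properties listed in [key_prop], with each idempotent variable replaced by
   a square. *)
Definition key_ids : seq identity :=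
  [:: ([:: 2], [::]); ([:: 2; 2], [:: 2]); ([:: 2; 3], [:: 3; 2]);
      ([:: 0; 0; 2; 0; 0], [:: 2; 0; 0]); ([:: 0; 0; 2; 0; 0], [:: 0; 0; 2]);
      ([:: 0; 0; 2; 0; 0; 3; 0; 0], [:: 0; 0; 2; 3; 0; 0]);
      ([:: 0; 0; 1; 1; 2; 0; 0], [:: 0; 0; 1; 1; 0; 0; 2; 0; 0]);
      ([:: 0; 0; 2; 0; 0; 1; 1; 0; 0], [:: 0; 0; 2; 1; 1; 0; 0]);
      ([:: 0; 0; 1; 1; 0; 0], [:: 1; 1; 0; 0; 1; 1]);
      ([:: 0; 0; 1; 1], [:: 0; 0; 1; 1; 0; 0])]%N.

Definition key_prop (i : nat) : monoidType -> Prop :=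
  nth p_triv [:: p_triv; p_band; p_comm; p_tau1; p_tau2; p_sig1; p_sig2; p_eta;
                 p_gam; p_del] i.

Lemma key_idP (G : monoidType) i : base G -> (i < 10)%N ->
  satisfies G (nth ([::], [::]) key_ids i) <-> key_prop i G.
Proof.
move=> Gb; case: i => [|[|[|[|[|[|[|[|[|[|//]]]]]]]]]] _; rewrite /key_prop /=; split=> H.
- by move=> t; have := H (assign4 1 1 t 1); eval_word.
- by move=> h; eval_word.
- by move=> t; have := H (assign4 1 1 t 1); eval_word.
- by move=> h; eval_word.
- by move=> t t'; have := H (assign4 1 1 t t'); eval_word.
- by move=> h; eval_word.
- move=> e t ee; have := H (assign4 e 1 t 1); eval_word; rewrite /assign4 /=.
  by rewrite -!(mulgA _ e e) !ee.
- by move=> h; have := H _ (h 2%N) (idem_sq Gb (h 0%N)); eval_word.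
- move=> e t ee; have := H (assign4 e 1 t 1); eval_word; rewrite /assign4 /=.
  by rewrite -!(mulgA _ e e) !ee.
- by move=> h; have := H _ (h 2%N) (idem_sq Gb (h 0%N)); eval_word.
- move=> e t t' ee; have := H (assign4 e 1 t t'); eval_word; rewrite /assign4 /=.
  by rewrite -!(mulgA _ e e) !ee.
- by move=> h; have := H _ (h 2%N) (h 3%N) (idem_sq Gb (h 0%N)); eval_word.
- move=> e f t ee ff; have := H (assign4 e f t 1); eval_word; rewrite /assign4 /=.
  by rewrite -!(mulgA _ e e) !ee -!(mulgA _ f f) !ff.
- by move=> h; have := H _ _ (h 2%N) (idem_sq Gb (h 0%N)) (idem_sq Gb (h 1%N)); eval_word.
- move=> e f t ee ff; have := H (assign4 e f t 1); eval_word; rewrite /assign4 /=.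
  by rewrite -!(mulgA _ e e) !ee -!(mulgA _ f f) !ff.
- by move=> h; have := H _ _ (h 2%N) (idem_sq Gb (h 0%N)) (idem_sq Gb (h 1%N)); eval_word.
- move=> e f ee ff; have := H (assign4 e f 1 1); eval_word; rewrite /assign4 /=.
  by rewrite -!(mulgA _ e e) !ee -!(mulgA _ f f) !ff.
- by move=> h; have := H _ _ (idem_sq Gb (h 0%N)) (idem_sq Gb (h 1%N)); eval_word.
- move=> e f ee ff; have := H (assign4 e f 1 1); eval_word; rewrite /assign4 /=.
  by rewrite -!(mulgA _ e e) !ee -!(mulgA _ f f) !ff.
- by move=> h; have := H _ _ (idem_sq Gb (h 0%N)) (idem_sq Gb (h 1%N)); eval_word.
Qed.

(** The source of all three Cross properties. One of sig1, sig2, eta is available because some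
    identity of [W] fails in a member of N, hence in A or in R_2; the corresponding normal form then
    transfers every identity of [W] to [M]. *)
Lemma determinacy (W : mclass) : is_variety W -> proper_subclass W varN ->
  forall M, base M ->
  (forall e, e \in key_ids -> (forall G, W G -> satisfies G e) -> satisfies M e) -> W M.
Proof.
move=> Wv [WN WnN] M Mb key.
have Wb G : W G -> base G by move=> /WN/varN_base.
have tr i : (i < 10)%N -> (forall G, W G -> key_prop i G) -> key_prop i M.
  move=> i10 H; apply/(key_idP Mb i10)/key; first exact: mem_nth.
  by move=> G WG; apply/(key_idP (Wb _ WG) i10)/H.
have cases : [\/ forall G, W G -> p_sig1 G, forall G, W G -> p_sig2 G |
                 forall G, W G -> p_eta G].
  have [N0 [NN0 nW]] : exists N0, varN N0 /\ ~ W N0.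
    apply: contrapT => nex; apply: WnN => G; split; first exact: WN.
    by move=> NG; apply: contrapT => nW; apply: nex; exists G.
  have [[u v] [We ne]] : exists e, theory W e /\ ~ satisfies N0 e.
    apply: contrapT => nex; apply: nW; apply: birkhoff => // e We.
    by apply: contrapT => ne; apply: nex; exists e.
  have [Ae|/A_fail[H|H]] := pselect (satisfies A_monoid (u, v)); last 2 first.
  - by apply: Or31 => G WG; apply: H; [exact: Wb|exact: We].
  - by apply: Or32 => G WG; apply: H; [exact: Wb|exact: We].
  have [Re|/R_fail[H|H]] := pselect (satisfies R_monoid (u, v)).
  - by case: ne; move/varNP: NN0; apply.
  - by apply: Or31 => G WG; apply: H; [exact: Wb|exact: We].
  - by apply: Or33 => G WG; apply: H; [exact: Wb|exact: We].
apply: birkhoff => // -[u v] Wuv h /=.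
have [//|[s [h' [[su sv] hs uv -> ->]]]] :=
  reduce_simple h Wb Mb Wuv (tr 0%N isT) (tr 1%N isT).
have [W1|/existsNP[G0 /not_implyP[WG0 nsig]]] := pselect (forall G, W G -> p_sig1 G).
  exact: (sig1_case Wb Mb Wuv su sv hs uv (tr 5%N isT W1) (tr 8%N isT) (tr 9%N isT)
    (tr 3%N isT) (tr 4%N isT) (tr 2%N isT)).
apply: (block_ind (s := s) (R := fun x y => eval h' x = eval h' y)) => //.
- by move=> ? ? ? -> ->.
- move=> u1 b u2 v1 b' v2 bk.
  have [c1 cb c2] := blocks_content (Wb _ WG0) nsig (Wuv _ WG0) su sv bk.
  have [W2|nW2] := pselect (forall G, W G -> p_sig2 G).
    exact: (sig2_block Wb Mb Wuv su sv hs bk c1 cb c2 (tr 6%N isT W2) (tr 8%N isT)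
      (tr 7%N isT) (tr 9%N isT)).
  have W3 : forall G, W G -> p_eta G by case: cases => // H; case: nsig; exact: H.
  (* A failure in A would give sig1 or sig2 throughout [W], and both are excluded here; the
     saturation argument relies on this. *)
  have Auv : satisfies A_monoid (u, v).
    apply: contrapT => /A_fail[H|H]; first by apply: nsig; apply: H; [exact: Wb|exact: Wuv].
    by apply: nW2 => G WG; apply: H; [exact: Wb|exact: Wuv].
  exact: (eta_block Wb Mb (tr 7%N isT W3) Wuv Auv su sv hs (tr 8%N isT) bk).
- exact: (simple_order nsig (Wuv _ WG0) su sv).
Qed.

Lemma inj_finite_set (T : choiceType) (U : finType) (f : T -> U) (x0 : T) :
  injective f -> finite_set [set: T].
Proof.
move=> fi; pose g u := xget x0 [set x | f x = u].
apply: (@sub_finite_set _ _ (g @` [set: U])); last exact: finite_image.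
move=> x _; exists (f x) => //; rewrite /g.
by case: xgetP => [y _ /fi //|nx]; case: (nx x).
Qed.

Lemma eval_eq_letters k (G : monoidType) (u v : seq nat) :
  all (fun c => c < k)%N u -> all (fun c => c < k)%N v ->
  (forall g : 'I_k.+1 -> G, eval (fun c => g (inord c)) u = eval (fun c => g (inord c)) v) ->
  satisfies G (u, v).
Proof.
move=> uk vk H h /=; have E w : all (fun c => c < k)%N w ->
    eval h w = eval (fun c => h (nat_of_ord (inord c : 'I_k.+1))) w.
  move=> wk; apply: eq_in_eval => c cw; rewrite inordK //.
  by apply: leqW; apply: (allP wk).
by rewrite (E u) // (E v) // (H (fun i => h i)).
Qed.

(** * Relatively free monoids of finite rank *)

Section FreeMonoid.
Variables (W : mclass) (k : nat).

(** Erasing the letters from [k] on makes the free monoid of rank [k] a quotient of the words over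
    the whole alphabet. *)
Definition cut (w : seq nat) := [seq c <- w | (c < k)%N].
Definition free_rel (u v : seq nat) : Prop := theory W (cut u, cut v).

Fact free_refl u : free_rel u u. Proof. by []. Qed.
Fact free_sym u v : free_rel u v -> free_rel v u.
Proof. by move=> uv G WG; apply/satisfies_sym/uv. Qed.
Fact free_trans u v w : free_rel u v -> free_rel v w -> free_rel u w.
Proof. by move=> uv vw G WG h; rewrite [LHS](uv G WG h); exact: (vw G WG h). Qed.
Fact free_cat u u' v v' : free_rel u u' -> free_rel v v' -> free_rel (u ++ v) (u' ++ v').
Proof.
move=> uu vv G WG h; rewrite /cut !filter_cat !eval_cat.
by rewrite [eval h (cut u)](uu G WG h) [eval h (cut v)](vv G WG h).
Qed.

Definition free_monoid : monoidType := qmonoid free_refl free_sym free_trans free_cat.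

Lemma cut_subst phi w : cut (subst phi w) = subst (cut \o phi) w.
Proof.
elim: w => // c w IH; rewrite !subst_cons -IH.
exact: filter_cat.
Qed.

Lemma free_in : is_variety W -> W free_monoid.
Proof.
move=> Wv; apply: birkhoff => // -[u v] We; apply/qmonoid_satisfies => phi G WG h /=.
by rewrite !cut_subst !eval_subst; apply: (We G WG).
Qed.

Lemma free_theory e : all (fun c => c < k)%N (e.1 ++ e.2) -> satisfies free_monoid e ->
  theory W e.
Proof.
case: e => u v; rewrite all_cat /= => /andP[uk vk] /qmonoid_satisfies/(_ (fun c => [::
  c])) /=.
have idE w : all (fun c => c < k)%N w -> cut (subst (fun c => [:: c]) w) = w.
  move=> wk; have -> : subst (fun c => [:: c]) w = w by elim: (w) => //= c w' IH; rewrite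
    subst_cons IH.
  by apply/all_filterP.
by rewrite /free_rel !idE.
Qed.

Lemma free_finite : subclass W varN -> finite_set [set: free_monoid].
Proof.
move=> WN.
(* An element is determined by its values under the assignments into A and into R. The index type
   has one element more than there are letters, because [inord] needs it nonempty even for k = 0. *)
pose fA (x : free_monoid) : {ffun {ffun 'I_k.+1 -> A_monoid} -> A_monoid} :=
  [ffun g : {ffun 'I_k.+1 -> A_monoid} => eval (fun c => g (inord c)) (cut (val x))].
pose fR (x : free_monoid) : {ffun {ffun 'I_k.+1 -> R_monoid} -> R_monoid} :=
  [ffun g : {ffun 'I_k.+1 -> R_monoid} => eval (fun c => g (inord c)) (cut (val x))].
apply: (@inj_finite_set _ _ (fun x => (fA x, fR x)) 1) => x y [/ffunP EA /ffunP ER].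
rewrite -(qclassK x) -(qclassK y); apply/qclass_eq => G /WN/varNP GN.
have all_cut w : all (fun c => c < k)%N (cut w) by exact: filter_all.
apply: GN; apply: (eval_eq_letters (k := k)) => // g.
  have := EA [ffun i => g i]; rewrite !ffunE => E.
  by have := E; rewrite (_ : (fun c => _) = (fun c => g (inord c))) //;
    apply: functional_extensionality_dep => c; rewrite ffunE.
have := ER [ffun i => g i]; rewrite !ffunE => E.
by have := E; rewrite (_ : (fun c => _) = (fun c => g (inord c))) //;
  apply: functional_extensionality_dep => c; rewrite ffunE.
Qed.

End FreeMonoid.

Lemma proper_sub (W W' : mclass) : proper_subclass W varN -> subclass W' W ->
  proper_subclass W' varN.
Proof.
move=> [WN nWN] W'W; split=> [M /W'W/WN //|E]; apply: nWN => M; split; first exact: WN.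
by move/E/W'W.
Qed.

Lemma proper_finitely_based W : is_variety W -> proper_subclass W varN -> finitely_based W.
Proof.
move=> Wv Wp; pose K := [set e | e \in key_ids /\ theory W e].
exists ([set` base_ids] `|` K); split.
  rewrite finite_setU; split; first exact: finite_seq.
  by apply: sub_finite_set (finite_seq key_ids) => e [].
have WN := Wp.1; move=> M; split=> [WM e [eb|[_ We]]|MS].
- by apply: (baseP _).1 (varN_base (WN _ WM)) _ eb.
- exact: We.
- apply: determinacy => // [|e ek We]; first by apply/baseP => e eb; apply: MS; left.
  by apply: MS; right.
Qed.

Lemma proper_small W : is_variety W -> proper_subclass W varN -> small W.
Proof.
move=> Wv Wp; pose I : finType := {set 'I_10}.
pose F (i : 'I_#|I|) : mclass := fun M => base M /\
  forall j : 'I_10, j \in (enum_val i : I) -> satisfies M (nth ([::], [::]) key_ids j).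
exists #|I|, F => W' W'v W'W; have W'p := proper_sub Wp W'W.
pose S : I := [set j : 'I_10 | `[< theory W' (nth ([::], [::]) key_ids j) >]]%SET.
exists (enum_rank S) => M; rewrite /F enum_rankK; split=> [WM|[Mb MS]].
  split=> [|j]; first exact: (varN_base (W'p.1 _ WM)).
  by rewrite inE => /asboolP; apply.
apply: determinacy => // e ek We.
have j10 : (index e key_ids < 10)%N by rewrite (@index_mem _ e key_ids).
have := MS (Ordinal j10); rewrite inE /= nth_index //; apply.
exact/asboolP.
Qed.

(** The key identities use the letters 0 to 3, so rank four suffices for the free monoid to satisfy
    no more of them than [W] does; [determinacy] for the variety it generates gives the inclusion of
    [W]. *)
Lemma proper_finitely_generated W : is_variety W -> proper_subclass W varN ->
  finitely_generated W.
Proof.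
move=> Wv Wp; exists (free_monoid W 4); split; first exact: free_finite (Wp.1).
move=> M; split=> [WM|]; last first.
  by apply=> // _ ->; exact: free_in.
have sub : subclass (var_of (free_monoid W 4)) W.
  by move=> G; apply=> // _ ->; exact: free_in.
apply: (determinacy (var_gen_variety _) (proper_sub Wp sub)).
  exact: varN_base (Wp.1 _ WM).
move=> e ek We; apply: (@free_theory W 4) => //.
  by apply: (allP (_ : all (fun e => all (fun c => c < 4)%N (e.1 ++ e.2)) key_ids)).
by apply: We; apply/var_ofP.
Qed.

Lemma varN_finitely_generated : finitely_generated varN.
Proof.
pose F (i : bool) : monoidType :=
  if i then (A_monoid : monoidType) else (R_monoid : monoidType).
exists (dprod_monoid F); split.
  apply: (@inj_finite_set _ (A_monoid * R_monoid)%type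
    (fun x : dprod_monoid F => (x true, x false)) 1) => x y [E1 E2].
  by apply: functional_extensionality_dep; case.
have DE e : satisfies (dprod_monoid F) e <-> satisfies A_monoid e /\ satisfies R_monoid e.
  split=> [De|[Ae Re] h]; last first.
    by apply: functional_extensionality_dep => i; rewrite !eval_dprod; case: i; [apply:
      Ae|apply: Re].
  split=> h.
    pose h' c : dprod_monoid F := fun i => if i is true then h c else 1.
    by have := congr1 (fun x : dprod_monoid F => x true) (De h'); rewrite !eval_dprod.
  pose h' c : dprod_monoid F := fun i => if i is false then h c else 1.
  by have := congr1 (fun x : dprod_monoid F => x false) (De h'); rewrite !eval_dprod.
move=> M; split=> [/varNP MN|/var_ofP MD].
  by apply/var_ofP => e /DE[]; exact: MN.
by apply/varNP => e Ae Re; apply: MD; apply/DE.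
Qed.

(** * Absence of a finite basis *)

(* The letters 0, 1, 2 and i + 3 stand for x, y, t and z_i, so that the identity
   below is x y t y z_0^2 ... z_(n-1)^2 x = x y x t y z_0^2 ... z_(n-1)^2 x. *)
Definition squares (n : nat) : seq nat := flatten [seq [:: i.+3; i.+3] | i <- iota 0 n].

Definition nfb_lhs (n : nat) : seq nat := [:: 0; 1; 2; 1]%N ++ squares n ++ [:: 0%N].
Definition nfb_rhs (n : nat) : seq nat := [:: 0; 1; 0; 2; 1]%N ++ squares n ++ [:: 0%N].

(** As c and bc have square 0, a product of squares takes neither of these values; what remains is a
    finite check. *)
Lemma A_sat_nfb n : satisfies A_monoid (nfb_lhs n, nfb_rhs n).
Proof.
move=> h; rewrite /nfb_lhs /nfb_rhs /= !(eval_cons, eval_cat, eval_nil) !mulg1.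
have : ~~ A_has_c (eval h (squares n)).
  rewrite /squares; elim: (iota 0 n) => [|i l IH] /=; first by rewrite eval_nil.
  by rewrite !eval_cons; move: IH; case: (h i.+3); case: (eval _ _).
by case: (h 0%N); case: (h 1%N); case: (h 2%N); case: (eval _ _).
Qed.

Lemma R_sat_nfb n : satisfies R_monoid (nfb_lhs n, nfb_rhs n).
Proof.
move=> h; rewrite /nfb_lhs /nfb_rhs /= !(eval_cons, eval_cat, eval_nil) !mulg1.
have : match eval h (squares n) with R_a | R_ac => false | _ => true end.
  rewrite /squares; elim: (iota 0 n) => [|i l IH] /=; first by rewrite eval_nil.
  by rewrite !eval_cons; move: IH; case: (h i.+3); case: (eval _ _).
by case: (h 0%N); case: (h 1%N); case: (h 2%N); case: (eval _ _).
Qed.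

Lemma A_not_triv : ~ p_triv A_monoid. Proof. by move/(_ A_a). Qed.
Lemma A_not_band : ~ p_band A_monoid. Proof. by move/(_ A_c). Qed.

Lemma A_content (u v : seq nat) : satisfies A_monoid (u, v) -> u =i v.
Proof.
move=> uv c; apply/idP/idP => cin; apply: contrapT => /negP cn; apply: A_not_triv.
  exact: (derive_triv A_base uv cin cn).
exact: (derive_triv A_base (satisfies_sym uv) cin cn).
Qed.

Lemma A_once (u v : seq nat) c : satisfies A_monoid (u, v) ->
  count_mem c u = 1%N -> count_mem c v = 1%N.
Proof.
move=> uv cu; apply/eqP; rewrite eqn_leq leqNgt -has_count has_pred1 -(A_content uv).
rewrite -has_pred1 has_count cu andbT; apply/negP => cv.
exact: (A_not_band (derive_band A_base uv cu cv)).
Qed.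

(** With p = b, q = a and the other letters erased, u placed between b and a has the value b a,
    while a p after a q in [w] produces a b = 0. *)
Lemma A_precede (u w U1 U2 w1 w2 : seq nat) p q : satisfies A_monoid (w, u) ->
  p != q -> u = U1 ++ U2 -> q \notin U1 -> p \notin U2 ->
  w = w1 ++ q :: w2 -> p \notin w2.
Proof.
move=> wu pq uE qU1 pU2 wE; apply/negP => /split_mem[w3 [w4 [w2E pw3]]].
pose g := assign2 p A_b q A_a 0 A_1.
have one (l : seq nat) : 0%N \notin l \/ A_1 = 1 by right.
have gp : g p = A_b by rewrite /g /assign2 eqxx.
have gq : g q = A_a by rewrite /g /assign2 eq_sym (negPf pq) eqxx.
have := congr1 (fun z => A_b * z * A_a) (wu g).
rewrite /= wE w2E uE !(eval_cat, eval_cons) gp gq -!mulgA (mulgA A_a).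
have [-> _] := @eval_idem A_monoid A_a g w3 erefl (assign2y _ _ _ (one w3) pw3).
have [E1 _] := @eval_idem A_monoid A_b g U1 erefl (assign2x _ _ _ (one U1) qU1).
have [_ E2] := @eval_idem A_monoid A_a g U2 erefl (assign2y _ _ _ (one U2) pU2).
rewrite (mulgA A_a A_b) -[A_a * A_b]/A_0 A_mul0l !A_mul0r (mulgA A_b (eval g U1)) E1 E2.
by [].
Qed.

Lemma mem_squares n c : (c \in squares n) = (2 < c < n.+3)%N.
Proof.
apply/flatten_mapP/idP => [[i]|/andP[c2 cn]].
  rewrite mem_iota /= add0n => ilt; rewrite !inE orbb => /eqP ->.
  by rewrite /= !ltnS.
case: c c2 cn => [|[|[|c]]] // _; rewrite !ltnS => cn.
by exists c; rewrite ?mem_iota ?inE ?eqxx.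
Qed.

Lemma squares_split n j : (j < n)%N -> exists2 Z, squares n = squares j ++ Z & all (leq
  j.+3) Z.
Proof.
move=> jn; exists (flatten [seq [:: i.+3; i.+3] | i <- iota j (n - j)]).
  by rewrite /squares -flatten_cat -map_cat -iotaD subnKC // ltnW.
apply/allP => c /flatten_mapP[i]; rewrite mem_iota => /andP[ji _].
by rewrite !inE orbb => /eqP ->; rewrite !ltnS.
Qed.

Lemma squaresS m : squares m.+1 = squares m ++ [:: m.+3; m.+3].
Proof.
have E : iota 0 m.+1 = iota 0 m ++ [:: m] by rewrite -addn1 iotaD.
by rewrite /squares E map_cat flatten_cat.
Qed.

(** * Words equal to the left-hand side modulo N *)

Section Rigid.
Variables (m : nat) (w : seq nat).
Hypotheses (Aw : satisfies A_monoid (w, nfb_lhs m.+1))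
  (Rw : satisfies R_monoid (w, nfb_lhs m.+1)).

Lemma rigid_mem c : (c \in w) = (c < m.+4)%N.
Proof.
rewrite (A_content Aw) /nfb_lhs mem_cat mem_cat mem_squares !inE.
by case: c => [|[|[|c]]] //=; rewrite orbF.
Qed.

Lemma rigid_once : count_mem 2%N w = 1%N.
Proof.
have /count_memPn E : 2%N \notin squares m.+1 by rewrite mem_squares.
by apply: (A_once (satisfies_sym Aw)); rewrite /nfb_lhs 2!count_cat E.
Qed.

(** In the left-hand side all letters with a code below that of z_j, except x, come before z_j;
    [A_precede] carries this over to [w]. *)
Lemma rigid_precede c j w1 w2 : (j <= m)%N -> (0 < c)%N -> (c < j.+3)%N ->
  w = w1 ++ j.+3 :: w2 -> c \notin w2.
Proof.
move=> jn c0 cj; have [Z ZE Zj] := @squares_split m.+1 j jn.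
apply: (A_precede (U1 := [:: 0; 1; 2; 1]%N ++ squares j) (U2 := Z ++ [:: 0%N]) Aw).
- by rewrite neq_ltn cj.
- by rewrite /nfb_lhs ZE -!catA.
- by rewrite !(mem_cat, inE) mem_squares ltnn andbF.
- rewrite mem_cat inE negb_or -lt0n c0 andbT; apply/negP => /(allP Zj).
  by rewrite leqNgt cj.
Qed.

(* This is where A alone is not enough: it would allow another x to be inserted
   right after t. *)
Lemma rigid_x w0 w1 w2 : w = w0 ++ 2%N :: w1 ++ 0%N :: w2 -> 0%N \notin w1 ->
  m.+3 \in w1.
Proof.
move=> wE xw1; apply: contrapT => /negP zw1.
(* Here x = c, z_m = b and t = a. In the left-hand side b follows a before any c does, so its value
   is 0, whereas an x before any z_m after t would give [w] the value ac. *)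
pose g := assign2 0 R_c m.+3 R_b 2 R_a.
have [tw0] : 2%N \notin w0 /\ 2%N \notin w1 ++ 0%N :: w2.
  by apply: once_notin; rewrite -wE; exact: rigid_once.
rewrite mem_cat inE !negb_or => /and3P[tw1 _ tw2].
have zw0 : m.+3 \notin w0.
  apply/negP => /split_mem[w3 [w4 [w0E _]]].
  have : 2%N \notin w4 ++ 2%N :: w1 ++ 0%N :: w2.
    by apply: (@rigid_precede 2 m w3) => //; rewrite wE w0E -catA.
  by rewrite mem_cat mem_head orbT.
have Eg : eval g w = eval g (nfb_lhs m.+1) := Rw g.
move: Eg; rewrite wE /nfb_lhs squaresS !(eval_cat, eval_cons, eval_nil).
have [_ E0] := @eval_idem R_monoid R_c g w0 erefl (assign2x _ _ _ (or_introl tw0) zw0).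
have -> : eval g w1 = R_1 by apply: assign2_1 => //; left.
have E2 : R_ac * eval g w2 = R_ac.
  have := @assign2P R_monoid 0 R_c m.+3 R_b 2 R_a w2 (or_introl tw2); rewrite -/g.
  elim: (w2) => [|c l IH] gl; first by rewrite eval_nil.
  rewrite eval_cons mulgA; case: (gl c (mem_head _ _)) => ->; rewrite IH // => d dl;
    by apply: gl; rewrite inE dl orbT.
have -> : g 2%N = R_a by [].
have -> : g 0%N = R_c by [].
rewrite -[R_a]/(R_c * R_a) -!mulgA (mulgA (eval g w0)) E0 mul1g (mulgA R_a) (mulgA R_c) E2.
have -> : eval g (squares m) = 1.
  apply: eval_all1 => c; rewrite mem_squares => /andP[c2 cm].
  rewrite /g /assign2 (gtn_eqF (ltn_trans _ c2)) //.
  by rewrite (ltn_eqF cm) (gtn_eqF c2).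
have -> : g m.+3 = R_b by rewrite /g /assign2 /= eqxx.
by [].
Qed.

(** The letter d after the last z_i cannot have a lower nonzero code, by A, nor a code above that of
    z_(i+1), which is still to come. It cannot be x either: by [rigid_x] a z_m would lie between t
    and that x, hence before the last z_i. *)
Lemma rigid_factor i : (i < m)%N -> exists X Y, w = X ++ i.+3 :: i.+4 :: Y.
Proof.
move=> im; have iw : i.+3 \in w by rewrite rigid_mem !ltnS ltnW // ltnW.
have [X [Y [wE iY]]] := split_last iw.
have jY : i.+4 \in Y.
  have : i.+4 \in w by rewrite rigid_mem !ltnS.
  rewrite wE mem_cat inE eqn_leq ltnn /= => /orP[/split_mem[w1 [w2 [XE _]]]|//].
  have : i.+3 \notin w2 ++ i.+3 :: Y.
    by apply: (@rigid_precede _ i.+1 w1) => //; rewrite wE XE -catA.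
  by rewrite mem_cat mem_head orbT.
case: Y wE iY jY => [//|d Y] wE iY jY; exists X, Y; suff -> : i.+4 = d by [].
move: jY; rewrite inE => /predU1P[//|jY].
case: (eqVneq d i.+4) => [-> //|dne]; exfalso.
have dm : (d < m.+4)%N by rewrite -rigid_mem wE mem_cat !inE eqxx !orbT.
have dlow : (0 < d)%N -> (i.+3 <= d)%N.
  move=> d0; rewrite leqNgt; apply/negP => di.
  have := rigid_precede (ltnW im) d0 di wE; by rewrite mem_head.
case: (posnP d) => [d0|/dlow di]; last first.
  have di' : (i.+3 < d)%N.
    rewrite ltn_neqAle di andbT; apply: contraNneq iY => ->; exact: mem_head.
  case: d {dlow} dm di di' wE iY dne => [|[|[|d]]] //; rewrite !ltnS => dm _ di' wE iY dne.
  move: di'; rewrite leq_eqVlt => /orP[/eqP dE|di'].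
    by rewrite dE eqxx in dne.
  have : i.+4 \notin Y.
    by apply: (@rigid_precede _ d (X ++ [:: i.+3])) => //; rewrite wE -catA.
  by rewrite jY.
have tX : 2%N \in X.
  have : 2%N \in w by rewrite rigid_mem.
  rewrite wE mem_cat inE => /or3P[//|//|tY].
  by have := rigid_precede (ltnW im) (c := 2%N) isT isT wE; rewrite tY.
have [w0 [w1 [XE tw0]]] := split_mem tX.
have wE' : w = w0 ++ 2%N :: (w1 ++ i.+3 :: 0%N :: Y) by rewrite wE XE d0 -catA.
have x1 : 0%N \in w1 ++ i.+3 :: 0%N :: Y by rewrite !(mem_cat, inE) eqxx !orbT.
have [a1 [a2 [aE xa1]]] := split_mem x1.
have za1 : m.+3 \in a1 by apply: (@rigid_x w0 a1 a2) => //; rewrite wE' aE.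
have E : w1 ++ i.+3 :: 0%N :: Y = (w1 ++ [:: i.+3]) ++ 0%N :: Y by rewrite -catA.
have za : m.+3 \in w1.
  have sz : (size a1 <= size (w1 ++ [:: i.+3]))%N.
    have := congr1 (index 0%N) aE; rewrite [RHS]index_cat (negPf xa1) /= addn0 => <-.
    by rewrite E index_cat; case: ifP => _; rewrite ?index_size //= addn0.
  have : m.+3 \in take (size a1) (w1 ++ i.+3 :: 0%N :: Y) by rewrite aE take_size_cat.
  rewrite E takel_cat // => /mem_take; rewrite mem_cat inE => /orP[//|/eqP[mi]].
  by rewrite mi ltnn in im.
have [a3 [a4 [w1E _]]] := split_mem za.
have : i.+3 \notin a4 ++ i.+3 :: 0%N :: Y.
  by apply: (@rigid_precede _ m (w0 ++ 2%N :: a3)) => //; rewrite wE' w1E -!catA.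
by rewrite mem_cat mem_head orbT.
Qed.

End Rigid.

(** * Preservation of rigidity under short identities *)

Lemma factor_subst (phi : nat -> seq nat) p X c d Y : subst phi p = X ++ c :: d :: Y ->
  (exists l a b, l \in p /\ phi l = a ++ c :: d :: b) \/
  (exists l a, l \in p /\ phi l = rcons a c).
Proof.
elim: p X => [|l p IH] X; first by case: X.
rewrite subst_cons => E.
have [sX|sX] := leqP (size (phi l)) (size X).
  have /IH : subst phi p = drop (size (phi l)) X ++ c :: d :: Y.
    have := congr1 (drop (size (phi l))) E; rewrite drop_size_cat // drop_cat.
    by move: sX; rewrite leq_eqVlt => /orP[/eqP ->|->]; rewrite ?ltnn ?subnn ?drop0
      ?drop_size.
  case=> [[l' [a [b [l'p E']]]]|[l' [a [l'p E']]]].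
    by left; exists l', a, b; rewrite inE l'p orbT.
  by right; exists l', a; rewrite inE l'p orbT.
have E1 : phi l = X ++ take (size (phi l) - size X) (c :: d :: Y).
  have := congr1 (take (size (phi l))) E; rewrite take_size_cat // take_cat.
  by rewrite ltnNge (ltnW sX).
case k : (size (phi l) - size X)%N E1 => [|[|k']] /= E1.
- by move/eqP: k; rewrite subn_eq0 leqNgt sX.
- by right; exists l, X; split; [exact: mem_head|rewrite E1 -cats1].
- by left; exists l, X, (take k' Y); rewrite mem_head.
Qed.

Lemma cat_prefix (t : nat) A1 B1 V Z : A1 ++ t :: B1 = V ++ Z -> t \notin Z ->
  exists r, V = A1 ++ t :: r.
Proof.
elim: V A1 => [|c V IH] A1 /=; first by move=> <-; rewrite mem_cat mem_head orbT.
case: A1 => [[-> _] _|a A1 [-> /IH H] /H[r ->]]; first by exists V.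
by exists r.
Qed.

(** x goes to b and y to a; since a b = 0, the value is 0 exactly when some x follows some y. *)
Definition theta (c : nat) : A_monoid := nth A_1 [:: A_b; A_a] c.

Lemma theta_nz w : ~~ A_has_c (eval theta w).
Proof.
elim: w => [|c w IH]; first by rewrite eval_nil.
by rewrite eval_cons; move: IH; case: c => [|[|[|c]]]; case: (eval _ w).
Qed.

Lemma theta_b w : 1%N \notin w -> A_in_b (eval theta w).
Proof.
elim: w => [|c w IH]; first by rewrite eval_nil.
rewrite inE negb_or eval_cons => /andP[c1 /IH].
by case: c c1 => [|[|[|c]]] // _; case: (eval _ w).
Qed.

Lemma theta_a w : 0%N \notin w -> A_in_a (eval theta w).
Proof.
elim: w => [|c w IH]; first by rewrite eval_nil.
rewrite inE negb_or eval_cons => /andP[c1 /IH].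
by case: c c1 => [|[|[|c]]] // _; case: (eval _ w).
Qed.

(* The words equivalent to nfb_lhs modulo N in which no x lies between the
   first y and t. *)
Definition rigid_set (m : nat) (w : seq nat) : Prop :=
  [/\ satisfies A_monoid (w, nfb_lhs m.+1), satisfies R_monoid (w, nfb_lhs m.+1) &
      forall w0 w1, w = w0 ++ 2%N :: w1 -> eval theta w0 <> A_0].

(** Some letter l of [p] covers a factor z_i z_(i+1) and is simple in [p], hence in [q]. With a
    value involving c for l, A compares what precedes this factor on the two sides: an x between y
    and t would make it 0 for [q], but it is not 0 for [p]. *)
Lemma rigid_set_subst m (phi : nat -> seq nat) p q :
  satisfies A_monoid (p, q) -> satisfies R_monoid (p, q) -> (size p < m)%N ->
  rigid_set m (subst phi p) -> rigid_set m (subst phi q).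
Proof.
move=> Apq Rpq pm [Aw Rw nz].
have Aw' : satisfies A_monoid (subst phi q, nfb_lhs m.+1).
  by move=> h; rewrite -(Aw h) /= !eval_subst; exact/esym/Apq.
have Rw' : satisfies R_monoid (subst phi q, nfb_lhs m.+1).
  by move=> h; rewrite -(Rw h) /= !eval_subst; exact/esym/Rpq.
split=> // w0 w1 wE.
have [i [l [a [b [im lp phil]]]]] : exists i l a b,
    [/\ (i < m)%N, l \in p & phi l = a ++ i.+3 :: i.+4 :: b].
  (* Pigeonhole: otherwise each of z_0, ..., z_(m-1) ends the image of a letter of [p], and [p] has
     fewer than m letters. *)
  apply: contrapT => none.
  have lasts : {subset [seq i.+3 | i <- iota 0 m] <= [seq last 0%N (phi l) | l <- p]}.
    move=> c /mapP[i]; rewrite mem_iota /= add0n => im ->.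
    have [X [Y wXY]] := rigid_factor Aw Rw im.
    case: (factor_subst wXY) => [[l [a [b [lp phil]]]]|[l [a [lp phil]]]].
      by case: none; exists i, l, a, b.
    by apply/mapP; exists l => //; rewrite phil last_rcons.
  have := uniq_leq_size _ lasts; rewrite !size_map size_iota leqNgt pm => H.
  by have := H (_ : uniq _); rewrite map_inj_uniq ?iota_uniq // => [/(_ isT)//|x y []].
have [p1 [p2 [pE lp1]]] := split_mem lp.
have wpre : subst phi p = (subst phi p1 ++ a) ++ i.+3 :: i.+4 :: (b ++ subst phi p2).
  by rewrite pE subst_cat subst_cons phil; norm_cat.
(* A second l would bring a z_i after a z_(i+1). *)
have lp2 : l \notin p2.
  apply/negP => /split_mem[p3 [p4 [p2E _]]].
  have : i.+3 \notin b ++ subst phi p2.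
    apply: (@rigid_precede m _ Aw i.+3 i.+1 ((subst phi p1 ++ a) ++ [:: i.+3])) => //.
    by rewrite wpre; norm_cat.
  by rewrite p2E subst_cat subst_cons phil !(mem_cat, inE) eqxx !orbT.
(* Images are evaluated by [theta], except that in the image of l the factor z_i z_(i+1) becomes
   c. *)
pose g c := if c == l then eval theta a * A_c * eval theta b else eval theta (phi c).
have gE (r : seq nat) : l \notin r -> eval g r = eval theta (subst phi r).
  move=> lr; rewrite eval_subst; apply: eq_in_eval => c cr; rewrite /g.
  by case: eqP => // cl; rewrite -cl cr in lr.
have gl : g l = eval theta a * A_c * eval theta b by rewrite /g eqxx.
have cp : count_mem l p = 1%N by rewrite pE count_once.
have lq : l \in q by rewrite -(A_content Apq).
have [q1 [q2 [qE lq1]]] := split_mem lq.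
have lq2 : l \notin q2.
  by have := A_once Apq cp; rewrite qE => /once_notin[].
have := Apq g; rewrite /= pE qE !eval_cat !eval_cons gl !gE //.
(* Up to t this is the hypothesis on the word; beyond t there is no x before the factor, since
   [rigid_x] would put a z_m before z_i. *)
have pre_nz : eval theta (subst phi p1 ++ a) <> A_0.
  have tin : 2%N \in subst phi p1 ++ a.
    have : 2%N \in subst phi p by rewrite (rigid_mem Aw).
    rewrite wpre mem_cat => /orP[//|]; rewrite inE /= => tin.
    have : 2%N \notin i.+4 :: (b ++ subst phi p2).
      by apply: (@rigid_precede m _ Aw 2 i (subst phi p1 ++ a)) => //; exact: ltnW.
    by rewrite tin.
  have [w2 [w3 [preE tw2]]] := split_mem tin.
  have /nz nz2 : subst phi p = w2 ++ 2%N :: (w3 ++ i.+3 :: i.+4 :: (b ++ subst phi p2)).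
    by rewrite wpre preE -catA.
  have xw3 : 0%N \notin w3.
    apply/negP => /split_mem[w4 [w5 [w3E xw4]]].
    have : m.+3 \in w4.
      apply: (@rigid_x m _ Aw Rw w2 w4 (w5 ++ i.+3 :: i.+4 :: (b ++ subst phi p2))) => //.
      by rewrite wpre preE w3E; norm_cat.
    case/split_mem=> w6 [w7 [w4E _]].
    have : i.+3 \notin (w7 ++ 0%N :: w5) ++ i.+3 :: i.+4 :: (b ++ subst phi p2).
      apply: (@rigid_precede m _ Aw i.+3 m (w2 ++ 2%N :: w6)) => //.
      by rewrite wpre preE w3E w4E; norm_cat.
    by rewrite mem_cat mem_head orbT.
  rewrite preE eval_cat eval_cons; move: nz2 (theta_nz w2) (theta_a xw3).
  by case: (eval _ w2); case: (eval _ w3).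
have post_b : A_in_b (eval theta (b ++ subst phi p2)).
  apply: theta_b; apply/negP => yb.
  have : 1%N \notin i.+4 :: (b ++ subst phi p2).
    by apply: (@rigid_precede m _ Aw 1 i (subst phi p1 ++ a)) => //; exact: ltnW.
  by rewrite inE yb orbT.
have -> : eval theta (subst phi p1) * (eval theta a * A_c * eval theta b * eval theta
  (subst phi p2)) =
   eval theta (subst phi p1 ++ a) * A_c * eval theta (b ++ subst phi p2).
  by rewrite !eval_cat !mulgA.
have -> : eval theta (subst phi q1) * (eval theta a * A_c * eval theta b * eval theta
  (subst phi q2)) =
   eval theta (subst phi q1 ++ a) * A_c * eval theta (b ++ subst phi q2).
  by rewrite !eval_cat !mulgA.
move=> Eg w00.
have wq : subst phi q = (subst phi q1 ++ a) ++ i.+3 :: i.+4 :: (b ++ subst phi q2).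
  by rewrite qE subst_cat subst_cons phil; norm_cat.
have tn : 2%N \notin i.+3 :: i.+4 :: (b ++ subst phi q2).
  rewrite inE negb_or /=.
  by apply: (@rigid_precede m _ Aw' 2 i (subst phi q1 ++ a)) => //; exact: ltnW.
have [|r rE] := @cat_prefix 2 w0 w1 (subst phi q1 ++ a) _ _ tn; first by rewrite -wE wq.
have z0 : eval theta (subst phi q1 ++ a) = A_0 by rewrite rE eval_cat w00 A_mul0l.
move: Eg; rewrite z0 !A_mul0l.
move: pre_nz (theta_nz (subst phi p1 ++ a)) post_b.
by case: (eval _ (_ ++ a)); case: (eval _ (b ++ _)).
Qed.

Lemma nfb_lhs_rigid m : rigid_set m (nfb_lhs m.+1).
Proof.
split=> // w0 w1 E.
have tn : 2%N \notin [:: 1%N] ++ squares m.+1 ++ [:: 0%N].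
  by rewrite mem_cat mem_cat mem_squares.
have [r] := @cat_prefix 2 w0 w1 [:: 0; 1; 2]%N _ (esym E) tn.
case: w0 {E} => [|c0 [|c1 [|c2 w0]]] //= [] //.
- by move=> <- <- _; eval_word.
- by case: w0.
Qed.

Lemma nfb_rhs_not_rigid m : ~ rigid_set m (nfb_rhs m.+1).
Proof.
by case=> _ _ /(_ [:: 0; 1; 0]%N (1%N :: squares m.+1 ++ [:: 0%N])) /(_ erefl); apply;
  eval_word.
Qed.

(** The syntactic congruence of [rigid_set m]. *)
Definition rigid_rel m (u v : seq nat) : Prop :=
  forall P Q, rigid_set m (P ++ u ++ Q) <-> rigid_set m (P ++ v ++ Q).

(** For m large compared with a finite basis, the syntactic monoid satisfies the basis and so lies
    in N; but then it satisfies the long identity, which relates a word of the rigid set to a word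
    outside it. *)
Lemma varN_not_finitely_based : ~ finitely_based varN.
Proof.
case=> Sigma [/finite_seqP[s SE] NS].
(* Two of the three units account for the letters that stand for the context, the third makes the
   inequality strict. *)
pose m := (\max_(e <- s) maxn (size e.1) (size e.2)).+3.
have rxx u : rigid_rel m u u by move=> P Q.
have rsym u v : rigid_rel m u v -> rigid_rel m v u by move=> uv P Q; symmetry; exact: uv.
have rtr u v w : rigid_rel m u v -> rigid_rel m v w -> rigid_rel m u w.
  by move=> uv vw P Q; apply: iff_trans (uv P Q) (vw P Q).
have rcat u u' v v' : rigid_rel m u u' -> rigid_rel m v v' -> rigid_rel m (u ++ v) (u' ++
  v').
  move=> uu vv P Q; have := uu P (v ++ Q); have := vv (P ++ u') Q.
  by norm_cat => H1 H2; apply: iff_trans H2 H1.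
pose S : monoidType := qmonoid rxx rsym rtr rcat.
have NA : varN A_monoid by apply/varNP.
have NR : varN R_monoid by apply/varNP.
have NSS : varN S.
  apply/NS => e; rewrite SE /= => es; apply/qmonoid_satisfies => phi P Q.
  have [Ae Re] : satisfies A_monoid e /\ satisfies R_monoid e.
    by split; [move/NS: NA|move/NS: NR]; apply; rewrite SE.
  have esz : (maxn (size e.1) (size e.2) <= \max_(e <- s) maxn (size e.1) (size e.2))%N.
    by rewrite (big_rem e es) leq_maxl.
  (* The context is absorbed into the substitution by two new letters, with the letters of the
     identity shifted by 2. *)
  pose phi' c := if c is c'.+2 then phi c' else if c is 0 then P else Q.
  pose ctx (w : seq nat) := 0%N :: map (fun c => c.+2) w ++ [:: 1%N].
  have ctxE w : P ++ subst phi w ++ Q = subst phi' (ctx w).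
    rewrite /ctx subst_cons subst_cat subst_cons /=.
    congr (_ ++ _ ++ _); last by rewrite cats0.
    by rewrite /subst -map_comp.
  have sctx w : size (ctx w) = (size w).+2 by rewrite /= size_cat size_map addn1.
  have sat G : satisfies G e -> satisfies G (ctx e.1, ctx e.2).
    move=> Ge h /=; rewrite !eval_cons !eval_cat.
    have E w : eval h (map (fun c => c.+2) w) = eval (fun c => h c.+2) w.
      by rewrite /eval big_map.
    by rewrite !E Ge.
  have [le1 le2] : ((size e.1).+2 < m)%N /\ ((size e.2).+2 < m)%N.
    by move: esz; rewrite geq_max /m !ltnS => /andP[].
  rewrite !ctxE; split; apply: rigid_set_subst; rewrite ?sctx //;
    try exact: sat; apply: satisfies_sym; exact: sat.
have /qmonoid_satisfies/(_ (fun c => [:: c])) /(_ [::] [::]) :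
    satisfies S (nfb_lhs m.+1, nfb_rhs m.+1).
  by move/varNP: NSS; apply; [exact: A_sat_nfb|exact: R_sat_nfb].
have idE w : subst (fun c => [:: c]) w = w by elim: w => // c w IH; rewrite subst_cons IH.
rewrite !idE /= !cats0 => -[/(_ (nfb_lhs_rigid m)) H _].
exact: (nfb_rhs_not_rigid H).
Qed.

Theorem proposition3p25 :
  is_variety varN /\ ~ finitely_based varN /\ finitely_generated varN /\
  almost_cross varN.
Proof.
split; first exact: var_gen_variety.
split; first exact: varN_not_finitely_based.
split; first exact: varN_finitely_generated.
split=> [[/varN_not_finitely_based]//|W Wv Wp].
split.
- exact: proper_finitely_based.
- exact: proper_finitely_generated.
- exact: proper_small.
Qed.
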